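(* The two groups $\mathrm{Homeo}_{(1,\infty)}(M,\xi)$ and $\mathrm{Homeo}_\infty(M,\xi)$ of contact homeomorphisms coincide.
   Context: Setting. $M$ is a closed (compact, without boundary), connected smooth manifold of dimension $2n+1$ with a cooriented contact structure $\xi=\ker\alpha$, where $\alpha$ is a fixed contact form, and $\nu_\alpha=\alpha\wedge(d\alpha)^n$ is the induced volume form. $\mathrm{Diff}(M,\xi)$ is the group of diffeomorphisms $\phi$ with $\phi^*\alpha=e^{g}\alpha$ for a smooth function $g$ on $M$. A smooth contact isotopy is a smooth isotopy $\Phi=\{\phi_t\}_{0\le t\le1}$ in $\mathrm{Diff}(M,\xi)$ with $\phi_0=\mathrm{id}$; if $\frac{d}{dt}\phi_t=X_t\circ\phi_t$, its Hamiltonian is $H_t=\alpha(X_t)$. This is a bijection between smooth contact isotopies and smooth functions $H\colon[0,1]\times M\to\mathbb R$; one writes $\Phi=\Phi_H=\{\phi_H^t\}$. Its conformal factor is the function $h$ with $(\phi_H^t)^*\alpha=e^{h_t}\alpha$, and $(\Phi_H,H,h)$ is called a smooth contact dynamical system. Norms. For a function $H$ on $M$, $\|H\|=\max_M H-\min_M H+\left|\frac{1}{\int_M\nu_\alpha}\int_M H\,\nu_\alpha\right|$. For $H\colon[0,1]\times M\to\mathbb R$, $\|H\|_{(1,\infty)}=\int_0^1\|H_t\|\,dt$ and $\|H\|_\infty=\max_{0\le t\le1}\|H_t\|$. Topological and continuous systems. A triple $(\Phi,H,h)$ of a continuous isotopy of homeomorphisms $\Phi$ and functions $H,h\colon[0,1]\times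 M\to\mathbb R$ is a topological contact dynamical system if there are smooth contact dynamical systems $(\Phi_{H_i},H_i,h_i)$ with $\Phi_{H_i}\to\Phi$ uniformly, $h_i\to h$ uniformly, and $\|H-H_i\|_{(1,\infty)}\to0$ ($H$ being an element of $L^1([0,1],C^0(M))$). It is a continuous contact dynamical system if there is such a sequence with $\|H-H_i\|_\infty\to0$ instead. The isotopy $\Phi$ is then written $\Phi_H=\{\phi_H^t\}$ and its time-one map is $\phi_H^1$. $\mathrm{Homeo}_{(1,\infty)}(M,\xi)$ is the group of time-one maps of topological contact dynamical systems, and $\mathrm{Homeo}_\infty(M,\xi)$ is the group of time-one maps of continuous contact dynamical systems. *)

(* Defs.v *)
From HB Require Import structures.
From mathcomp Require Import all_boot all_order all_algebra all_fingroup.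
From mathcomp Require Import all_classical all_reals all_analysis.

Set Implicit Arguments.
Unset Strict Implicit.
Unset Printing Implicit Defensive.

Import Order.TTheory GRing.Theory Num.Theory.
Import numFieldNormedType.Exports.

Local Open Scope classical_set_scope.
Local Open Scope ring_scope.

(* Smoothness on an arbitrary set [A] means local extendability to maps all of
   whose iterated directional derivatives are differentiable on an open set.
   For open [A] this is the usual notion; on [0, 1] x U it is smoothness up to
   the boundary. *)
Definition smooth_on (R : realType) (V W : normedModType R) (A : set V)
    (f : V -> W) : Prop :=
  forall x, A x -> exists (O : set V) (g : V -> W),
    [/\ open O, O x,
        forall (vs : seq V) y, O y ->
          differentiable (foldr (fun v (k : V -> W) => 'D_v k) g vs) y
      & forall y, A y -> O y -> g y = f y].

(* A smooth atlas; [chart i] and [param i] are mutually inverse homeomorphisms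
   between the open sets [chart_dom i] and [chart_img i], with irrelevant values
   outside. *)
Record atlas (R : realType) (d : nat) (M : topologicalType) := Atlas {
  chart_index : Type;
  chart_dom : chart_index -> set M;
  chart_img : chart_index -> set 'rV[R]_d;
  chart : chart_index -> M -> 'rV[R]_d;
  param : chart_index -> 'rV[R]_d -> M;
  dom_open : forall i, open (chart_dom i);
  img_open : forall i, open (chart_img i);
  chart_to : forall i x, chart_dom i x -> chart_img i (chart i x);
  param_to : forall i y, chart_img i y -> chart_dom i (param i y);
  chartK : forall i x, chart_dom i x -> param i (chart i x) = x;
  paramK : forall i y, chart_img i y -> chart i (param i y) = y;
  chart_continuous : forall i x, chart_dom i x -> {for x, continuous (chart i)};
  param_continuous : forall i y, chart_img i y -> {for y, continuous (param i)};
  dom_cover : forall x, exists i, chart_dom i x;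
  transition_smooth : forall i j,
    smooth_on [set y | chart_img i y /\ chart_dom j (param i y)]
              (chart j \o param i)
}.

Section SmoothManifold.
Variables (R : realType) (d : nat) (M : topologicalType) (A : atlas R d M).

Definition smooth_fun (g : M -> R) : Prop :=
  forall i : chart_index A, smooth_on (chart_img i) (g \o param i).

Definition smooth_map (phi : M -> M) : Prop :=
  continuous phi /\
  forall i j : chart_index A,
    smooth_on [set y | chart_img i y /\ chart_dom j (phi (param i y))]
              (chart j \o phi \o param i).

Definition diffeomorphism (phi : M -> M) : Prop :=
  smooth_map phi /\
  exists psi : M -> M, [/\ smooth_map psi, cancel phi psi & cancel psi phi].

Definition smooth_path_of_maps (Phi : R -> M -> M) : Prop :=
  {within `[0, 1] `*` [set: M], continuous (fun p : R * M => Phi p.1 p.2)} /\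
  forall i j : chart_index A,
    smooth_on [set p : R * 'rV[R]_d |
                 [/\ `[0, 1]%classic p.1, chart_img i p.2
                   & chart_dom j (Phi p.1 (param i p.2))]]
              (fun p => chart j (Phi p.1 (param i p.2))).

Definition pairing (v : 'rV[R]_d) (w : 'cV[R]_d) : R := (v *m w) 0 0.

(* A differential 1-form is given by its component columns in the charts. *)
Definition one_form (a : chart_index A -> 'rV[R]_d -> 'cV[R]_d) : Prop :=
  (forall i, smooth_on (chart_img i) (a i)) /\
  forall i j y (v : 'rV[R]_d), chart_img i y -> chart_dom j (param i y) ->
    pairing v (a i y) =
    pairing ('D_v (chart j \o param i) y) (a j (chart j (param i y))).

(* phi^* a = e^g a *)
Definition conformal_factor (a : chart_index A -> 'rV[R]_d -> 'cV[R]_d)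
    (phi : M -> M) (g : M -> R) : Prop :=
  forall i j x (v : 'rV[R]_d), chart_dom i x -> chart_dom j (phi x) ->
    pairing ('D_v (chart j \o phi \o param i) (chart i x))
            (a j (chart j (phi x))) =
    expR (g x) * pairing v (a i (chart i x)).

Definition contact_diffeo (a : chart_index A -> 'rV[R]_d -> 'cV[R]_d)
    (phi : M -> M) : Prop :=
  diffeomorphism phi /\ exists g, smooth_fun g /\ conformal_factor a phi g.

Definition smooth_contact_isotopy (a : chart_index A -> 'rV[R]_d -> 'cV[R]_d)
    (Phi : R -> M -> M) : Prop :=
  [/\ smooth_path_of_maps Phi,
      forall t, `[0, 1]%classic t -> contact_diffeo a (Phi t)
    & forall x, Phi 0 x = x].

(* [v] represents d/dt phi_t(x) in the chart [j]; one-sided at t = 0, 1. *)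
Definition velocity (Phi : R -> M -> M) (j : chart_index A) (t : R) (x : M)
    (v : 'rV[R]_d) : Prop :=
  (s - t)^-1 *: (chart j (Phi s x) - chart j (Phi t x))
    @[s --> within `[0, 1]%classic t^'] --> v.

(* H_t = a(X_t), where X_t (phi_t x) = d/dt phi_t(x). *)
Definition hamiltonian (a : chart_index A -> 'rV[R]_d -> 'cV[R]_d)
    (Phi : R -> M -> M) (H : R -> M -> R) : Prop :=
  forall t x j, `[0, 1]%classic t -> chart_dom j (Phi t x) ->
    exists v, velocity Phi j t x v /\
      H t (Phi t x) = pairing v (a j (chart j (Phi t x))).

Definition smooth_contact_system (a : chart_index A -> 'rV[R]_d -> 'cV[R]_d)
    (Phi : R -> M -> M) (H h : R -> M -> R) : Prop :=
  [/\ smooth_contact_isotopy a Phi, hamiltonian a Phi H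
    & forall t, `[0, 1]%classic t -> conformal_factor a (Phi t) (h t)].

End SmoothManifold.

(* Iterated Lebesgue integral; for continuous integrands with compact support
   it is the integral with respect to Lebesgue measure on R^m. *)
Fixpoint integral_rV (R : realType) (m : nat) : ('rV[R]_m -> R) -> R :=
  match m with
  | 0 => fun f => f 0
  | m'.+1 => fun f => \int[@lebesgue_measure R]_t
      integral_rV (fun v : 'rV[R]_m' => f (row_mx (t%:M : 'rV[R]_1) v))
  end.

Section ContactManifold.
Variables (R : realType) (n : nat) (M : topologicalType).
Variable A : atlas R n.*2.+1 M.
Variable a : chart_index A -> 'rV[R]_n.*2.+1 -> 'cV[R]_n.*2.+1.

(* (da)(e_k, e_l) = d_k a_l - d_l a_k *)
Definition dform (i : chart_index A) (y : 'rV[R]_n.*2.+1)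
    (k l : 'I_n.*2.+1) : R :=
  'D_(delta_mx 0 k) (fun z => a i z l 0) y -
  'D_(delta_mx 0 l) (fun z => a i z k 0) y.

(* (a /\ (da)^n)(e_0, ..., e_2n), where a wedge of forms of degrees p_1, ..., p_r
   is the alternating sum over all permutations divided by p_1! ... p_r! *)
Definition volume_coef (i : chart_index A) (y : 'rV[R]_n.*2.+1) : R :=
  (2 ^+ n)^-1 * \sum_(s : 'S_n.*2.+1) (-1) ^+ s * a i y (s ord0) 0 *
    \prod_(k < n) dform i y (s (inord k.*2.+1)) (s (inord k.*2.+2)).

Definition contact_form : Prop :=
  one_form a /\ forall i y, chart_img i y -> volume_coef i y != 0.

Definition partition_of_unity
    (rho : seq {classic chart_index A * (M -> R)}) : Prop :=
  (forall p, p \in rho ->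
     [/\ continuous p.2, forall x, 0 <= p.2 x
       & closure [set x | p.2 x != 0] `<=` chart_dom p.1]) /\
  forall x, \sum_(p <- rho) p.2 x = 1.

(* The integral over M of [f] times the volume form a /\ (da)^n, with respect to
   the orientation that this form induces, which is why its absolute value
   appears. The result does not depend on the partition of unity. *)
Definition volume_integral (f : M -> R) : R :=
  \sum_(p <- xget [::] partition_of_unity)
    integral_rV (fun y => if y \in chart_img p.1 then
      p.2 (param p.1 y) * f (param p.1 y) * `|volume_coef p.1 y| else 0).

Definition mean (f : M -> R) : R :=
  (volume_integral (fun=> 1))^-1 * volume_integral f.

Definition contact_norm (f : M -> R) : R :=
  sup (range f) - inf (range f) + `|mean f|.

Definition norm_1oo (H : R -> M -> R) : \bar R :=
  (\int[@lebesgue_measure R]_(t in `[0%R, 1%R]) (contact_norm (H t))%:E)%E.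

Definition norm_oo (H : R -> M -> R) : R :=
  sup [set contact_norm (H t) | t in `[0, 1]].

End ContactManifold.

Section BochnerSpace.
Variables (R : realType) (M : topologicalType).

Definition simple_path (S : R -> M -> R) : Prop :=
  exists (m : nat) (E : 'I_m -> set R) (f : 'I_m -> M -> R),
    [/\ forall k, measurable (E k), forall k, continuous (f k)
      & forall t x, S t x = \sum_(k < m) \1_(E k) t * f k x].

(* Bochner integrability of t |-> H_t as a map from [0, 1] to C^0(M), for
   compact M: a.e. limit of simple maps, with integrable norm. *)
Definition L1C0 (H : R -> M -> R) : Prop :=
  exists S : nat -> R -> M -> R,
    [/\ forall k, simple_path (S k),
        {ae @lebesgue_measure R, forall t, `[0, 1]%classic t ->
           {uniform, (fun k => S k t) @ \oo --> H t}}
      & (\int[@lebesgue_measure R]_(t in `[0%R, 1%R])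
           (sup (range (fun x => `|H t x|%R)))%:E < +oo)%E].

End BochnerSpace.

Section ContactHomeomorphisms.
(* A compact Hausdorff space carries exactly one uniform structure inducing its
   topology, so uniform convergence here is that for any metric on M. *)
Variables (R : realType) (n : nat) (M : uniformType).
Variable A : atlas R n.*2.+1 M.
Variable a : chart_index A -> 'rV[R]_n.*2.+1 -> 'cV[R]_n.*2.+1.

Definition homeomorphism (phi : M -> M) : Prop :=
  continuous phi /\
  exists psi : M -> M, [/\ continuous psi, cancel phi psi & cancel psi phi].

Definition isotopy_of_homeos (Phi : R -> M -> M) : Prop :=
  {within `[0, 1] `*` [set: M], continuous (fun p : R * M => Phi p.1 p.2)} /\
  forall t, `[0, 1]%classic t -> homeomorphism (Phi t).

Definition cvg_uniformly (T : uniformType) (F_ : nat -> R -> M -> T)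
    (F : R -> M -> T) : Prop :=
  {uniform `[0, 1] `*` [set: M],
     (fun i (p : R * M) => F_ i p.1 p.2) @ \oo --> (fun p => F p.1 p.2)}.

Definition topological_contact_system (Phi : R -> M -> M)
    (H h : R -> M -> R) : Prop :=
  [/\ isotopy_of_homeos Phi, L1C0 H
    & exists (Phi_ : nat -> R -> M -> M) (H_ h_ : nat -> R -> M -> R),
      [/\ forall i, smooth_contact_system a (Phi_ i) (H_ i) (h_ i),
          cvg_uniformly Phi_ Phi,
          cvg_uniformly h_ h
        & norm_1oo a (fun t x => H t x - H_ i t x) @[i --> \oo] --> 0%E]].

(* The norm is a maximum over [0, 1] x M, so H is taken to be continuous, as a
   uniform limit of smooth Hamiltonians is. *)
Definition continuous_contact_system (Phi : R -> M -> M)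
    (H h : R -> M -> R) : Prop :=
  [/\ isotopy_of_homeos Phi,
      {within `[0, 1] `*` [set: M], continuous (fun p : R * M => H p.1 p.2)}
    & exists (Phi_ : nat -> R -> M -> M) (H_ h_ : nat -> R -> M -> R),
      [/\ forall i, smooth_contact_system a (Phi_ i) (H_ i) (h_ i),
          cvg_uniformly Phi_ Phi,
          cvg_uniformly h_ h
        & norm_oo a (fun t x => H t x - H_ i t x) @[i --> \oo] --> 0]].

Definition Homeo_1oo : set (M -> M) :=
  [set phi | exists Phi H h, topological_contact_system Phi H h /\ Phi 1 = phi].

Definition Homeo_oo : set (M -> M) :=
  [set phi | exists Phi H h, continuous_contact_system Phi H h /\ Phi 1 = phi].

End ContactHomeomorphisms.

(* Main.v *)
(** Only the inclusion of Homeo_(1,oo) in Homeo_oo is hard; for the other one the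
    system is unchanged, a continuous path of functions being Bochner integrable.

    Let smooth systems (Phi_k, H_k, h_k) converge to a topological system. After
    passing to a subsequence, the L^1 norms of H_{k+1} - H_k decrease like 4^-k.
    Put t_k = 1 - 2^-(k+1). Run Phi_0 during [0, t_0] and then compose on the
    right, during [t_k, t_{k+1}], with the increment (Phi_k^s)^-1 Phi_{k+1}^s,
    where s = z_k(t) grows from 0 to 1. Up to a bounded conformal factor, the
    Hamiltonian of the k-th piece is z_k' times H_{k+1} - H_k at time z_k. The
    time change z_k is slow where the norm of H_{k+1} - H_k is large, which turns
    its integral into a pointwise bound of order 2^-k. The Hamiltonians of the
    concatenated smooth isotopies are thus uniformly Cauchy, and they extend
    continuously by 0 to t = 1, where the isotopies end at the given time-one
    map. *)

From HB Require Import structures.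
Require Import Defs.
From mathcomp Require Import all_boot all_order all_algebra.
From mathcomp Require Import all_classical all_reals all_analysis.
From mathcomp Require Import measurable_realfun ring lra.

Set Implicit Arguments.
Unset Strict Implicit.
Unset Printing Implicit Defensive.

Import Order.TTheory GRing.Theory Num.Theory.
Import numFieldNormedType.Exports.

Local Open Scope classical_set_scope.
Local Open Scope ring_scope.

(** Composing on the right keeps the estimates uniform: a new factor adds to the Hamiltonian only
    its own Hamiltonian, moved by a homeomorphism and multiplied by a conformal factor, so its
    supremum grows at most by a constant depending on the bound for the [h_k]. At the end of a piece
    the increment is [(Phi_k^1)^-1 Phi_{k+1}^1], and the product telescopes to [Phi_{k+1}^1]. In
    between, the increment is close to the identity, because the [Phi_k^s] are uniformly close and
    the inverses of the limit are equicontinuous. This controls the isotopies and the conformal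
    factors near [t = 1]. The rate [4^-k] has to beat the length [2^-(k+2)] of the interval, since
    the time change costs a division by that length. No flow is integrated: all isotopies come from
    given ones by composition, inversion and smooth changes of time with values in [[0, 1]]. These
    also turn paths smooth up to the ends of [[0, 1]] into paths smooth on [R]. The price is that
    inverses must be shown smooth jointly in time and space. Moreover, the integrand in [norm_1oo]
    is not known to be measurable; measurability is established only for supremum norms away from a
    null set. *)

Lemma continuous_fst (T U : topologicalType) : continuous (@fst T U).
Proof. by move=> p; exact: cvg_fst. Qed.

Lemma continuous_snd (T U : topologicalType) : continuous (@snd T U).
Proof. by move=> p; exact: cvg_snd. Qed.

Lemma continuous_pair_at (T U V : topologicalType) (f : T -> U) (g : T -> V) x :
  {for x, continuous f} -> {for x, continuous g} ->
  {for x, continuous (fun y => (f y, g y))}.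
Proof.
by rewrite /prop_for /continuous_at => cf cg; exact: (cvg_pair cf cg).
Qed.

Lemma continuous_within_comp (T U V : topologicalType) (B : set U) (f : U -> V) (g : T -> U) x :
  {within B, continuous f} -> (forall y, B (g y)) -> {for x, continuous g} ->
  {for x, continuous (f \o g)}.
Proof.
move=> /subspace_continuousP cf gB cg.
apply: (@cvg_comp _ _ _ g f _ (within B (nbhs (g x)))); last exact: (cf _ (gB x)).
move=> P nP; have H : nbhs x (g @^-1` (fun y => B y -> P y)) := cg _ nP.
by change (nbhs x (g @^-1` P)); apply: filterS H => y; exact: (@^~ (gB y)).
Qed.

Section RealContinuity.
Variables (R : realType) (T : topologicalType) (f g : T -> R) (x : T).
Hypotheses (cf : {for x, continuous f}) (cg : {for x, continuous g}).

Lemma contD : {for x, continuous (fun y => f y + g y)}.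
Proof. exact: (continuousD cf cg). Qed.

Lemma contB : {for x, continuous (fun y => f y - g y)}.
Proof. exact: (continuousB cf cg). Qed.

Lemma contM : {for x, continuous (fun y => f y * g y)}.
Proof. exact: (continuousM cf cg). Qed.

End RealContinuity.

(* Retracts R onto [0, 1], so that data known on [0, 1] only become functions on R. *)
Definition clamp (R : realType) (t : R) : R := Num.max 0 (Num.min t 1).

Lemma clamp01 (R : realType) (t : R) : `[0, 1]%classic (clamp t).
Proof. by rewrite /= in_itv /= /clamp le_max lexx /= ge_max ler01 /= ge_min lexx orbT. Qed.

Lemma clamp_id (R : realType) (t : R) : `[0, 1]%classic t -> clamp t = t.
Proof.
rewrite /= in_itv /= => /andP[t0 t1].
by rewrite /clamp (min_l t1) (max_r t0).
Qed.

Lemma clamp_continuous (R : realType) : continuous (@clamp R).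
Proof.
move=> t; apply: (@continuous_max R R (fun=> 0) (fun t => Num.min t 1)); first exact: cvg_cst.
by apply: (@continuous_min R R id (fun=> 1)); [exact: cvg_id|exact: cvg_cst].
Qed.

(** * Iterated directional derivatives *)

Section Ck.
Variable R : realType.
Implicit Types V W U : normedModType R.

Lemma near_eq_differentiable V W (f g : V -> W) x :
  (\forall y \near x, f y = g y) -> differentiable f x -> differentiable g x.
Proof.
move=> fg df; have fgx := nbhs_singleton fg.
suff H : continuous ('d f x) /\ g \o shift x = cst (g x) + 'd f x +o_ 0 id.
  by apply/diff_locallyP; rewrite (diff_unique (proj1 H) (proj2 H)).
split; first exact: diff_continuous.
apply/eqaddoP => e e0.
have /eqaddoP/(_ e e0) H := diff_locally df.
have fg0 : \forall y \near (0:V), f (y + x) = g (y + x).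
  by move: fg; rewrite (near_shift 0 x) /=; apply: filterS => y /=; rewrite subr0.
near=> y.
have -> : (g \o shift x - (cst (g x) + 'd f x)) y = (f \o shift x - (cst (f x) + 'd f x)) y.
  have E : f (y + x) = g (y + x) by near: y.
  by rewrite !fctE /= E fgx.
by near: y.
Unshelve. all: by end_near. Qed.

(* Junk values of ['D_v] are excluded by asking for differentiability at every order. *)
Fixpoint Ck V W (k : nat) (O : set V) (f : V -> W) : Prop :=
  (forall y, O y -> differentiable f y) /\
  match k with 0 => True | k'.+1 => forall v, Ck k' O ('D_v f) end.

Lemma Ck_diff V W k (O : set V) (f : V -> W) y :
  Ck k O f -> O y -> differentiable f y.
Proof. by case: k => [|k] [h _]; apply: h. Qed.

Lemma CkW V W k (O : set V) (f : V -> W) : Ck k.+1 O f -> Ck k O f.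
Proof.
elim: k f => [|k IH] f; first by case.
by move=> [h1 h2]; split => // v; apply: IH; apply: h2.
Qed.

Lemma Ck_sub V W k (O P : set V) (f : V -> W) :
  P `<=` O -> Ck k O f -> Ck k P f.
Proof.
move=> PO; elim: k f => [|k IH] f [h1 h2].
  by split=> // y /PO/h1.
by split=> [y /PO/h1//|v]; apply/IH/h2.
Qed.

Lemma Ck_ext V W k (O : set V) (f g : V -> W) : open O ->
  (forall y, O y -> f y = g y) -> Ck k O f -> Ck k O g.
Proof.
move=> oO; elim: k f g => [|k IH] f g fg [h1 h2];
  have near_fg y : O y -> \forall z \near y, f z = g z
    by (move=> Oy; have := open_nbhs_nbhs (conj oO Oy); apply: filterS => z /fg).
  by split=> // y Oy; apply: near_eq_differentiable (h1 _ Oy); apply: near_fg.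
split=> [y Oy|v]; first by apply: near_eq_differentiable (h1 _ Oy); apply: near_fg.
apply: IH (h2 v) => y Oy; apply: near_eq_derive; exact: near_fg.
Qed.

Lemma Ck_cst V W k (O : set V) (c : W) : Ck k O (cst c : V -> W).
Proof.
elim: k c => [|k IH] c; first by split=> // y _; exact: differentiable_cst.
split=> [y _|v]; first exact: differentiable_cst.
have -> : 'D_v (cst c : V -> W) = cst 0; last exact: IH.
by apply/funext => x; rewrite derive_val.
Qed.

Lemma Ck_lin V W k (O : set V) (f : {linear V -> W}) : continuous f -> Ck k O f.
Proof.
move=> cf; have df y : differentiable f y by exact: linear_differentiable.
case: k => [|k]; first by split=> // y _.
split=> [y _|v] //.
have -> : 'D_v f = cst (f v); last exact: Ck_cst.
by apply/funext => x; rewrite deriveE ?diff_lin //; exact: linear_differentiable.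
Qed.

Lemma Ck_D V W k (O : set V) (f g : V -> W) : open O ->
  Ck k O f -> Ck k O g -> Ck k O (fun x => f x + g x).
Proof.
move=> oO; elim: k f g => [|k IH] f g [f1 f2] [g1 g2].
  by split=> // y Oy; apply: differentiableD; [exact: f1|exact: g1].
split=> [y Oy|v]; first by apply: differentiableD; [exact: f1|exact: g1].
apply: (@Ck_ext _ _ _ _ (fun x => 'D_v f x + 'D_v g x)) => //.
  move=> y Oy; rewrite (_ : (fun x => f x + g x) = f + g) // deriveD //.
    by apply: diff_derivable; exact: f1.
  by apply: diff_derivable; exact: g1.
by apply: IH; [exact: f2|exact: g2].
Qed.

Lemma Ck_sum V W k (O : set V) n (f : 'I_n -> V -> W) : open O ->
  (forall i, Ck k O (f i)) -> Ck k O (fun x => \sum_(i < n) f i x).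
Proof.
move=> oO; elim: n f => [|n IH] f h.
  apply: (@Ck_ext _ _ _ _ (cst 0)) => //; last exact: Ck_cst.
  by move=> y _; rewrite big_ord0.
apply: (@Ck_ext _ _ _ _ (fun x => \sum_(i < n) f (widen_ord (leqnSn n) i) x + f ord_max x)) => //.
  by move=> y _; rewrite big_ord_recr.
by apply: Ck_D => //; apply: IH.
Qed.

(** Makes scalar multiplication a bilinear map, so that the Leibniz rule for vector-valued functions
    follows from the differential of a continuous bilinear map. *)
Lemma scale_is_bilinear V :
  bilinear_for
    (GRing.Scale.Law.clone _ _ *:%R _) (GRing.Scale.Law.clone _ _ *:%R _)
    (@GRing.scale R V).
Proof.
split=> [u'|u] a x y /=.
- by rewrite scalerDl scalerA.
- by rewrite scalerDr !scalerA mulrC.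
Qed.
HB.instance Definition _ V := bilinear_isBilinear.Build R R V V _ _ (@GRing.scale R V)
  (@scale_is_bilinear V).

Lemma differentiable_scale V W (c : V -> R) (f : V -> W) x :
  differentiable c x -> differentiable f x -> differentiable (fun y => c y *: f y) x.
Proof.
move=> dc df.
rewrite (_ : (fun y => c y *: f y) = (fun p : R * W => p.1 *: p.2) \o (fun y => (c y, f y))) //.
apply: differentiable_comp; first exact: differentiable_pair.
apply: (@differentiable_bilin R R W W (@GRing.scale R W)).
exact: scale_continuous.
Qed.

Lemma derive_scale V W (c : V -> R) (f : V -> W) x v :
  differentiable c x -> differentiable f x ->
  'D_v (fun y => c y *: f y) x = c x *: 'D_v f x + 'D_v c x *: f x.
Proof.
move=> dc df.
rewrite deriveE; last exact: differentiable_scale.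
rewrite (_ : (fun y => c y *: f y) = (fun p : R * W => p.1 *: p.2) \o (fun y => (c y, f y))) //.
rewrite diff_comp; last 2 first.
- exact: differentiable_pair.
- apply: (@differentiable_bilin R R W W (@GRing.scale R W)); exact: scale_continuous.
rewrite /= diff_pair // (@diff_bilin R R W W (@GRing.scale R W)) /=; last exact: scale_continuous.
by rewrite !deriveE.
Qed.

Lemma Ck_scale V W k (O : set V) (c : V -> R) (f : V -> W) : open O ->
  Ck k O c -> Ck k O f -> Ck k O (fun x => c x *: f x).
Proof.
move=> oO; elim: k c f => [|k IH] c f hc hf; have [c1 c2] := hc; have [f1 f2] := hf.
  by split=> // y Oy; apply: differentiable_scale; [exact: c1|exact: f1].
split=> [y Oy|v]; first by apply: differentiable_scale; [exact: c1|exact: f1].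
apply: (@Ck_ext _ _ _ _ (fun x => c x *: 'D_v f x + 'D_v c x *: f x)) => //.
  by move=> y Oy; rewrite derive_scale //; [exact: c1|exact: f1].
by apply: Ck_D => //; apply: IH => //; [exact: CkW hc|exact: f2|exact: c2|exact: CkW hf].
Qed.

Lemma Ck_M V k (O : set V) (c f : V -> R) : open O ->
  Ck k O c -> Ck k O f -> Ck k O (fun x => c x * f x).
Proof. exact: Ck_scale. Qed.

Lemma Ck_N V W k (O : set V) (f : V -> W) : open O ->
  Ck k O f -> Ck k O (fun x => - f x).
Proof.
move=> oO hf; apply: (@Ck_ext _ _ _ _ (fun x => (-1) *: f x)) => //.
  by move=> y _; rewrite scaleN1r.
by apply: Ck_scale => //; exact: Ck_cst.
Qed.

Lemma Ck_inv V k (O : set V) (f : V -> R) : open O -> (forall y, O y -> f y != 0) ->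
  Ck k O f -> Ck k O (fun x => (f x)^-1).
Proof.
move=> oO f0; elim: k f f0 => [|k IH] f f0 hf; have [f1 f2] := hf.
  by split=> // y Oy; apply: differentiableV; [exact: f1|exact: f0].
split=> [y Oy|v]; first by apply: differentiableV; [exact: f1|exact: f0].
apply: (@Ck_ext _ _ _ _ (fun x => - ((f x)^-1 * (f x)^-1 * 'D_v f x))) => //.
  move=> y Oy; rewrite [RHS]deriveE; last by apply: differentiableV; [exact: f1|exact: f0].
  rewrite diffV ?f0 //; last exact: f1.
  by rewrite deriveE; [rewrite /= expr2 invfM scaleNr|exact: f1].
have hi : Ck k O (fun x => (f x)^-1) by apply: IH => //; exact: CkW hf.
apply: (@Ck_N V R k O (fun x => (f x)^-1 * (f x)^-1 * 'D_v f x)) => //.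
by apply: (Ck_M oO _ (f2 v)); exact: (Ck_M oO hi hi).
Qed.

Lemma Ck_lincomp U V W k (O : set U) (L : {linear V -> W}) (f : U -> V) : open O ->
  continuous L -> Ck k O f -> Ck k O (L \o f).
Proof.
move=> oO cL; elim: k f => [|k IH] h [h1 h2].
  by split => // y Oy; apply: differentiable_comp; [exact: h1|exact: linear_differentiable].
have dh y : O y -> differentiable (L \o h) y.
  by move=> Oy; apply: differentiable_comp; [exact: h1|exact: linear_differentiable].
split=> // w; apply: (@Ck_ext _ _ _ _ (L \o 'D_w h)) => //; last exact/IH/h2.
move=> y Oy; rewrite [RHS]deriveE; last exact: dh.
rewrite diff_comp //=; [|exact: h1|exact: linear_differentiable].
by rewrite diff_lin //= -deriveE //; exact: h1.
Qed.

(* The chain rule for iterated directional derivatives needs the inner map to be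
   a combination of finitely many directions. *)
Definition fdim V := exists (n : nat) (e : 'I_n -> V) (c : 'I_n -> {linear V -> R}),
  (forall i, continuous (c i)) /\ forall v, v = \sum_(i < n) c i v *: e i.

Lemma Ck_comp U V W k (O : set U) (P : set V) (f : U -> V) (g : V -> W) :
  fdim V -> open O -> open P -> (forall x, O x -> P (f x)) ->
  Ck k O f -> Ck k P g -> Ck k O (g \o f).
Proof.
move=> [n [e [c [cc ce]]]] oO oP fP; elim: k f g fP => [|k IH] f g fP hf hg;
  have [f1 f2] := hf; have [g1 g2] := hg.
  by split=> // y Oy; apply: differentiable_comp; [exact: f1|exact/g1/fP].
split=> [y Oy|v]; first by apply: differentiable_comp; [exact: f1|exact/g1/fP].
(* Expanding ['D_v f x] in the directions [e i] leaves only the fixed derivatives ['D_(e i) g]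
   composed with [f], to which the induction hypothesis applies. *)
apply: (@Ck_ext _ _ _ _ (fun x => \sum_(i < n) (c i ('D_v f x)) *: ('D_(e i) g \o f) x)) => //.
  move=> y Oy; have df := f1 _ Oy; have dg := g1 _ (fP _ Oy).
  rewrite [RHS]deriveE; last exact: differentiable_comp.
  rewrite diff_comp //= -(deriveE v df) [in RHS](ce ('D_v f y)) linear_sum.
  by apply: eq_bigr => i _; rewrite linearZ /= (deriveE (e i) dg).
apply: Ck_sum => // i; apply: Ck_scale => //; last first.
  by apply: IH => //; [exact: CkW hf|exact: g2].
by apply: Ck_lincomp => //; exact: f2.
Qed.

Lemma Ck_pair U V W k (O : set U) (f : U -> V) (g : U -> W) : open O ->
  Ck k O f -> Ck k O g -> Ck k O (fun x => (f x, g x)).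
Proof.
move=> oO; elim: k f g => [|k IH] f g [f1 f2] [g1 g2].
  by split=> // y Oy; apply: differentiable_pair; [exact: f1|exact: g1].
split=> [y Oy|v]; first by apply: differentiable_pair; [exact: f1|exact: g1].
apply: (@Ck_ext _ _ _ _ (fun x => ('D_v f x, 'D_v g x))) => //.
  move=> y Oy; have df := f1 _ Oy; have dg := g1 _ Oy.
  rewrite [RHS]deriveE; last exact: differentiable_pair.
  by rewrite diff_pair // !deriveE.
by apply: IH; [exact: f2|exact: g2].
Qed.

(** [foldr] applies the last direction of the list first, whereas [Ck] peels off the derivative
    taken first; hence the inductions through [rcons]. *)
Lemma Ck_foldrP V W (O : set V) (f : V -> W) :
  (forall vs y, O y -> differentiable (foldr (fun v (k : V -> W) => 'D_v k) f vs) y)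
  <-> forall k, Ck k O f.
Proof.
split=> [h k|].
  elim: k f h => [|k IH] f h; first by split=> // y Oy; exact: (h [::] y Oy).
  split=> [y Oy|v]; first exact: (h [::] y Oy).
  by apply: IH => vs y Oy; have := h (rcons vs v) y Oy; rewrite foldr_rcons.
move=> h vs; elim/last_ind: vs f h => [|vs v IH] f h y Oy /=.
  exact: (Ck_diff (h 0)).
by rewrite foldr_rcons; apply: IH => // k; have [_ /(_ v)] := h k.+1.
Qed.

(** One neighbourhood serves all orders, as in [smooth_on], so smoothness at [x] spreads to nearby
    points and passes to derivatives. *)
Definition smooth_at V W (f : V -> W) (x : V) :=
  exists O : set V, [/\ open O, O x & forall k, Ck k O f].

Lemma smooth_at_diff V W (f : V -> W) x : smooth_at f x -> differentiable f x.
Proof. by move=> [ O [oO Ox /(_ 0)/Ck_diff]]; apply. Qed.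

Lemma smooth_at_cont V W (f : V -> W) x : smooth_at f x -> {for x, continuous f}.
Proof. by move=> /smooth_at_diff; exact: differentiable_continuous. Qed.

Lemma smooth_at_near V W (f : V -> W) x :
  smooth_at f x -> \forall y \near x, smooth_at f y.
Proof.
move=> [ O [oO Ox hO]]; have := open_nbhs_nbhs (conj oO Ox).
by apply: filterS => y Oy; exists O.
Qed.

Lemma smooth_at_ext V W (f g : V -> W) x :
  (\forall y \near x, f y = g y) -> smooth_at f x -> smooth_at g x.
Proof.
rewrite /prop_near1 nbhsE => -[P [oP Px] fg] [ O [oO Ox hO]].
exists (O `&` P); split; [exact: openI|by []|move=> k].
apply: (@Ck_ext _ _ _ _ f); first exact: openI.
  by move=> y [_ Py]; exact: fg.
by apply: Ck_sub (hO k) => y [].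
Qed.

Lemma smooth_at_cst V W (c : W) (x : V) : smooth_at (fun=> c) x.
Proof. by exists setT; split=> // [|k]; [exact: openT|exact: Ck_cst]. Qed.

Lemma smooth_at_lin V W (f : {linear V -> W}) x : continuous f -> smooth_at f x.
Proof. by move=> cf; exists setT; split=> // [|k]; [exact: openT|exact: Ck_lin]. Qed.

Lemma smooth_at_id V (x : V) : smooth_at id x.
Proof. by apply: (@smooth_at_lin _ _ idfun) => y; exact: cvg_id. Qed.

Lemma smooth_at_lincomp U V W (L : {linear V -> W}) (f : U -> V) x :
  continuous L -> smooth_at f x -> smooth_at (fun y => L (f y)) x.
Proof. by move=> cL [ O [oO Ox hO]]; exists O; split=> // k; exact: Ck_lincomp. Qed.

Lemma smooth_at_op2 V W1 W2 W (f : V -> W1) (g : V -> W2) (h : V -> W) x :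
  (forall k (O : set V), open O -> Ck k O f -> Ck k O g -> Ck k O h) ->
  smooth_at f x -> smooth_at g x -> smooth_at h x.
Proof.
move=> H [ O [oO Ox hO]] [P [oP Px hP]].
exists (O `&` P); split; [exact: openI|by []|move=> k].
apply: H; first exact: openI.
  by apply: Ck_sub (hO k) => y [].
by apply: Ck_sub (hP k) => y [].
Qed.

Lemma smooth_at_D V W (f g : V -> W) x :
  smooth_at f x -> smooth_at g x -> smooth_at (fun y => f y + g y) x.
Proof. by apply: smooth_at_op2 => k O; exact: Ck_D. Qed.

Lemma smooth_at_scale V W (c : V -> R) (f : V -> W) x :
  smooth_at c x -> smooth_at f x -> smooth_at (fun y => c y *: f y) x.
Proof. by apply: smooth_at_op2 => k O; exact: Ck_scale. Qed.

Lemma smooth_at_M V (f g : V -> R) x :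
  smooth_at f x -> smooth_at g x -> smooth_at (fun y => f y * g y) x.
Proof. by apply: smooth_at_op2 => k O; exact: Ck_M. Qed.

Lemma smooth_at_pair V W1 W2 (f : V -> W1) (g : V -> W2) x :
  smooth_at f x -> smooth_at g x -> smooth_at (fun y => (f y, g y)) x.
Proof. by apply: smooth_at_op2 => k O; exact: Ck_pair. Qed.

Lemma smooth_at_N V W (f : V -> W) x : smooth_at f x -> smooth_at (fun y => - f y) x.
Proof. by move=> [ O [oO Ox hO]]; exists O; split=> // k; exact: Ck_N. Qed.

Lemma smooth_at_B V W (f g : V -> W) x :
  smooth_at f x -> smooth_at g x -> smooth_at (fun y => f y - g y) x.
Proof. by move=> sf sg; apply: smooth_at_D => //; exact: smooth_at_N. Qed.

Lemma smooth_at_sum V W (I : Type) (r : seq I) (f : I -> V -> W) x :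
  (forall i, smooth_at (f i) x) -> smooth_at (fun y => \sum_(i <- r) f i y) x.
Proof.
move=> h; elim: r => [|i r IH].
  apply: smooth_at_ext (smooth_at_cst 0 x); near=> y; by rewrite big_nil.
apply: smooth_at_ext (smooth_at_D (h i) IH); near=> y; by rewrite big_cons.
Unshelve. all: by end_near. Qed.

Lemma smooth_at_prod V (I : Type) (r : seq I) (f : I -> V -> R) x :
  (forall i, smooth_at (f i) x) -> smooth_at (fun y => \prod_(i <- r) f i y) x.
Proof.
move=> h; elim: r => [|i r IH].
  apply: (@smooth_at_ext V R (fun=> 1)); [|exact: smooth_at_cst]; near=> y; by rewrite big_nil.
apply: (@smooth_at_ext V R (fun y => f i y * \prod_(j <- r) f j y)); [|exact: smooth_at_M (h i) IH]; near=> y; by rewrite big_cons.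
Unshelve. all: by end_near. Qed.

Lemma smooth_at_inv V (f : V -> R) x :
  f x != 0 -> smooth_at f x -> smooth_at (fun y => (f y)^-1) x.
Proof.
move=> fx0 sf; have [ O [oO Ox hO]] := sf.
have : \forall y \near x, f y != 0.
  have cf : {for x, continuous f} by exact: smooth_at_cont.
  by apply: (cf [set z | z != 0]); apply: open_nbhs_nbhs; split=> //; exact: open_neq.
rewrite /prop_near1 nbhsE => -[P [oP Px] P0].
exists (O `&` P); split; [exact: openI|by []|move=> k].
apply: Ck_inv; [exact: openI|by move=> y [_ /P0]|].
by apply: Ck_sub (hO k) => y [].
Qed.

Lemma smooth_at_derive V W (f : V -> W) x v : smooth_at f x -> smooth_at ('D_v f) x.
Proof.
by move=> [ O [oO Ox hO]]; exists O; split=> // k; have [_ /(_ v)] := hO k.+1.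
Qed.

Lemma smooth_at_comp U V W (f : U -> V) (g : V -> W) x : fdim V ->
  smooth_at f x -> smooth_at g (f x) -> smooth_at (g \o f) x.
Proof.
move=> fd sf [P [oP Px hP]]; have [ O [oO Ox hO]] := sf.
have : \forall y \near x, P (f y).
  by apply: (smooth_at_cont sf); apply: open_nbhs_nbhs.
rewrite /prop_near1 nbhsE => -[Q [oQ Qx] QP].
exists (O `&` Q); split; [exact: openI|by []|move=> k].
apply: Ck_comp (hP k) => //; first exact: openI.
  by move=> y [_ /QP].
by apply: Ck_sub (hO k) => y [].
Qed.

Lemma smooth_onP V W (A : set V) (f : V -> W) : open A ->
  smooth_on A f <-> forall x, A x -> smooth_at f x.
Proof.
move=> oA; split=> h x Ax.
  have [ O [g [oO Ox dg gf]]] := h _ Ax.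
  apply: (@smooth_at_ext _ _ g).
    have : nbhs x (O `&` A) by apply: open_nbhs_nbhs; split=> //; exact: openI.
    by apply: filterS => y [Oy Ay]; exact: gf.
  by exists O; split=> //; apply/Ck_foldrP.
by have [ O [oO Ox /Ck_foldrP hO]] := h _ Ax; exists O, f; split.
Qed.

End Ck.

(** * Finite-dimensional spaces and smoothness of local inverses *)

Section FiniteDim.
Variable R : realType.
Implicit Types V W U : normedModType R.

Lemma fdim_R : fdim (R : normedModType R).
Proof.
exists 1%N, (fun=> 1), (fun=> idfun); split=> [_ x|v]; first exact: cvg_id.
by rewrite big_ord1 /= -[LHS]mulr1.
Qed.

Definition mcoord m n (i : 'I_m) (j : 'I_n) (M : 'M[R]_(m, n)) : R := M i j.
Lemma mcoord_is_linear m n i j : linear (@mcoord m n i j).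
Proof. by move=> a u v; rewrite /mcoord !mxE. Qed.
HB.instance Definition _ m n i j :=
  GRing.isLinear.Build R 'M[R]_(m, n) R _ (mcoord i j) (@mcoord_is_linear m n i j).

Lemma mcoord_continuous m n i j : continuous (@mcoord m n i j).
Proof. exact: coord_continuous. Qed.

Lemma fdim_rV n : fdim ('rV[R]_n : normedModType R).
Proof.
exists n, (fun i => delta_mx 0 i), (fun i => mcoord 0 i).
split=> [i|v]; first exact: mcoord_continuous.
exact: row_sum_delta.
Qed.

Lemma fdim_pair V W : fdim V -> fdim W -> fdim (V * W)%type.
Proof.
move=> [n [e [c [cc ce]]]] [m [e' [c' [cc' ce']]]].
exists (n + m)%N, (fun i => match fintype.split i with inl j => (e j, 0) | inr j => (0, e' j) end),
  (fun i => match fintype.split i with inl j => (c j \o @fst V W : {linear _ -> _})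
    | inr j => (c' j \o @snd V W : {linear _ -> _}) end); split.
  move=> i; case: (fintype.split i) => j x.
    by apply: continuous_comp; [exact: continuous_fst|exact: cc].
  by apply: continuous_comp; [exact: continuous_snd|exact: cc'].
case=> v w; rewrite big_split_ord /=.
under eq_bigr => i _ do rewrite (unsplitK (inl _ i)) /=.
under [X in _ + X]eq_bigr => i _ do rewrite (unsplitK (inr _ i)) /=.
have fE (k : nat) (F : 'I_k -> V * W) : \sum_(i < k) F i = (\sum_(i < k) (F i).1, \sum_(i < k) (F i).2).
  elim: k F => [|k IH] F; first by rewrite !big_ord0.
  by rewrite !big_ord_recr /= IH.
rewrite !fE /= -ce -ce'; congr pair => /=.
  by rewrite big1 ?addr0 // => i _; rewrite /= scaler0.
by rewrite big1 ?add0r // => i _; rewrite /= scaler0.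
Qed.

Lemma smooth_at_coord V m n (f : V -> 'M[R]_(m, n)) i j x :
  smooth_at f x -> smooth_at (fun y => f y i j) x.
Proof. by apply: (@smooth_at_lincomp _ _ _ _ (mcoord i j)); exact: mcoord_continuous. Qed.

Lemma smooth_at_rV V n (f : V -> 'rV[R]_n) x :
  (forall j, smooth_at (fun y => f y 0 j) x) -> smooth_at f x.
Proof.
move=> h; apply: (@smooth_at_ext _ _ _ (fun y => \sum_(j < n) f y 0 j *: delta_mx 0 j)).
  by near=> y; rewrite -row_sum_delta.
by apply: smooth_at_sum => j; apply: smooth_at_scale => //; exact: smooth_at_cst.
Unshelve. all: by end_near. Qed.

Lemma smooth_at_det V n (f : V -> 'M[R]_n) x :
  (forall i j, smooth_at (fun y => f y i j) x) -> smooth_at (fun y => \det (f y)) x.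
Proof.
move=> h; apply: smooth_at_sum => s; apply: smooth_at_M; first exact: smooth_at_cst.
by apply: smooth_at_prod.
Qed.

(** The inverse matrix is written by Cramer's rule, which makes its entries quotients of polynomials
    in the entries of [f y]. *)
Lemma smooth_at_invmx V n (f : V -> 'M[R]_n) x i j : \det (f x) != 0 ->
  (forall i j, smooth_at (fun y => f y i j) x) ->
  smooth_at (fun y => ((\det (f y))^-1 *: \adj (f y)) i j) x.
Proof.
move=> d0 h.
apply: (@smooth_at_ext _ _ _ (fun y => (\det (f y))^-1 * ((-1) ^+ (j + i) * \det (row' j (col' i (f y)))))).
  by near=> y; rewrite !mxE.
apply: smooth_at_M; first by apply: smooth_at_inv => //; exact: smooth_at_det.
apply: smooth_at_M; first exact: smooth_at_cst.
apply: smooth_at_det => k l.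
by apply: smooth_at_ext (h (lift j k) (lift i l)); near=> y; rewrite !mxE.
Unshelve. all: by end_near. Qed.

Lemma smooth_at_Ck V W (P : set V) (f : V -> W) : open P ->
  (forall x, P x -> smooth_at f x) -> forall k, Ck k P f.
Proof.
move=> oP h k; elim: k f h => [|k IH] f h; first by split=> // y /h /smooth_at_diff.
split=> [y /h /smooth_at_diff//|v]; apply: IH => x Px.
exact/smooth_at_derive/h.
Qed.

(** With [k = g (h + w) - g w], the vector [k - L h] is [- L] applied to [h - 'd F k], the remainder
    of [F] at [k]. Continuity of [g] makes [k] small, so this remainder is [o(k)]; absorbing it
    shows that [k] is [O(h)], which turns [o(k)] into [o(h)]. *)
Lemma diff_inverse V W (F : V -> W) (g : W -> V) (L : {linear W -> V}) w :
  continuous L -> differentiable F (g w) -> (forall v, L ('d F (g w) v) = v) ->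
  {for w, continuous g} -> (\forall z \near w, F (g z) = z) ->
  differentiable g w /\ forall h, 'd g w h = L h.
Proof.
move=> cL dF LF cg Fg.
suff H : continuous L /\ g \o shift w = cst (g w) + L +o_ 0 id.
  have E := diff_unique (proj1 H) (proj2 H).
  split; last by move=> h; rewrite E.
  by apply/diff_locallyP; rewrite E.
split=> //; apply/eqaddoP => e e0.
have [C C0 LC] := linear_lipschitz cL.
(* The first bound gives [C * e1 <= 1 / 2], whence [|k| <= 2 * C * |h|]; the second turns
   [C * e1 * |k|] into at most [e * |h|]. *)
pose e1 := Num.min (C^-1 / 2) (e / (2 * C ^+ 2)).
have e10 : 0 < e1 by rewrite /e1 lt_min !divr_gt0 ?invr_gt0 ?mulr_gt0 ?exprn_gt0.
have /eqaddoP/(_ e1 e10) H := diff_locally dF.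
have g0 : (fun h => g (h + w) - g w) @ (0:W) --> (0 : V).
  rewrite -(subrr (g w)); apply: cvgB; last exact: cvg_cst.
  move: cg; rewrite /continuous_at.
  move=> cg; apply: (@cvg_comp _ _ _ (fun h => h + w) g _ (nbhs w)) => //.
  have c0 : (fun h : W => h + w) @ (0:W) --> (0 + w : W).
    by apply: cvgD; [exact: cvg_id|exact: cvg_cst].
  by rewrite add0r in c0.
have Fg0 : \forall h \near (0:W), F (g (h + w)) = h + w.
  by move: Fg; rewrite (near_shift 0 w) /=; apply: filterS => y /=; rewrite subr0.
have H0 : \forall h \near (0:W), `|F (g (h + w) - g w + g w) - (F (g w) + 'd F (g w) (g (h + w) - g w))| <= e1 * `|g (h + w) - g w|.
  exact: (g0 _ H).
near=> h.
have Eh : F (g (h + w)) = h + w by near: h.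
have Hh : `|F (g (h + w) - g w + g w) - (F (g w) + 'd F (g w) (g (h + w) - g w))| <= e1 * `|g (h + w) - g w| by near: h.
rewrite !fctE /=; set k := g (h + w) - g w in Hh *.
have Ew : F (g w) = w by exact: nbhs_singleton Fg.
rewrite {1}/k subrK Eh Ew opprD addrA addrK in Hh.
have Ek : k - L h = - L (h - 'd F (g w) k) by rewrite linearB /= LF opprB.
have -> : g (h + w) - (g w + L h) = k - L h by rewrite opprD addrA.
have B1 : `|k - L h| <= C * (e1 * `|k|).
  by rewrite Ek normrN; apply: le_trans (LC _) _; rewrite ler_pM2l.
have B2 : `|k| <= C * `|h| + C * (e1 * `|k|).
  rewrite -{1}(subrK (L h) k) addrC; apply: le_trans (ler_normD _ _) _.
  exact: lerD.
have e1C : C * e1 <= 1 / 2.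
  rewrite -ler_pdivlMl // mulrC mul1r mulrC.
  by rewrite /e1 ge_min lexx.
have B3 : C * (e1 * `|k|) <= 1 / 2 * `|k|.
  by rewrite mulrA ler_wpM2r.
have B4 : `|k| <= 2 * C * `|h| by lra.
apply: le_trans B1 _; rewrite mulrA.
have : C * e1 * `|k| <= C * e1 * (2 * C * `|h|).
  by rewrite ler_wpM2l // mulr_ge0 // ltW.
move=> /le_trans; apply.
rewrite mulrA ler_wpM2r //.
have : e1 <= e / (2 * C ^+ 2) by rewrite /e1 ge_min lexx orbT.
rewrite ler_pdivlMr; last by rewrite mulr_gt0 // exprn_gt0.
by apply: le_trans; rewrite expr2; nra.
Unshelve. all: by end_near. Qed.

(* Only the elementary half of the inverse function theorem is needed: a local
   inverse is given and known to be continuous. *)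
Lemma smooth_at_inverse V W (F : V -> W) (g : W -> V) (L : V -> {linear W -> V})
    (P : set V) (Q : set W) w0 : fdim V ->
  open P -> open Q -> Q w0 ->
  (forall x, P x -> [/\ differentiable F x, continuous (L x),
     forall v, L x ('d F x v) = v & forall w, smooth_at (fun y => L y w) x]) ->
  (forall w, Q w -> [/\ P (g w), {for w, continuous g} & F (g w) = w]) ->
  smooth_at g w0.
Proof.
move=> fd oP oQ Qw0 HP HQ; exists Q; split=> //.
have dg w : Q w -> differentiable g w /\ forall h, 'd g w h = L (g w) h.
  move=> Qw; have [Pg cg Fg] := HQ _ Qw; have [dF cL LF _] := HP _ Pg.
  apply: (diff_inverse cL dF LF cg).
  have : nbhs w Q by exact: open_nbhs_nbhs.
  by apply: filterS => z /HQ [].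
elim=> [|k IH]; first by split=> // y /dg [].
split=> [y /dg []//|v].
(* Bootstrap: the derivative of [g] is a smooth function composed with [g], so order [k] for [g]
   gives order [k.+1]. *)
apply: (@Ck_ext _ _ _ _ _ ((fun y => L y v) \o g)) => //.
  by move=> y Qy; have [dgy E] := dg _ Qy; rewrite deriveE // E.
apply: (@Ck_comp _ _ _ _ _ _ P) => //; first by move=> x /HQ [].
by apply: smooth_at_Ck => // x /HP [_ _ _]; exact.
Qed.

Section PathInverse.
Variable d : nat.
Notation E := 'rV[R]_d.

(* The inverse of the derivative [(s, w) |-> (s, s *: c + w *m B^-1)] of a
   map [(t, y) |-> (t, G (t, y))]. *)
Definition path_linv (c : E) (B : 'M[R]_d) (p : R * E) : R * E :=
  (p.1, (p.2 - p.1 *: c) *m B).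
Lemma path_linv_is_linear c B : linear (path_linv c B).
Proof.
move=> a u v; rewrite /path_linv /=; congr pair.
rewrite /= scalemxAl -mulmxDl; congr (_ *m _).
by rewrite scalerBr scalerDl opprD scalerA addrACA.
Qed.
HB.instance Definition _ c B := GRing.isLinear.Build R (R * E)%type (R * E)%type _
  (path_linv c B) (@path_linv_is_linear c B).

Definition jac (G : R * E -> E) (p : R * E) : 'M[R]_d :=
  \matrix_(i, j) ('D_(0, delta_mx 0 i) G p) 0 j.

Lemma jacE (G : R * E -> E) p (v : E) : differentiable G p ->
  'D_(0, v) G p = v *m jac G p.
Proof.
move=> dG; rewrite deriveE //.
have -> : (0, v) = \sum_(i < d) v 0 i *: ((0, delta_mx 0 i) : R * E).
  have fE (k : nat) (F : 'I_k -> R * E) : \sum_(i < k) F i = (\sum_(i < k) (F i).1, \sum_(i < k) (F i).2).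
    elim: k F => [|k IH] F; first by rewrite !big_ord0.
    by rewrite !big_ord_recr /= IH.
  rewrite fE /=; congr pair; last exact: row_sum_delta.
  by rewrite big1 // => i _; rewrite scaler0.
rewrite linear_sum; apply/rowP => j; rewrite summxE !mxE.
by apply: eq_bigr => i _; rewrite linearZ !mxE deriveE.
Qed.

(** Reduces to the ordinary inverse of [(t, y) |-> (t, G (t, y))], whose derivative is block
    triangular and therefore invertible as soon as the derivative in [y] is. Injectivity at the
    single point makes the determinant nonzero there, hence nearby. *)
Lemma smooth_at_path_inverse (G g : R * E -> E) t0 y0 :
  smooth_at G (t0, g (t0, y0)) ->
  (forall v, 'D_(0, v) G (t0, g (t0, y0)) = 0 -> v = 0) ->
  (\forall p \near (t0, y0), {for p, continuous g} /\ G (p.1, g p) = p.2) ->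
  smooth_at g (t0, y0).
Proof.
set x0 := g (t0, y0) => sG inj near_g.
have dJ0 : \det (jac G (t0, x0)) != 0.
  apply/negP => /det0P [v v0 vJ]; move/eqP: v0; apply; apply: inj.
  by rewrite jacE //; exact: smooth_at_diff.
have sJ p i j : smooth_at G p -> smooth_at (fun q => jac G q i j) p.
  move=> sGp; apply: (@smooth_at_ext _ _ _ (fun q => ('D_(0, delta_mx 0 i) G q) 0 j)).
    by near=> q; rewrite mxE.
  exact/smooth_at_coord/smooth_at_derive.
have : \forall p \near (t0, x0), smooth_at G p /\ \det (jac G p) != 0.
  near=> p; split; first by near: p; exact: (smooth_at_near sG).
  near: p.
  have : {for (t0, x0), continuous (fun p => \det (jac G p))}.
    by apply: smooth_at_cont; apply: smooth_at_det => i j; exact: sJ.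
  by move=> /(_ [set z | z != 0]); apply; apply: open_nbhs_nbhs; split=> //; exact: open_neq.
rewrite /prop_near1 nbhsE => -[P [oP P0] HP].
have near2 : \forall p \near (t0, y0), [/\ {for p, continuous g}, G (p.1, g p) = p.2 & P (p.1, g p)].
  have cg0 : {for (t0, y0), continuous g} by have [] := nbhs_singleton near_g.
  have : \forall p \near (t0, y0), P (p.1, g p).
    have c2 : {for (t0, y0), continuous (fun p : R * E => (p.1, g p))}.
      by apply: continuous_pair_at => //; exact: continuous_fst.
    by apply: (c2 P); apply: open_nbhs_nbhs.
  by apply: filterS2 near_g => p [].
move: near2; rewrite /prop_near1 nbhsE => -[Q [oQ Q0] HQ].
pose F (p : R * E) := (p.1, G p).
pose gg (p : R * E) := (p.1, g p).
pose L (p : R * E) := (path_linv ('D_(1, 0) G p) ((\det (jac G p))^-1 *: \adj (jac G p)) : {linear _ -> _}).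
have sgg : smooth_at gg (t0, y0).
  apply: (@smooth_at_inverse _ _ F gg L P Q) => //.
  - by apply: fdim_pair; [exact: fdim_R|exact: fdim_rV].
  - move=> p /HP [sGp dJ]; have dG := smooth_at_diff sGp; split.
    + by apply: differentiable_pair => //; apply: (@linear_differentiable _ _ _ fst); exact: continuous_fst.
    + move=> q; apply: continuous_pair_at; first exact: continuous_fst.
      apply: smooth_at_cont; apply: smooth_at_rV => j.
      apply: (@smooth_at_ext _ _ _ (fun q : R * E => \sum_k (q.2 0 k - q.1 * ('D_(1, 0) G p) 0 k) * ((\det (jac G p))^-1 *: \adj (jac G p)) k j)).
        by near=> z; rewrite mxE; apply: eq_bigr => k _; rewrite !mxE.
      apply: smooth_at_sum => k; apply: smooth_at_M; last exact: smooth_at_cst.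
      apply: smooth_at_B.
        by apply: smooth_at_coord; apply: (@smooth_at_lin _ _ _ snd); exact: continuous_snd.
      apply: smooth_at_M; last exact: smooth_at_cst.
      by apply: (@smooth_at_lin _ _ _ fst); exact: continuous_fst.
    + move=> [s v]; rewrite /L /path_linv /=.
      have -> : 'd F p (s, v) = (s, s *: 'D_(1, 0) G p + v *m jac G p).
        rewrite /F diff_pair //; last by apply: (@linear_differentiable _ _ _ fst); exact: continuous_fst.
        rewrite (@diff_lin _ _ _ fst) /=; last exact: continuous_fst.
        congr pair; rewrite -jacE // !deriveE // -linearZ -linearD; congr ('d G p _).
        by congr pair; rewrite /= ?scaler0 ?add0r ?addr0 // [_ *: _]mulr1.
      congr pair; rewrite /= [X in X - _]addrC addrK -mulmxA -scalemxAr mul_mx_adj scale_scalar_mx mulVf //.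
      exact: mulmx1.
    + move=> [s v]; apply: smooth_at_pair; first exact: smooth_at_cst.
      apply: smooth_at_rV => j.
      apply: (@smooth_at_ext _ _ _ (fun q : R * E => \sum_k (v 0 k - s * ('D_(1, 0) G q) 0 k) * ((\det (jac G q))^-1 *: \adj (jac G q)) k j)).
        by near=> z; rewrite mxE; apply: eq_bigr => k _; rewrite !mxE.
      apply: smooth_at_sum => k; apply: smooth_at_M.
        apply: smooth_at_B; first exact: smooth_at_cst.
        apply: smooth_at_M; first exact: smooth_at_cst.
        exact/smooth_at_coord/smooth_at_derive.
      by apply: smooth_at_invmx => // i1 j1; exact: sJ.
  - move=> p /HQ [cg Gg Pg]; split=> //; last by rewrite /F /gg /= Gg; case: p {cg Gg Pg}.
    by apply: continuous_pair_at => //; exact: continuous_fst.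
have := @smooth_at_lincomp _ _ _ _ snd gg (t0, y0); apply => //.
exact: continuous_snd.
Unshelve. all: by end_near. Qed.

End PathInverse.
End FiniteDim.

(** * A smooth step function *)

Section SmoothStep.
Variable R : realType.

(** The powers of [1 / x] make the family stable under differentiation: the derivative of [flat n]
    is a combination of [flat n.+1] and [flat n.+2], so smoothness follows by induction on the
    order. *)
Definition flat (n : nat) (x : R) : R :=
  if 0 < x then x^-1 ^+ n * expR (- x^-1) else 0.

Lemma flat_ge0 n x : 0 <= flat n x.
Proof.
rewrite /flat; case: ifP => // x0.
by rewrite mulr_ge0 ?expR_ge0 // exprn_ge0 // invr_ge0 ltW.
Qed.

Lemma flat_eq0 n x : x <= 0 -> flat n x = 0.
Proof. by move=> x0; rewrite /flat ifN // -leNgt. Qed.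

Lemma flat_bound n x : flat n.+1 x <= n.+1`!%:R.
Proof.
rewrite /flat; case: ifP => // x0.
have := @expR_ge1Dxn R x^-1 n; rewrite invr_ge0 => /(_ (ltW x0)) H.
rewrite expRN ler_pdivrMr ?expR_gt0 // mulrC -ler_pdivrMr ?ltr0n ?fact_gt0 //.
by apply: le_trans H; rewrite lerDr.
Qed.

Lemma flatS n x : 0 < x -> flat n x = x * flat n.+1 x.
Proof. by move=> x0; rewrite /flat x0 exprS !mulrA divff ?mul1r // gt_eqF. Qed.

Lemma is_derive_flat n (x : R) :
  is_derive x 1 (flat n : R -> R) (- n%:R * flat n.+1 x + flat n.+2 x).
Proof.
have [x0|x0|->] := ltgtP x 0.
- apply: (@near_eq_is_derive _ _ _ (cst 0)).
    near=> y; rewrite /flat /= ifF //; apply/negbTE; rewrite -leNgt ltW //.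
    by near: y; apply: (open_nbhs_nbhs (conj (@open_lt _ 0) x0)).
  rewrite {1 2}/flat !ifN -?leNgt ?ltW // mulr0 addr0; exact: is_derive_cst.
- apply: (@near_eq_is_derive _ _ _ (fun y : R => y^-1 ^+ n * expR (- y^-1))).
    near=> y; rewrite /flat ifT //.
    by near: y; apply: (open_nbhs_nbhs (conj (@open_gt _ 0) x0)).
  have dV : is_derive x 1 (fun y : R => y^-1) (- x ^- 2 *: 1).
    by apply: (@is_deriveV _ id); rewrite ?gt_eqF.
  have dX := @is_deriveX _ _ _ n _ _ _ dV.
  have dN : is_derive x 1 (fun y : R => - y^-1) (- (- x ^- 2 *: 1)) by exact: is_deriveN.
  have dE : is_derive x 1 (expR \o (fun y : R => - y^-1)) (expR (- x^-1) * (- (- x ^- 2 *: 1))).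
    by apply: is_derive1_comp.
  have dM := @is_deriveM _ _ _ _ _ _ _ _ dX dE.
  have fE : (fun y : R => y^-1) ^+ n = (fun y : R => y^-1 ^+ n).
    by apply/funext => y; rewrite fctE.
  rewrite fE in dM.
  apply: is_derive_eq dM _.
  rewrite /= /flat x0 /GRing.scale /=.
  rewrite -exprVn; move: x^-1 (expR _) => y E.
  case: n {dX fE} => [|n]; first by rewrite /= !expr0; ring.
  by rewrite /= !exprS; ring.
- rewrite {2 3}/flat ltxx mulr0 addr0.
  suff H : h^-1 *: ((flat n \o shift 0) (h *: 1) - flat n 0) @[h --> 0^'] --> (0 : R).
    apply: DeriveDef; last exact: cvg_lim.
    by apply/cvg_ex; exists 0.
  apply/cvgrPdist_le => e e0.
  near=> h.
  have -> : flat n 0 = 0 by rewrite /flat ltxx.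
  rewrite /= addr0 subr0 sub0r normrN [h *: 1]mulr1 -[X in `|X|]/(h^-1 * flat n h : R).
  have [h0|h0|h0] := ltgtP h 0.
  + by rewrite flat_eq0 ?mulr0 ?normr0 ltW.
  (* For [h > 0] the difference quotient [flat n h / h] equals [h * flat n.+2 h], and the second
     factor is bounded. *)
  + rewrite flatS // mulKf ?gt_eqF // flatS // ger0_norm ?mulr_ge0 ?flat_ge0 ?(ltW h0) //.
    have hs : h <= e / (n.+2)`!%:R.
      rewrite -[h]gtr0_norm // -normrN -sub0r; near: h.
      apply: cvg_within; apply/nbhs_ballP; exists (e / (n.+2)`!%:R) => /=.
        by rewrite divr_gt0 // ltr0n fact_gt0.
      by move=> z /ltW.
    apply: le_trans (ler_wpM2l (ltW h0) (flat_bound n.+1 h)) _.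
    by rewrite -ler_pdivlMr // ltr0n fact_gt0.
  + by rewrite h0 /flat ltxx mulr0 normr0 ltW.
Unshelve. all: by end_near. Qed.

Lemma smooth_at_flat n (x : R) : smooth_at (flat n : R -> R) x.
Proof.
exists setT; split=> // [|k]; first exact: openT.
have df m y : differentiable (flat m : R -> R) y.
  by apply/derivable1_diffP; have [] := is_derive_flat m y.
elim: k n => [|k IH] n; first by split.
split=> // v.
apply: (@Ck_ext _ _ _ _ _ (fun x => v * (- n%:R * flat n.+1 x + flat n.+2 x))).
- exact: openT.
- move=> y _; have [_ <-] := is_derive_flat n y.
  have E : v = v *: (1 : R) by rewrite [_ *: _]mulr1.
  by rewrite !deriveE // [in RHS]E linearZ.
apply: Ck_M; [exact: openT|exact: Ck_cst|].
apply: (@Ck_D R R R); [exact: openT| |exact: IH].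
by apply: Ck_M; [exact: openT|exact: Ck_cst|].
Qed.

Definition step (x : R) : R := flat 0 x / (flat 0 x + flat 0 (1 - x)).

Lemma flat0_gt0 x : 0 < x -> 0 < flat 0 x.
Proof. by move=> x0; rewrite /flat x0 mul1r expR_gt0. Qed.

Lemma step_den x : 0 < flat 0 x + flat 0 (1 - x).
Proof.
have [x0|x0] := ltP 0 x; first by rewrite ltr_wpDr ?flat_ge0 ?flat0_gt0.
by rewrite ltr_wpDl ?flat_ge0 ?flat0_gt0 // subr_gt0 (le_lt_trans x0).
Qed.

Lemma step_ge0 x : 0 <= step x.
Proof. by rewrite divr_ge0 ?flat_ge0 // ltW // step_den. Qed.

Lemma step_le1 x : step x <= 1.
Proof. by rewrite ler_pdivrMr ?step_den // mul1r lerDl flat_ge0. Qed.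

Lemma step0 x : x <= 0 -> step x = 0.
Proof. by move=> x0; rewrite /step flat_eq0 // mul0r. Qed.

Lemma step1 x : 1 <= x -> step x = 1.
Proof.
move=> x1; rewrite /step (@flat_eq0 0 (1 - x)) ?subr_le0 // addr0 divff // gt_eqF //.
by rewrite flat0_gt0 // (lt_le_trans ltr01).
Qed.

Lemma smooth_at_affine (a b x : R) : smooth_at (fun y : R => a * y + b : R) x.
Proof.
apply: (@smooth_at_D R R R); last exact: smooth_at_cst.
apply: (@smooth_at_M R R); [exact: smooth_at_cst|exact: smooth_at_id].
Qed.

Lemma smooth_at_step (x : R) : smooth_at (step : R -> R) x.
Proof.
have s2 : smooth_at (fun y : R => flat 0 (1 - y) : R) x.
  have E : (fun y : R => flat 0 (1 - y) : R) = (flat 0 : R -> R) \o (fun y : R => -1 * y + 1 : R).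
    by apply/funext => y /=; congr flat; rewrite mulN1r addrC.
  rewrite E; apply: smooth_at_comp; [exact: fdim_R|exact: smooth_at_affine|exact: smooth_at_flat].
apply: (@smooth_at_M R R); first exact: smooth_at_flat.
apply: (@smooth_at_inv R R); first by rewrite gt_eqF // step_den.
by apply: (@smooth_at_D R R R) => //; exact: smooth_at_flat.
Qed.

Lemma derive_step_out x : x <= 0 \/ 1 <= x -> 'D_1 (step : R -> R) x = 0.
Proof.
have dc : continuous ('D_1 (step : R -> R)).
  by move=> y; apply: smooth_at_cont; apply: smooth_at_derive; exact: smooth_at_step.
have lt0 y : y < 0 -> 'D_1 (step : R -> R) y = 0.
  move=> y0; rewrite (@near_eq_derive _ _ _ _ (cst 0)) ?derive_val //.
  near=> z; rewrite step0 // ltW //.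
  by near: z; apply: (open_nbhs_nbhs (conj (@open_lt _ 0) y0)).
have gt1 y : 1 < y -> 'D_1 (step : R -> R) y = 0.
  move=> y0; rewrite (@near_eq_derive R R R _ (cst (1:R))) ?derive_val //.
  near=> z; rewrite step1 // ltW //.
  by near: z; apply: (open_nbhs_nbhs (conj (@open_gt _ 1) y0)).
rewrite !le_eqVlt => -[/orP[/eqP ->|/lt0]|/orP[/eqP <-|/gt1]] //.
(* At the two break points the derivative is recovered by continuity from the side on which [step]
   is constant. *)
- have : ('D_1 (step : R -> R)) x @[x --> (0:R)^'-] --> 'D_1 (step : R -> R) 0.
    by apply: cvg_at_left_filter; exact: dc.
  move=> /cvg_lim <- //; apply: lim_near_cst => //.
  near=> z; apply: lt0; by near: z; exact: nbhs_left_lt.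
- have : ('D_1 (step : R -> R)) x @[x --> (1:R)^'+] --> 'D_1 (step : R -> R) 1.
    by apply: cvg_at_right_filter; exact: dc.
  move=> /cvg_lim <- //; apply: lim_near_cst => //.
  near=> z; apply: gt1; by near: z; exact: nbhs_right_gt.
Unshelve. all: by end_near. Qed.

(** The derivative vanishes off [[0, 1]] and attains its maximum there; the added 1 keeps the bound
    positive. It becomes the constant of [reparametrization]. *)
Lemma derive_step_bounded : exists2 C : R, 0 < C & forall x, `|'D_1 (step : R -> R) x| <= C.
Proof.
have dc : continuous (fun x => `|'D_1 (step : R -> R) x|).
  move=> y; have cy : {for y, continuous ('D_1 (step : R -> R))}.
    by apply: smooth_at_cont; apply: smooth_at_derive; exact: smooth_at_step.
  exact: (cvg_norm cy).
have [c _ hc] := @EVT_max R _ 0 1 ler01 (continuous_subspaceT dc).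
exists (`|'D_1 (step : R -> R) c| + 1); first by rewrite ltr_wpDl.
move=> x; have [x0|x0] := leP x 0; first by rewrite derive_step_out ?normr0 ?addr_ge0 //; left.
have [x1|x1] := leP 1 x; first by rewrite derive_step_out ?normr0 ?addr_ge0 //; right.
by apply: le_trans (hc x _) _; [rewrite in_itv /= !ltW|rewrite lerDl].
Qed.

End SmoothStep.

(** * Partial derivatives and curves in product spaces *)

Section Slices.
Variable R : realType.
Implicit Types V W U : normedModType R.

Lemma smooth_at_fst V W (p : V * W) : smooth_at (@fst V W) p.
Proof. by apply: (@smooth_at_lin _ _ _ fst); exact: continuous_fst. Qed.

Lemma smooth_at_snd V W (p : V * W) : smooth_at (@snd V W) p.
Proof. by apply: (@smooth_at_lin _ _ _ snd); exact: continuous_snd. Qed.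

Lemma smooth_at_slice V W (t : V) (y : W) : smooth_at (fun z : W => (t, z)) y.
Proof. by apply: smooth_at_pair; [exact: smooth_at_cst|exact: smooth_at_id]. Qed.

Lemma diff_slice_r V W U (G : V * W -> U) (t : V) (y : W) :
  differentiable G (t, y) -> differentiable (fun z => G (t, z)) y.
Proof.
move=> dG; apply: (@differentiable_comp _ _ _ _ (fun z => (t, z)) G) .
  exact/smooth_at_diff/smooth_at_slice.
exact: dG.
Qed.

Lemma derive_slice_r V W U (G : V * W -> U) (t : V) (y v : W) : differentiable G (t, y) ->
  'D_v (fun z => G (t, z)) y = 'D_(0, v) G (t, y).
Proof.
move=> dG; rewrite deriveE; last exact: diff_slice_r.
have ds : differentiable (fun z : W => (t, z)) y by exact/smooth_at_diff/smooth_at_slice.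
have di : differentiable (@id W) y by exact/smooth_at_diff/smooth_at_id.
rewrite (_ : (fun z => G (t, z)) = G \o (fun z => (t, z))) //.
have dk : differentiable (fun=> t : V) y by exact: (@differentiable_cst _ W V t y).
rewrite diff_comp //= (diff_pair dk di) /=.
by rewrite deriveE //= diff_cst diff_val.
Qed.

Lemma derive_slice_l V U (G : R * V -> U) (t : R) (y : V) : differentiable G (t, y) ->
  is_derive t 1 (fun s => G (s, y)) ('D_(1, 0) G (t, y)).
Proof.
move=> dG.
have dk : differentiable (fun=> y : V) t by exact: (@differentiable_cst _ R V y t).
have di : differentiable (@id R) t by exact/smooth_at_diff/smooth_at_id.
have dp : differentiable (fun s : R => (s, y)) t by exact: differentiable_pair.
have dc : differentiable (fun s => G (s, y)) t by exact: (@differentiable_comp _ _ _ _ (fun s => (s, y)) G).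
apply: DeriveDef; first exact: diff_derivable.
rewrite deriveE // (_ : (fun s => G (s, y)) = G \o (fun s => (s, y))) //.
rewrite diff_comp //= (diff_pair di dk) /=.
by rewrite deriveE //= diff_cst diff_val.
Qed.

Lemma derive_curve V U (G : R * V -> U) (g : R -> V) (t : R) (w : V) :
  differentiable G (t, g t) -> is_derive t 1 g w ->
  is_derive t 1 (fun s => G (s, g s)) ('D_(1, 0) G (t, g t) + 'D_(0, w) G (t, g t)).
Proof.
move=> dG [/derivable1_diffP dg Eg].
have di : differentiable (@id R) t by exact/smooth_at_diff/smooth_at_id.
have dp : differentiable (fun s : R => (s, g s)) t by exact: differentiable_pair.
have dc : differentiable (fun s => G (s, g s)) t by exact: (@differentiable_comp _ _ _ _ (fun s => (s, g s)) G).
apply: DeriveDef; first exact: diff_derivable.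
rewrite deriveE // (_ : (fun s => G (s, g s)) = G \o (fun s => (s, g s))) //.
rewrite diff_comp //= (diff_pair di dg) /=.
have -> : 'd (@id R) t (1 : R) = 1 by rewrite diff_val.
rewrite -(deriveE _ dg) Eg !deriveE // -linearD.
by congr ('d G _ _); congr pair; rewrite /= ?addr0 ?add0r.
Qed.

End Slices.

(** * Paths of maps of a manifold *)

Section Atlas.
Variables (R : realType) (d : nat) (M : topologicalType) (A : atlas R d M).
Implicit Types (i j k : chart_index A) (x : M).
Notation E := 'rV[R]_d.

Lemma near_dom (T : topologicalType) (f : T -> M) (p : T) j :
  {for p, continuous f} -> chart_dom j (f p) -> \forall q \near p, chart_dom j (f q).
Proof.
by move=> cf Df; apply: (cf (chart_dom j)); apply: open_nbhs_nbhs; split=> //; exact: dom_open.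
Qed.

Lemma near_img (T : topologicalType) (f : T -> E) (p : T) j :
  {for p, continuous f} -> chart_img j (f p) -> \forall q \near p, chart_img j (f q).
Proof.
by move=> cf Df; apply: (cf (chart_img j)); apply: open_nbhs_nbhs; split=> //; exact: img_open.
Qed.

Lemma param_cont i x : chart_dom i x -> {for chart i x, continuous (param i)}.
Proof. by move=> Dx; apply: param_continuous; exact: chart_to. Qed.

Definition jcont (Phi : R -> M -> M) := continuous (fun p : R * M => Phi p.1 p.2).

Lemma cont_expr (Phi : R -> M -> M) t i x : jcont Phi -> chart_dom i x ->
  {for (t, chart i x), continuous (fun p : R * E => Phi p.1 (param i p.2))}.
Proof.
move=> cP Dx.
apply: (@continuous_comp _ _ _ (fun p : R * E => (p.1, param i p.2)) (fun p : R * M => Phi p.1 p.2)).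
  apply: continuous_pair_at; first exact: continuous_fst.
  apply: continuous_comp; first exact: continuous_snd.
  exact: param_cont.
exact: cP.
Qed.

Lemma near_expr (Phi : R -> M -> M) t i j x : jcont Phi -> chart_dom i x ->
  chart_dom j (Phi t x) ->
  \forall p \near (t, chart i x), chart_dom j (Phi p.1 (param i p.2)).
Proof.
move=> cP Dx Dj; apply: (near_dom (cont_expr cP Dx)).
by rewrite /= chartK.
Qed.

Definition cexpr (Phi : R -> M -> M) i j (p : R * E) : E := chart j (Phi p.1 (param i p.2)).

(* Paths are parametrized by all of R, which makes the domains of the chart
   expressions open, and need not start at the identity. *)
Definition gpath (Phi : R -> M -> M) := jcont Phi /\
  forall i j t x, chart_dom i x -> chart_dom j (Phi t x) ->
    smooth_at (cexpr Phi i j) (t, chart i x).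

Lemma near_img2 (t : R) i x : chart_dom i x ->
  \forall p \near ((t, chart i x) : R * E), chart_img i p.2.
Proof. by move=> Dx; apply: near_img; [exact: continuous_snd|exact: chart_to]. Qed.

Lemma gpath_comp Phi Psi : gpath Phi -> gpath Psi -> gpath (fun t x => Phi t (Psi t x)).
Proof.
move=> [cPhi sPhi] [cPsi sPsi]; split.
  move=> p; apply: (@continuous_comp _ _ _ (fun p : R * M => (p.1, Psi p.1 p.2)) (fun p : R * M => Phi p.1 p.2)).
    by apply: continuous_pair_at; [exact: continuous_fst|exact: cPsi].
  exact: cPhi.
move=> i j t x Di Dj; have [k Dk] := dom_cover A (Psi t x).
apply: (@smooth_at_ext _ _ _ (cexpr Phi k j \o (fun p => (p.1, cexpr Psi i k p)))).
  have := near_expr cPsi Di Dk; apply: filterS => p Dkp.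
  by rewrite /cexpr /= chartK.
apply: smooth_at_comp.
- by apply: fdim_pair; [exact: fdim_R|exact: fdim_rV].
- by apply: smooth_at_pair; [exact: smooth_at_fst|exact: sPsi].
- have -> : cexpr Psi i k (t, chart i x) = chart k (Psi t x) by rewrite /cexpr /= chartK.
  exact: sPhi.
Qed.

Lemma smooth_map_at phi : smooth_map A phi <-> continuous phi /\
  forall i j x, chart_dom i x -> chart_dom j (phi x) ->
    smooth_at (chart j \o phi \o param i) (chart i x).
Proof.
have H (cphi : continuous phi) i j :
    open [set y | chart_img i y /\ chart_dom j (phi (param i y))].
  rewrite openE => y [Iy Dy]; rewrite /interior /=.
  near=> z; split; first by near: z; apply: open_nbhs_nbhs; split=> //; exact: img_open.
  near: z; apply: (@near_dom _ (phi \o param i)) => //.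
  by apply: continuous_comp; [exact: param_continuous|exact: cphi].
split=> -[cphi s]; split=> // i j.
  move=> x Di Dj; have /(smooth_onP _ (H cphi i j)) := s i j; apply.
  by split; [exact: chart_to|rewrite chartK].
apply/(smooth_onP _ (H cphi i j)) => y [Iy Dy].
by rewrite -(paramK Iy); apply: s => //; exact: param_to.
Unshelve. all: by end_near. Qed.

Lemma gpath_smooth_map Phi t : gpath Phi -> smooth_map A (Phi t).
Proof.
move=> [cPhi sPhi]; apply/smooth_map_at; split.
  move=> x; apply: (@continuous_comp _ _ _ (fun x => (t, x)) (fun p : R * M => Phi p.1 p.2)).
    by apply: continuous_pair_at; [exact: cvg_cst|exact: cvg_id].
  exact: cPhi.
move=> i j x Di Dj.
have := @smooth_at_comp _ _ _ _ (fun y : E => (t, y)) (cexpr Phi i j) (chart i x).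
apply.
- by apply: fdim_pair; [exact: fdim_R|exact: fdim_rV].
- exact: smooth_at_slice.
- exact: sPhi.
Qed.

Hypothesis cptM : compact [set: M].
Hypothesis hausM : hausdorff_space M.

(* Fibrewise inverses on a compact fibre: every cluster point of [Theta] along a
   filter converging to [(t, x)] is sent by [Phi t] to [x]. *)
Lemma jcont_inv (T : topologicalType) (Phi Theta : T -> M -> M) :
  continuous (fun p : T * M => Phi p.1 p.2) ->
  (forall t, cancel (Phi t) (Theta t)) -> (forall t, cancel (Theta t) (Phi t)) ->
  continuous (fun p : T * M => Theta p.1 p.2).
Proof.
move=> cPhi PK TK [t x].
pose F := (fun p : T * M => Theta p.1 p.2) @ (t, x).
have clE z : cluster F z -> z = Theta t x.
  move=> clz; suff E : x = Phi t z by rewrite E PK.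
  apply: hausM => B C Bx Cz.
  have [[T0 Z0] /= [nT nZ] TZ] := cPhi (t, z) C Cz.
  have FC : F [set w | exists s y, [/\ T0 s, B y & w = Theta s y]].
    exists (T0, B) => //= -[s y] [/= Ts By]; by exists s, y.
  have [w [[s [y [Ts By wE]]] Zw]] := clz _ _ FC nZ.
  exists y; split=> //; have := TZ (s, w); rewrite /= wE TK; apply.
  by split=> //=; rewrite -wE.
have FT : F setT by exact: filterT.
have [z [_ cz]] := @cptM F _ FT.
apply: (@compact_cluster_set1 _ (Theta t x) F setT) => //; first exact: filterT.
rewrite eqEsubset; split=> w; first exact: clE.
by move=> /= ->; rewrite -(clE _ cz).
Qed.

End Atlas.

Section Paths.
Variables (R : realType) (d : nat) (M : topologicalType) (A : atlas R d M).
Implicit Types (i j k : chart_index A) (x : M).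
Notation E := 'rV[R]_d.
Hypothesis cptM : compact [set: M].
Hypothesis hausM : hausdorff_space M.

Lemma cexpr_at (Phi : R -> M -> M) i j t x : chart_dom i x ->
  cexpr Phi i j (t, chart i x) = chart j (Phi t x).
Proof. by move=> Dx; rewrite /cexpr /= chartK. Qed.

Lemma derive_cexpr (Phi : R -> M -> M) i j t x v : gpath A Phi ->
  chart_dom i x -> chart_dom j (Phi t x) ->
  'D_v (chart j \o Phi t \o param i) (chart i x) = 'D_(0, v) (cexpr Phi i j) (t, chart i x).
Proof.
move=> [_ sP] Di Dj; rewrite -derive_slice_r //.
exact/smooth_at_diff/sP.
Qed.

Lemma derive_id_near (f : E -> E) y v : (\forall z \near y, f z = z) -> 'D_v f y = v.
Proof.
move=> h; rewrite (near_eq_derive _ h).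
by have [_ ->] := @is_derive_id _ _ y v.
Qed.

(** Each [Theta t] is known to be smooth in space only. Joint continuity comes from compactness
    ([jcont_inv]), and joint smoothness from inverting the chart expressions of [Phi] as
    time-dependent maps. *)
Lemma gpath_inv Phi Theta : gpath A Phi -> (forall t, smooth_map A (Theta t)) ->
  (forall t, cancel (Phi t) (Theta t)) -> (forall t, cancel (Theta t) (Phi t)) ->
  gpath A Theta.
Proof.
move=> gP sT PK TK; have [cP sP] := gP.
have cT : jcont Theta by exact: (jcont_inv cptM hausM cP PK TK).
split=> // i j t x Di Dj.
have E0 : cexpr Theta i j (t, chart i x) = chart j (Theta t x) by exact: cexpr_at.
have DP : chart_dom i (Phi t (Theta t x)) by rewrite TK.
apply: (@smooth_at_path_inverse _ _ (cexpr Phi j i)); rewrite ?E0.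
- exact: sP.
(* Differentiating [Theta t (Phi t z) = z] forces a vector killed by the derivative of [Phi t] to
   vanish. *)
- move=> v; rewrite -derive_cexpr // => Dv.
  have /smooth_map_at [_ sTt] := sT t.
  have sU := sTt _ _ _ Di Dj.
  have /smooth_map_at [_ sPt] := gpath_smooth_map t gP.
  have sW := sPt _ _ _ Dj DP.
  have E1 : (chart i \o Phi t \o param j) (chart j (Theta t x)) = chart i x.
    by rewrite /= chartK // TK.
  rewrite -(@derive_id_near ((chart j \o Theta t \o param i) \o (chart i \o Phi t \o param j)) (chart j (Theta t x)) v).
    have df := smooth_at_diff sW.
    have dg : differentiable (chart j \o Theta t \o param i) ((chart i \o Phi t \o param j) (chart j (Theta t x))).
      by rewrite E1; exact: smooth_at_diff.
    rewrite deriveE; last exact: (differentiable_comp df dg).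
    rewrite (diff_comp df dg) /= -[X in 'd _ _ X](deriveE v df).
    by rewrite Dv linear0.
  near=> z; rewrite /= chartK.
    rewrite PK paramK //; near: z; apply: (@near_img _ _ _ _ _ id); [exact: cvg_id|exact: chart_to].
  near: z; apply: (@near_dom _ _ _ _ _ (Phi t \o param j)); last by rewrite /= chartK.
  apply: continuous_comp; first exact: param_cont.
  by have [cPt _] := gpath_smooth_map t gP; exact: cPt.
- near=> p.
  have Dp : chart_dom j (Theta p.1 (param i p.2)) by near: p; exact: near_expr.
  have Ip : chart_img i p.2 by near: p; exact: near_img2.
  split; last by rewrite /cexpr /= chartK // TK paramK.
  apply: (@continuous_comp _ _ _ (fun p : R * E => Theta p.1 (param i p.2)) (chart j)); last exact: chart_continuous.
  rewrite [p]surjective_pairing -(paramK Ip); apply: cont_expr => //.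
  exact: param_to.
Unshelve. all: by end_near. Qed.

Lemma jcont_clamp (T : topologicalType) (Phi : R -> M -> T) :
  {within `[0, 1] `*` [set: M], continuous (fun p : R * M => Phi p.1 p.2)} ->
  continuous (fun p : R * M => Phi (clamp p.1) p.2).
Proof.
move=> cP p.
have c2 : {for p, continuous (fun p : R * M => (clamp p.1, p.2))}.
  apply: continuous_pair_at; last exact: continuous_snd.
  by apply: continuous_comp; [exact: continuous_fst|exact: clamp_continuous].
have gB (y : R * M) : (`[0, 1] `*` [set: M]) (clamp y.1, y.2) by split=> //; exact: clamp01.
exact: (continuous_within_comp cP gB c2).
Qed.

(** Smoothness up to the boundary provides a function smooth in a full neighbourhood, which
    represents the path only at times in [[0, 1]]. All one-sided derivatives are computed from such
    a [g]. *)
Lemma smooth_path_at (Phi : R -> M -> M) t i j x : smooth_path_of_maps A Phi ->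
  `[0, 1]%classic t -> chart_dom i x -> chart_dom j (Phi t x) ->
  exists g : R * E -> E, smooth_at g (t, chart i x) /\
    \forall p \near (t, chart i x), `[0, 1]%classic p.1 -> g p = cexpr Phi i j p.
Proof.
move=> [cP sP] t01 Di Dj.
have [|O [g [oO Ox dg gE]]] := sP i j (t, chart i x).
  by split=> //=; [exact: chart_to|rewrite chartK].
exists g; split; first by exists O; split=> //; apply/Ck_foldrP.
have cPc := jcont_clamp cP.
have nD : \forall p \near (t, chart i x), chart_dom j (Phi (clamp p.1) (param i p.2)).
  by apply: (@near_expr _ _ _ A (fun t => Phi (clamp t)) t i j x cPc Di); rewrite clamp_id.
near=> p => p01; apply: gE; last first.
  by near: p; exact: open_nbhs_nbhs.
split=> //; first by near: p; exact: near_img2.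
by rewrite -(clamp_id p01); near: p.
Unshelve. all: by end_near. Qed.

Definition unit_time (z : R -> R) :=
  (forall t, smooth_at (z : R -> R) t) /\ forall t, `[0, 1]%classic (z t).

(** Since [z] never leaves [[0, 1]], the local extension [g] composed with [z] always agrees with
    the path, on both sides of every time. *)
Lemma gpath_reparam (Phi : R -> M -> M) z : smooth_path_of_maps A Phi ->
  unit_time z -> gpath A (fun t => Phi (z t)).
Proof.
move=> sP [sz z01]; split.
  have [cP _] := sP; have cPc := jcont_clamp cP.
  rewrite /jcont (_ : (fun p => _) = (fun p : R * M => Phi (clamp p.1) p.2) \o (fun p : R * M => (z p.1, p.2))); last first.
    by apply/funext => p /=; rewrite clamp_id.
  move=> p; apply: continuous_comp; last exact: cPc.
  apply: continuous_pair_at; last exact: continuous_snd.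
  by apply: continuous_comp; [exact: continuous_fst|exact/smooth_at_cont].
move=> i j t x Di Dj.
have [g [sg gE]] := smooth_path_at sP (z01 t) Di Dj.
have sz2 : smooth_at (fun p : R * E => (z p.1, p.2)) (t, chart i x).
  apply: smooth_at_pair; last exact: smooth_at_snd.
  apply: (@smooth_at_comp _ _ _ _ (@fst R E) z); [exact: fdim_R|exact: smooth_at_fst|exact: sz].
apply: (@smooth_at_ext _ _ _ (g \o (fun p : R * E => (z p.1, p.2)))).
  have : \forall p \near (t, chart i x), `[0, 1]%classic (z p.1) -> g (z p.1, p.2) = cexpr Phi i j (z p.1, p.2).
    exact: (smooth_at_cont sz2 gE).
  by apply: filterS => p; apply.
by apply: smooth_at_comp => //; apply: fdim_pair; [exact: fdim_R|exact: fdim_rV].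
Qed.

End Paths.

(** * Composition of contact systems *)

Section Systems.
Variables (R : realType) (d : nat) (M : topologicalType) (A : atlas R d M).
Implicit Types (i j k : chart_index A) (x : M).
Notation E := 'rV[R]_d.
Variable a : chart_index A -> E -> 'cV[R]_d.

Lemma pairingD (v w : E) c : pairing (v + w) c = pairing v c + pairing w c.
Proof. by rewrite /pairing mulmxDl mxE. Qed.

Lemma pairingZ r (v : E) c : pairing (r *: v) c = r * pairing v c.
Proof. by rewrite /pairing -scalemxAl mxE. Qed.

Lemma pairing0 (c : 'cV[R]_d) : pairing 0 c = 0.
Proof. by rewrite /pairing mul0mx mxE. Qed.

(** The analogue of [hamiltonian] for paths over all of [R], where velocities are two-sided
    derivatives. *)
Definition alpha_velocity (Phi : R -> M -> M) (H : R -> M -> R) :=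
  forall t x j, chart_dom j (Phi t x) ->
    H t (Phi t x) = pairing ('D_1 (fun s => chart j (Phi s x)) t) (a j (chart j (Phi t x))).

(** Contact systems over all of [R] with the inverse path [Theta] as part of the data. As no initial
    condition is imposed, they are stable under composition, inversion and change of time. *)
Definition gsystem (Phi Theta : R -> M -> M) (H h : R -> M -> R) : Prop :=
  [/\ gpath A Phi, gpath A Theta,
      (forall t, cancel (Phi t) (Theta t) /\ cancel (Theta t) (Phi t)),
      alpha_velocity Phi H &
      forall t, conformal_factor a (Phi t) (h t) /\ smooth_fun A (h t)].

Lemma smooth_fun_at (g : M -> R) : smooth_fun A g <->
  forall i x, chart_dom i x -> smooth_at (g \o param i) (chart i x).
Proof.
split=> sg i.
  by move=> x Dx; have /(smooth_onP _ (@img_open _ _ _ A i)) := sg i; apply; exact: chart_to.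
apply/(smooth_onP _ (@img_open _ _ _ A i)) => y Iy.
by rewrite -(paramK Iy); apply: sg; exact: param_to.
Qed.

Lemma smooth_fun_comp (g : M -> R) phi : smooth_map A phi -> smooth_fun A g -> smooth_fun A (g \o phi).
Proof.
move=> /smooth_map_at [cphi sphi] /smooth_fun_at sg; apply/smooth_fun_at => i x Di.
have [j Dj] := dom_cover A (phi x).
apply: (@smooth_at_ext _ _ _ ((g \o param j) \o (chart j \o phi \o param i))).
  near=> y; rewrite /= chartK //; near: y.
  apply: (@near_dom _ _ _ _ _ (phi \o param i)); last by rewrite /= chartK.
  by apply: continuous_comp; [exact: param_cont|exact: cphi].
apply: smooth_at_comp; [exact: fdim_rV|exact: sphi|].
by rewrite /= chartK //; exact: sg.
Unshelve. all: by end_near. Qed.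

Lemma smooth_funD (f g : M -> R) : smooth_fun A f -> smooth_fun A g -> smooth_fun A (fun x => f x + g x).
Proof.
move=> /smooth_fun_at sf /smooth_fun_at sg; apply/smooth_fun_at => i x Di.
by apply: (@smooth_at_D R E R (f \o param i) (g \o param i)); [exact: sf|exact: sg].
Qed.

Lemma smooth_funN (f : M -> R) : smooth_fun A f -> smooth_fun A (fun x => - f x).
Proof.
move=> /smooth_fun_at sf; apply/smooth_fun_at => i x Di.
by apply: (@smooth_at_N R E R (f \o param i)); exact: sf.
Qed.

Lemma chain_charts (phi psi : M -> M) i k j x v : smooth_map A phi -> smooth_map A psi ->
  chart_dom i x -> chart_dom k (psi x) -> chart_dom j (phi (psi x)) ->
  'D_v (chart j \o (phi \o psi) \o param i) (chart i x) =
  'D_('D_v (chart k \o psi \o param i) (chart i x)) (chart j \o phi \o param k) (chart k (psi x)).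
Proof.
move=> /smooth_map_at [cphi sphi] /smooth_map_at [cpsi spsi] Di Dk Dj.
pose F := chart k \o psi \o param i; pose G := chart j \o phi \o param k.
have df : differentiable F (chart i x) by exact: smooth_at_diff (spsi _ _ _ Di Dk).
have E1 : F (chart i x) = chart k (psi x) by rewrite /F /= chartK.
have dg : differentiable G (F (chart i x)).
  by rewrite E1; exact: smooth_at_diff (sphi _ _ _ Dk Dj).
rewrite -/F -/G -E1 (@near_eq_derive _ _ _ _ (G \o F)); last first.
  near=> y; rewrite /G /F /= chartK //; near: y.
  apply: (@near_dom _ _ _ _ _ (psi \o param i)); last by rewrite /= chartK.
  by apply: continuous_comp; [exact: param_cont|exact: cpsi].
rewrite (deriveE _ (differentiable_comp df dg)) (diff_comp df dg).
by rewrite (deriveE _ dg) (deriveE _ df).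
Unshelve. all: by end_near. Qed.

Lemma derive_orbit (Phi : R -> M -> M) t i j x : gpath A Phi -> chart_dom i x -> chart_dom j (Phi t x) ->
  is_derive t 1 (fun s => chart j (Phi s x)) ('D_(1, 0) (cexpr Phi i j) (t, chart i x)).
Proof.
move=> [_ sP] Di Dj.
have -> : (fun s => chart j (Phi s x)) = (fun s => cexpr Phi i j (s, chart i x)).
  by apply/funext => s; rewrite cexpr_at.
exact/derive_slice_l/smooth_at_diff/sP.
Qed.

(* The velocity of a composition splits into the velocity of the outer path and
   the image of the velocity of the inner one. *)
Lemma derive_comp_path (Phi Psi : R -> M -> M) t k j x : gpath A Phi -> gpath A Psi ->
  chart_dom k (Psi t x) -> chart_dom j (Phi t (Psi t x)) ->
  'D_1 (fun s => chart j (Phi s (Psi s x))) t =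
  'D_1 (fun s => chart j (Phi s (Psi t x))) t +
  'D_('D_1 (fun s => chart k (Psi s x)) t) (chart j \o Phi t \o param k) (chart k (Psi t x)).
Proof.
move=> gP gS Dk Dj; have [i Di] := dom_cover A x.
have dk := derive_orbit gS Di Dk.
have [_ Ek] := dk.
have [_ ->] := derive_orbit gP Dk Dj.
rewrite derive_cexpr // Ek.
have [_ sP] := gP; have := smooth_at_diff (sP _ _ _ _ Dk Dj) => dG.
have [_ <-] := derive_curve dG dk.
apply: near_eq_derive; near=> s; rewrite /cexpr /= chartK //; near: s.
apply: (@near_dom _ _ _ _ _ (fun s => Psi s x)) => //.
have [cS _] := gS.
apply: (@continuous_comp _ _ _ (fun s : R => (s, x)) (fun p : R * M => Psi p.1 p.2)); last exact: cS.
by apply: continuous_pair_at; [exact: cvg_id|exact: cvg_cst].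
Unshelve. all: by end_near. Qed.

(** The velocity of the inner path is pushed forward by [Phi t], which multiplies its pairing with
    the contact form by [e^h]; writing the result as a function of the end point brings in
    [Theta t]. *)
Lemma gsystem_comp Phi Theta H h Phi' Theta' H' h' :
  gsystem Phi Theta H h -> gsystem Phi' Theta' H' h' ->
  gsystem (fun t x => Phi t (Phi' t x)) (fun t x => Theta' t (Theta t x))
    (fun t x => H t x + expR (h t (Theta t x)) * H' t (Theta t x))
    (fun t x => h t (Phi' t x) + h' t x).
Proof.
move=> [gP gT PT vH ch] [gP' gT' PT' vH' ch']; split.
- exact: gpath_comp.
- exact: gpath_comp.
- move=> t; have [PK TK] := PT t; have [PK' TK'] := PT' t.
  by split=> x; rewrite ?PK ?PK' // TK' TK.
- move=> t x j Dj; have [k Dk] := dom_cover A (Phi' t x).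
  rewrite (derive_comp_path gP gP' Dk Dj) pairingD -(vH _ _ _ Dj); congr (_ + _).
  have [PK _] := PT t; rewrite PK (vH' _ _ _ Dk).
  have [c _] := ch t.
  have := c k j (Phi' t x) ('D_1 (fun s => chart k (Phi' s x)) t) Dk Dj.
  by move=> <-.
- move=> t; have [c s] := ch t; have [c' s'] := ch' t; split.
    move=> i j x v Di Dj; have [k Dk] := dom_cover A (Phi' t x).
    have sP := gpath_smooth_map t gP; have sP' := gpath_smooth_map t gP'.
    have := chain_charts v sP sP' Di Dk Dj; rewrite -/(Phi t \o Phi' t) => ->.
    by rewrite (c _ _ _ _ Dk Dj) (c' _ _ _ _ Di Dk) expRD mulrA.
  by apply: smooth_funD => //; apply: smooth_fun_comp => //; exact: gpath_smooth_map.
Qed.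

(** Differentiating the constant curve [Phi s (Theta s x) = x] makes the two contributions of
    [derive_comp_path] cancel; solving for the inner one gives the formula. *)
Lemma gsystem_inv Phi Theta H h : gsystem Phi Theta H h ->
  gsystem Theta Phi (fun t x => - (expR (- h t x) * H t (Phi t x)))
    (fun t x => - h t (Theta t x)).
Proof.
move=> [gP gT PT vH ch]; split=> //.
- by move=> t; have [] := PT t.
- move=> t x j Dj; have [i Di] := dom_cover A x.
  have [PK TK] := PT t.
  have Di' : chart_dom i (Phi t (Theta t x)) by rewrite TK.
  have E1 := derive_comp_path gP gT Dj Di'.
  have E2 : (fun s => chart i (Phi s (Theta s x))) = cst (chart i x).
    by apply/funext => s; rewrite (PT s).2.
  have {}E1 : 0 = 'D_1 (fun s => chart i (Phi s (Theta t x))) t +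
      'D_('D_1 (fun s => chart j (Theta s x)) t) (chart i \o Phi t \o param j) (chart j (Theta t x)).
    by rewrite -E1 E2 derive_val.
  have := congr1 (fun v => pairing v (a i (chart i (Phi t (Theta t x))))) E1.
  rewrite pairing0 pairingD -vH //.
  have [c _] := ch t; rewrite (c _ _ _ _ Dj Di') => /esym/eqP.
  rewrite addr_eq0 => /eqP ->.
  by rewrite mulrN opprK mulrA -expRD addNr expR0 mul1r.
- move=> t; have [c s] := ch t; have [PK TK] := PT t; split; last first.
    by apply: smooth_funN; apply: smooth_fun_comp => //; exact: gpath_smooth_map.
  move=> i j x v Di Dj.
  have Di' : chart_dom i (Phi t (Theta t x)) by rewrite TK.
  have sP := gpath_smooth_map t gP; have sT := gpath_smooth_map t gT.
  have E1 := chain_charts v sP sT Di Dj Di'.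
  have := c _ _ _ ('D_v (chart j \o Theta t \o param i) (chart i x)) Dj Di'.
  rewrite -E1 TK (_ : Phi t \o Theta t = id); last by apply/funext => y; rewrite /= TK.
  rewrite derive_id_near; last first.
    near=> z; rewrite /= paramK //; near: z.
    by apply: (@near_img _ _ _ _ _ id); [exact: cvg_id|exact: chart_to].
  by move=> ->; rewrite mulrA -expRD addNr expR0 mul1r.
Unshelve. all: by end_near. Qed.

Hypothesis cptM : compact [set: M].
Hypothesis hausM : hausdorff_space M.
Hypothesis a_neq0 : forall i y, chart_img i y -> exists v, pairing v (a i y) != 0.

(** Lets a conformal factor be read off from the map alone, which later replaces explicit
    computations with concatenated factors. *)
Lemma conformal_factor_uniq phi g h :
  conformal_factor a phi g -> conformal_factor a phi h -> g = h.
Proof.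
move=> cg ch; apply/funext => x.
have [i Di] := dom_cover A x; have [j Dj] := dom_cover A (phi x).
have [v v0] := a_neq0 (chart_to Di).
have := cg i j x v Di Dj; rewrite (ch i j x v Di Dj) => /(mulIf v0) /esym.
exact: expR_inj.
Qed.

End Systems.

(** * One-sided velocities and changes of time *)

Section Velocity.
Variable R : realType.

(** Makes velocities unique, including at the end points: there is room to the right of [t] if
    [t < 1] and to its left otherwise. *)
Lemma within01_proper (t : R) : `[0, 1]%classic t -> ProperFilter (within `[0, 1]%classic t^').
Proof.
rewrite /= in_itv /= => /andP[t0 t1]; apply: Build_ProperFilter_ex => P.
move=> [e /= e0 He].
have [t2|t2] := ltP t 1.
  pose s := t + Num.min (e / 2) (1 - t).
  have m0 : 0 < Num.min (e / 2) (1 - t) by rewrite lt_min divr_gt0 //= subr_gt0.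
  have m1 : Num.min (e / 2) (1 - t) <= e / 2 by rewrite ge_min lexx.
  have m2 : Num.min (e / 2) (1 - t) <= 1 - t by rewrite ge_min lexx orbT.
  exists s; apply: He.
  - by rewrite /= /s opprD addrA subrr add0r normrN gtr0_norm //; lra.
  - by rewrite /s; apply/eqP; lra.
  - by rewrite /= in_itv /= /s; lra.
pose s := t - Num.min (e / 2) t.
have m0 : 0 < Num.min (e / 2) t by rewrite lt_min divr_gt0 //=; lra.
have m1 : Num.min (e / 2) t <= e / 2 by rewrite ge_min lexx.
have m2 : Num.min (e / 2) t <= t by rewrite ge_min lexx orbT.
exists s; apply: He.
- by rewrite /= /s opprB addrC subrK gtr0_norm //; lra.
- by rewrite /s; apply/eqP; lra.
- by rewrite /= in_itv /= /s; lra.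
Qed.

Lemma quotient_within (V : normedModType R) (f : R -> V) (t : R) (l : V) (B : set R) :
  is_derive t 1 f l -> (s - t)^-1 *: (f s - f t) @[s --> within B t^'] --> l.
Proof.
move=> [df E]; have : h^-1 *: (f (h + t) - f t) @[h --> 0^'] --> l.
  rewrite -E; have := df; rewrite /derivable => /cvgP; rewrite /derive.
  by under eq_fun do rewrite /= [_ *: 1]mulr1.
move=> /cvgrPdist_le H; apply/cvgrPdist_le => e e0.
have [r /= r0 Hr] := H e e0.
exists r => //= s st snt Bs.
have := Hr (s - t); rewrite subrK; apply.
  by rewrite /= sub0r normrN distrC.
by rewrite subr_eq0.
Qed.

End Velocity.

Section Systems.
Variables (R : realType) (d : nat) (M : topologicalType) (A : atlas R d M).
Implicit Types (i j k : chart_index A) (x : M).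
Notation E := 'rV[R]_d.
Variable a : chart_index A -> E -> 'cV[R]_d.
Hypothesis cptM : compact [set: M].
Hypothesis hausM : hausdorff_space M.
Hypothesis a_neq0 : forall i y, chart_img i y -> exists v, pairing v (a i y) != 0.

Lemma velocity_uniq Phi j t x v w : velocity Phi j t x v -> velocity Phi j t x w ->
  `[0, 1]%classic t -> v = w.
Proof.
rewrite /velocity => cv cw t01.
have PF := within01_proper t01.
exact: (cvg_unique (@norm_hausdorff _ _) cv cw).
Qed.

Lemma velocity_local (Phi : R -> M -> M) i j t x (g : R * E -> E) :
  `[0, 1]%classic t -> chart_dom i x ->
  smooth_at g (t, chart i x) ->
  (\forall p \near (t, chart i x), `[0, 1]%classic p.1 -> g p = cexpr Phi i j p) ->
  velocity Phi j t x ('D_(1, 0) g (t, chart i x)).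
Proof.
move=> t01 Di sg gE.
have Q := quotient_within `[0, 1]%classic (derive_slice_l (smooth_at_diff sg)).
rewrite /velocity; apply: (cvg_trans _ Q); apply: near_eq_cvg.
have nE : \forall s \near t, `[0, 1]%classic s -> g (s, chart i x) = cexpr Phi i j (s, chart i x).
  have c : {for t, continuous (fun s : R => (s, chart i x))}.
    by apply: continuous_pair_at; [exact: cvg_id|exact: cvg_cst].
  exact: (c _ gE).
have e0 := nbhs_singleton nE t01.
rewrite near_withinE; near=> s => s01.
have -> : g (s, chart i x) = cexpr Phi i j (s, chart i x).
  by move: s01; near: s; exact: nbhs_dnbhs.
by rewrite e0 !cexpr_at.
Unshelve. all: by end_near. Qed.

(** The chain rule multiplies the velocity, hence the Hamiltonian, by [z']. The velocity at [z t]
    may be one-sided; it is identified with the derivative of a local smooth extension. *)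
Lemma system_reparam (Phi Theta : R -> M -> M) H h z :
  smooth_contact_system a Phi H h ->
  (forall t, `[0, 1]%classic t ->
     [/\ smooth_map A (Theta t), cancel (Phi t) (Theta t) & cancel (Theta t) (Phi t)]) ->
  unit_time z ->
  gsystem a (fun t => Phi (z t)) (fun t => Theta (z t))
    (fun t x => 'D_1 (z : R -> R) t * H (z t) x) (fun t => h (z t)).
Proof.
move=> [[sP cd P0] hH ch] HT uz; have [sz z01] := uz.
have gP := gpath_reparam sP uz.
split=> //.
- apply: (gpath_inv cptM hausM gP) => t; have [] := HT _ (z01 t); done.
- by move=> t; have [] := HT _ (z01 t).
- move=> t x j Dj; have [i Di] := dom_cover A x.
  have [v [cv ->]] := hH _ _ _ (z01 t) Dj.
  have [g [sg gE]] := smooth_path_at sP (z01 t) Di Dj.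
  have -> := velocity_uniq cv (velocity_local (z01 t) Di sg gE) (z01 t).
  rewrite -pairingZ; congr pairing.
  have dz : is_derive t 1 (z : R -> R) ('D_1 (z : R -> R) t).
    by apply: derivableP; apply: diff_derivable; exact/smooth_at_diff.
  have dc : is_derive t 1 (fun s : R => (z s, chart i x)) ('D_1 (z : R -> R) t *: (1 : R), 0 : E).
    have dk : differentiable (fun=> chart i x : E) t by exact: (@differentiable_cst _ R E _ t).
    have dz' := smooth_at_diff (sz t).
    apply: DeriveDef; first exact/diff_derivable/differentiable_pair.
    rewrite deriveE; last exact: differentiable_pair.
    by rewrite (diff_pair dz' dk) /= diff_cst -deriveE // [_ *: _]mulr1.
  have dg := smooth_at_diff sg.
  transitivity ('D_1 (g \o (fun s : R => (z s, chart i x))) t); last first.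
    apply: near_eq_derive.
    have c : {for t, continuous (fun s : R => (z s, chart i x))}.
      by apply: continuous_pair_at; [exact/smooth_at_cont|exact: cvg_cst].
    have nE : \forall s \near t, `[0, 1]%classic (z s) -> g (z s, chart i x) = cexpr Phi i j (z s, chart i x) := c _ gE.
    by apply: filterS nE => s hs; rewrite [LHS](hs (z01 s)) cexpr_at.
  have [/derivable1_diffP dc1 dc2] := dc.
  rewrite [RHS](deriveE _ (differentiable_comp dc1 dg)) (diff_comp dc1 dg) [RHS]/comp.
  rewrite -(deriveE _ dc1) dc2 (deriveE _ dg) -linearZ; congr ('d g _ _).
  by congr pair; rewrite /= ?scaler0.
- move=> t; split; first exact: ch.
  (* The system asserts no smoothness of [h], but [h] must coincide with the smooth factor provided
     by [contact_diffeo]. *)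
  have [_ [g [sg cg]]] := cd _ (z01 t).
  by rewrite (conformal_factor_uniq a_neq0 (ch _ (z01 t)) cg).
Qed.

Lemma gsystem_contact Phi Theta H h : gsystem a Phi Theta H h -> (forall x, Phi 0 x = x) ->
  smooth_contact_system a Phi H h.
Proof.
move=> [gP gT PT vH ch] P0; have [cP sP] := gP; split.
- split=> //.
    split; first exact: continuous_subspaceT.
    move=> i j [t y] [/= t01 Iy Dj].
    have [] := sP i j t (param i y) _ Dj; first exact: param_to.
    rewrite paramK // => O [oO Oy hO].
    exists O, (cexpr Phi i j); split=> //.
    exact/Ck_foldrP.
  move=> t _; split.
    split; first exact: gpath_smooth_map.
    by exists (Theta t); have [PK TK] := PT t; split=> //; exact: gpath_smooth_map.
  by exists (h t); have [] := ch t.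
- move=> t x j t01 Dj; have [i Di] := dom_cover A x.
  have [_ Eo] := derive_orbit gP Di Dj.
  exists ('D_(1, 0) (cexpr Phi i j) (t, chart i x)); split.
    by apply: velocity_local => //; [exact: sP|near=> p].
  by rewrite (vH _ _ _ Dj) Eo.
- by move=> t _; have [] := ch t.
Unshelve. all: by end_near. Qed.

End Systems.

(** * Joint continuity of conformal factors and Hamiltonians *)

Section Continuity.
Variables (R : realType) (d : nat) (M : topologicalType) (A : atlas R d M).
Implicit Types (i j k : chart_index A) (x : M).
Notation E := 'rV[R]_d.
Variable a : chart_index A -> E -> 'cV[R]_d.
Hypothesis cptM : compact [set: M].
Hypothesis hausM : hausdorff_space M.
Hypothesis a_neq0 : forall i y, chart_img i y -> exists v, pairing v (a i y) != 0.
Hypothesis smooth_a : one_form a.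

Lemma one_form_cont i y : chart_img i y -> {for y, continuous (a i)}.
Proof.
move=> Iy; have [sa _] := smooth_a; apply: smooth_at_cont.
by have /(smooth_onP _ (@img_open _ _ _ A i)) := sa i; apply.
Qed.

Lemma pairing_cont (T : topologicalType) (f : T -> E) (g : T -> 'cV[R]_d) t :
  {for t, continuous f} -> {for t, continuous g} ->
  {for t, continuous (fun s => pairing (f s) (g s))}.
Proof.
move=> cf cg.
have sP (p : E * 'cV[R]_d) : smooth_at (fun p : E * 'cV[R]_d => pairing p.1 p.2) p.
  apply: (@smooth_at_ext _ _ _ (fun p : E * 'cV[R]_d => \sum_k p.1 0 k * p.2 k 0)).
    by near=> q; rewrite /pairing mxE.
  apply: smooth_at_sum => k; apply: smooth_at_M; apply: smooth_at_coord.
    exact: smooth_at_fst.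
  exact: smooth_at_snd.
have c2 : {for t, continuous (fun s => (f s, g s))} by exact: continuous_pair_at.
apply: (@continuous_comp _ _ _ (fun s => (f s, g s)) (fun p => pairing p.1 p.2)) => //.
exact: smooth_at_cont.
Unshelve. all: by end_near. Qed.

Lemma cont_chart_clamp i t x : chart_dom i x ->
  {for (t, x), continuous (fun p : R * M => (clamp p.1, chart i p.2))}.
Proof.
move=> Di; apply: continuous_pair_at.
  by apply: continuous_comp; [exact: continuous_fst|exact: clamp_continuous].
by apply: continuous_comp; [exact: continuous_snd|exact: chart_continuous].
Qed.

Lemma near_dom_snd i (t : R) x : chart_dom i x -> \forall p \near (t, x), chart_dom i p.2.
Proof. by move=> Di; apply: near_dom => //; exact: continuous_snd. Qed.

Section System.
Variables (Phi : R -> M -> M) (H h : R -> M -> R).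
Hypothesis sys : smooth_contact_system a Phi H h.

Let sP : smooth_path_of_maps A Phi. Proof. by have [[? _ _] _ _] := sys. Qed.
Let cP : continuous (fun p : R * M => Phi (clamp p.1) p.2).
Proof. by have [cP _] := sP; exact: (jcont_clamp cP). Qed.

Let near_g i j t x g :
  (\forall p \near (clamp t, chart i x), `[0, 1]%classic p.1 -> g p = cexpr Phi i j p) ->
  chart_dom i x ->
  \forall p \near (t, x), \forall q \near (clamp p.1, chart i p.2), `[0, 1]%classic q.1 -> g q = cexpr Phi i j q.
Proof.
move=> gE Di.
have c := @cont_chart_clamp i t x Di.
have : \forall q \near (clamp t, chart i x), \forall r \near q, `[0, 1]%classic r.1 -> g r = cexpr Phi i j r.
  exact: (nbhs_interior gE).
by move=> H1; exact: (c _ H1).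
Qed.

Let cont_a_orbit j t x : chart_dom j (Phi (clamp t) x) ->
  {for (t, x), continuous (fun p : R * M => a j (chart j (Phi (clamp p.1) p.2)))}.
Proof.
move=> Dj; apply: (@continuous_comp _ _ _ (fun p : R * M => chart j (Phi (clamp p.1) p.2)) (a j)).
  by apply: (@continuous_comp _ _ _ (fun p : R * M => Phi (clamp p.1) p.2) (chart j)); [exact: cP|exact: chart_continuous].
by apply: one_form_cont; exact: chart_to.
Qed.

(** Near a given point, [e^h] is a quotient of two values of the contact form on a fixed vector [v]:
    after and before applying the derivative of the isotopy. Both are continuous in time and
    space. *)
Lemma conformal_cont : continuous (fun p : R * M => h (clamp p.1) p.2).
Proof.
move=> [t x]; have [i Di] := dom_cover A x; have [j Dj] := dom_cover A (Phi (clamp t) x).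
have [g [sg gE]] := smooth_path_at sP (clamp01 t) Di Dj.
have [v v0] := a_neq0 (chart_to Di).
pose N p := pairing ('D_(0, v) g (clamp p.1, chart i p.2)) (a j (chart j (Phi (clamp p.1) p.2))) : R.
pose D (p : R * M) := pairing v (a i (chart i p.2)) : R.
have cN : {for (t, x), continuous N}.
  apply: pairing_cont; last exact: cont_a_orbit.
  apply: (@continuous_comp _ _ _ (fun p : R * M => (clamp p.1, chart i p.2)) ('D_(0, v) g)).
    exact: cont_chart_clamp.
  exact/smooth_at_cont/smooth_at_derive.
have cD : {for (t, x), continuous D}.
  apply: pairing_cont; first exact: cvg_cst.
  apply: (@continuous_comp _ _ _ (fun p : R * M => chart i p.2) (a i)).
    by apply: continuous_comp; [exact: continuous_snd|exact: chart_continuous].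
  by apply: one_form_cont; exact: chart_to.
have cQ : {for (t, x), continuous (fun p => N p / D p)}.
  by apply: continuousM => //; exact: continuousV.
have near_eq : \forall p \near (t, x), N p / D p = expR (h (clamp p.1) p.2).
  near=> p.
  have Dp : chart_dom i p.2 by near: p; exact: near_dom_snd.
  have Dq : chart_dom j (Phi (clamp p.1) p.2).
    by near: p; apply: (@near_dom _ _ _ _ _ (fun p : R * M => Phi (clamp p.1) p.2)) => //; exact: cP.
  have D0 : D p != 0.
    by near: p; apply: (cD [set z | z != 0]); apply: open_nbhs_nbhs; split=> //; exact: open_neq.
  have sgp : smooth_at g (clamp p.1, chart i p.2).
    near: p; exact: (@cont_chart_clamp i t x Di _ (smooth_at_near sg)).
  have gEp : \forall q \near (clamp p.1, chart i p.2), `[0, 1]%classic q.1 -> g q = cexpr Phi i j q.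
    by near: p; exact: near_g.
  have [_ _ ch] := sys.
  have := ch _ (clamp01 p.1) i j p.2 v Dp Dq => E1.
  apply: (mulIf D0); rewrite divfK // -E1 /N; congr pairing.
  rewrite -derive_slice_r; last exact: smooth_at_diff.
  apply: near_eq_derive.
  have c : {for chart i p.2, continuous (fun y : E => (clamp p.1, y))}.
    by apply: continuous_pair_at; [exact: cst_continuous|exact: cvg_id].
  have nE : \forall y \near chart i p.2, `[0, 1]%classic (clamp p.1) -> g (clamp p.1, y) = cexpr Phi i j (clamp p.1, y) := c _ gEp.
  by apply: filterS nE => y /(_ (clamp01 _)).
have -> : (fun p : R * M => h (clamp p.1) p.2) = (@ln R) \o (fun p => expR (h (clamp p.1) p.2)).
  by apply/funext => p /=; rewrite expRK.
apply: continuous_comp; last by apply: continuous_ln; exact: expR_gt0.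
rewrite /prop_for /continuous_at -(nbhs_singleton near_eq).
have cQ2 : (fun p => N p / D p) @ (t, x) --> N (t, x) / D (t, x) := cQ.
exact: (cvg_trans (near_eq_cvg near_eq) cQ2).
Unshelve. all: by end_near. Qed.

(** The defining formula gives continuity of [H] along orbits, as a function of [(t, x)] with value
    at [Phi t x]. Composing with the jointly continuous inverse removes the orbit. *)
Lemma hamiltonian_cont : continuous (fun p : R * M => H (clamp p.1) p.2).
Proof.
have [[_ cd _] hH _] := sys.
have H0 : forall t : R, exists psi, cancel (Phi (clamp t)) psi /\ cancel psi (Phi (clamp t)).
  by move=> t; have [[_ [psi [_ ? ?]]] _] := cd _ (clamp01 t); exists psi.
have [Th HT] := choice H0.
have cT : continuous (fun p : R * M => Th p.1 p.2).
  apply: (@jcont_inv _ cptM hausM R (fun t => Phi (clamp t)) Th cP) => t; by have [] := HT t.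
have cK : continuous (fun p : R * M => H (clamp p.1) (Phi (clamp p.1) p.2)).
  move=> [t x]; have [i Di] := dom_cover A x; have [j Dj] := dom_cover A (Phi (clamp t) x).
  have [g [sg gE]] := smooth_path_at sP (clamp01 t) Di Dj.
  pose N p := pairing ('D_(1, 0) g (clamp p.1, chart i p.2)) (a j (chart j (Phi (clamp p.1) p.2))) : R.
  have cN : {for (t, x), continuous N}.
    apply: pairing_cont; last exact: cont_a_orbit.
    apply: (@continuous_comp _ _ _ (fun p : R * M => (clamp p.1, chart i p.2)) ('D_(1, 0) g)).
      exact: cont_chart_clamp.
    exact/smooth_at_cont/smooth_at_derive.
  have near_eq : \forall p \near (t, x), N p = H (clamp p.1) (Phi (clamp p.1) p.2).
    near=> p.
    have Dp : chart_dom i p.2 by near: p; exact: near_dom_snd.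
    have Dq : chart_dom j (Phi (clamp p.1) p.2).
      by near: p; apply: (@near_dom _ _ _ _ _ (fun p : R * M => Phi (clamp p.1) p.2)) => //; exact: cP.
    have sgp : smooth_at g (clamp p.1, chart i p.2).
      near: p; exact: (@cont_chart_clamp i t x Di _ (smooth_at_near sg)).
    have gEp : \forall q \near (clamp p.1, chart i p.2), `[0, 1]%classic q.1 -> g q = cexpr Phi i j q.
      by near: p; exact: near_g.
    have [v [cv ->]] := hH _ _ _ (clamp01 p.1) Dq.
    by rewrite /N (velocity_uniq cv (velocity_local (clamp01 p.1) Dp sgp gEp) (clamp01 p.1)).
  rewrite /continuous_at -(nbhs_singleton near_eq).
  have cN2 : N @ (t, x) --> N (t, x) := cN.
  exact: (cvg_trans (near_eq_cvg near_eq) cN2).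
have -> : (fun p : R * M => H (clamp p.1) p.2) =
    (fun p : R * M => H (clamp p.1) (Phi (clamp p.1) p.2)) \o (fun p => (p.1, Th p.1 p.2)).
  by apply/funext => p /=; rewrite (HT p.1).2.
move=> p; apply: continuous_comp; last exact: cK.
by apply: continuous_pair_at; [exact: continuous_fst|exact: cT].
Unshelve. all: by end_near. Qed.

End System.
End Continuity.

(** * Integration over the manifold *)

(** The tube lemma in quantitative form; it gives continuity in the parameter of iterated integrals
    and of supremum norms. *)
Lemma tube_continuous (R : realType) (X T : topologicalType) (K : set T) (f : X * T -> R) (x0 : X) (e : R) :
  compact K -> continuous f -> 0 < e ->
  \forall x \near x0, forall k, K k -> `|f (x, k) - f (x0, k)| <= e.
Proof.
move=> /compact_near_coveringP cK cf e0.
apply: (cK X (nbhs x0) (fun x k => `|f (x, k) - f (x0, k)| <= e)) => k Kk.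
have e2 : 0 < e / 2 by rewrite divr_gt0.
have /cvgrPdist_le/(_ _ e2) h1 := cf (x0, k).
have c2 : {for k, continuous (fun k' => f (x0, k'))}.
  apply: (@continuous_comp _ _ _ (fun k' : T => (x0, k')) f); last exact: cf.
  by apply: continuous_pair_at; [exact: cst_continuous|exact: cvg_id].
have /cvgrPdist_le/(_ _ e2) h2 := c2.
have h1' : \forall k' \near k & x \near x0, `|f (x0, k) - f (x, k')| <= e / 2.
  by move: h1 => [[U V] /= [nU nV] UV]; exists (V, U) => //= -[k' x] [/= Vk Ux]; exact: (UV (x, k')).
have h2' : \forall k' \near k & x \near x0, `|f (x0, k) - f (x0, k')| <= e / 2.
  by exists ([set k' | `|f (x0, k) - f (x0, k')| <= e / 2], setT) => /=; [split=> //; exact: filterT|move=> [k' x] []].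
apply: filterS2 h1' h2' => -[k' x] /= H1 H2.
rewrite -(subrKA (f (x0, k))); apply: le_trans (ler_normD _ _) _.
by rewrite [e](splitr e) lerD // distrC.
Qed.

Section IntegralCc.
Variable R : realType.
Notation mu := (@lebesgue_measure R).

Section OneDim.
Variables (B : R) (F : R -> R).
Hypothesis B0 : 0 <= B.
Hypothesis cF : continuous F.
Hypothesis F0 : forall t, B < `|t| -> F t = 0.

Lemma cc1_restrict : F = F \_ `[- B, B].
Proof.
apply/funext => t; rewrite patchE; case: ifPn => // /negP tB; apply: F0.
by rewrite ltNge; apply/negP => h; apply: tB; rewrite inE /= in_itv /= -ler_norml.
Qed.

Lemma cc1_integrable : mu.-integrable `[- B, B] (EFin \o F).
Proof.
apply: continuous_compact_integrable; first exact: segment_compact.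
exact: continuous_subspaceT.
Qed.

Lemma cc1_E : \int[mu]_t F t = \int[mu]_(t in `[- B, B]) F t.
Proof. by rewrite [RHS]Rintegral_mkcond -cc1_restrict. Qed.

Lemma cc1_integrableT : mu.-integrable setT (EFin \o F).
Proof.
have := cc1_integrable; rewrite integrable_mkcond //.
by rewrite restrict_EFin -cc1_restrict.
Qed.

Lemma cc1_gt0 t0 : (forall t, 0 <= F t) -> 0 < F t0 -> 0 < \int[mu]_t F t.
Proof.
move=> Fge F1; have e2 : 0 < F t0 / 2 by rewrite divr_gt0.
have /cvgrPdist_le/(_ _ e2) [r /= r0 Hr] := @cF t0.
pose I := `[t0 - r / 2, t0 + r / 2]%classic : set R.
have FI t : I t -> F t0 / 2 <= F t.
  rewrite /I /= in_itv /= => /andP[h1 h2].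
  have : `|F t0 - F t| <= F t0 / 2.
    by apply: Hr => /=; rewrite ltr_norml; lra.
  by rewrite ler_norml; lra.
apply: fine_gt0; apply/andP; split; last first.
  have /integrableP [_] := cc1_integrableT; apply: le_lt_trans.
  by rewrite le_eqVlt; apply/orP; left; apply/eqP; apply: eq_integral => t _ /=; rewrite ger0_norm.
have mI : measurable I by exact: measurable_itv.
have /integrableP [mF _] := cc1_integrableT.
apply: (@lt_le_trans _ _ (\int[mu]_(t in I) (F t0 / 2)%:E)%E).
  have muI : mu I = r%:E.
    rewrite /I lebesgue_measure_itv /= lte_fin ifT; last lra.
    by rewrite -EFinB; congr EFin; lra.
  by rewrite integral_cst // -[X in (_ * X)%E]/(mu I) muI -EFinM lte_fin mulr_gt0.
apply: (@le_trans _ _ (\int[mu]_(t in I) (F t)%:E)%E).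
  apply: ge0_le_integral => //.
  - by move=> t _; rewrite lee_fin ltW.
  - exact: (measurable_funS measurableT (@subsetT _ I) mF).
by apply: ge0_subset_integral => // t _; rewrite lee_fin.
Qed.

End OneDim.

(* Continuous functions supported in the box of half-width [B]. *)
Definition cc (m : nat) (B : R) (f : 'rV[R]_m -> R) :=
  continuous f /\ forall v : 'rV[R]_m, (exists j, B < `|v 0 j|) -> f v = 0.

Definition slice m (f : 'rV[R]_m.+1 -> R) (t : R) (v : 'rV[R]_m) : R :=
  f (row_mx (t%:M : 'rV[R]_1) v).

Lemma row_mx_cont m : continuous (fun p : R * 'rV[R]_m => row_mx (p.1%:M : 'rV[R]_1) p.2 : 'rV[R]_(1 + m)).
Proof.
move=> p; apply: smooth_at_cont; apply: smooth_at_rV => j.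
apply: (@smooth_at_ext _ _ _ (fun p : R * 'rV[R]_m => match fintype.split j with inl k => p.1 | inr k => p.2 0 k end)).
  near=> q; rewrite mxE; case: (fintype.split j) => k //.
  by rewrite mxE !ord1 eqxx mulr1n.
case: (fintype.split j) => k; first exact: smooth_at_fst.
by apply: smooth_at_coord; exact: smooth_at_snd.
Unshelve. all: by end_near. Qed.

Lemma slice2_cont m (f : 'rV[R]_m.+1 -> R) : continuous f ->
  continuous (fun p : R * 'rV[R]_m => slice f p.1 p.2).
Proof.
move=> cf p; apply: (@continuous_comp _ _ _ (fun p : R * 'rV[R]_m => row_mx (p.1%:M : 'rV[R]_1) p.2 : 'rV[R]_(1 + m)) f).
  exact: row_mx_cont.
exact: cf.
Qed.

Lemma slice_cc m B (f : 'rV[R]_m.+1 -> R) t : cc B f -> cc B (slice f t).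
Proof.
move=> [cf f0]; split.
  move=> v; apply: (@continuous_comp _ _ _ (fun v : 'rV[R]_m => (t, v)) (fun p => slice f p.1 p.2)); last exact: slice2_cont.
  by apply: continuous_pair_at; [exact: cst_continuous|exact: cvg_id].
move=> v [j hj]; apply: f0; exists (rshift 1 j).
by rewrite (@row_mxEr _ 1 1 m).
Qed.

Lemma slice_out m B (f : 'rV[R]_m.+1 -> R) t : cc B f -> B < `|t| -> slice f t = fun=> 0.
Proof.
move=> [cf f0] Bt; apply/funext => v; apply: f0; exists (lshift m (0 : 'I_1)).
by rewrite (@row_mxEl _ 1 1 m) mxE eqxx mulr1n.
Qed.

Lemma box_compact m (B : R) : compact [set v : 'rV[R]_m | forall j, `|v 0 j| <= B].
Proof.
have := @rV_compact R m (fun=> `[- B, B]%classic) (fun=> @segment_compact R _ _).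
congr (compact _); rewrite eqEsubset.
by split=> v /= h j; have := h j; rewrite in_itv /= ler_norml.
Qed.

Lemma integral_rV0 m : integral_rV (fun _ : 'rV[R]_m => 0) = 0.
Proof.
elim: m => [//|m IH] /=.
under eq_Rintegral do rewrite IH.
by rewrite Rintegral_cst // mul0r.
Qed.

Section Induct.
Variable B : R.
Hypothesis B0 : 0 <= B.

(** The four properties go through one induction on the dimension: the Lipschitz estimate in
    dimension [m] makes the integral over slices continuous in the remaining variable, hence
    integrable, and everything in dimension [m.+1] rests on that. *)
Lemma cc_integral m :
  (forall (f : 'rV[R]_m -> R) c, cc B f -> integral_rV (fun v => c * f v) = c * integral_rV f) /\
  (forall (f g : 'rV[R]_m -> R) e, cc B f -> cc B g -> 0 <= e -> (forall v, `|f v - g v| <= e) ->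
    `|integral_rV f - integral_rV g| <= (2 * B) ^+ m * e) /\
  (forall (f g : 'rV[R]_m -> R), cc B f -> cc B g -> (forall v, f v <= g v) ->
    integral_rV f <= integral_rV g) /\
  (forall (f : 'rV[R]_m -> R) v, cc B f -> (forall v, 0 <= f v) -> 0 < f v -> 0 < integral_rV f).
Proof.
elim: m => [|m [IHZ [IHL [IHM IHP]]]].
  split; [by []|split; [|split]] => /=.
  - by move=> f g e _ _ _ h; rewrite expr0 mul1r; exact: h.
  - by move=> f g _ _; exact.
  - by move=> f v _ _; rewrite (_ : v = 0) //; apply/rowP; case.
have IC (f : 'rV[R]_m.+1 -> R) : cc B f -> continuous (fun t => integral_rV (slice f t)).
  move=> hf t0; apply/cvgrPdist_le => e e0.
  have K0 : 0 < (2 * B) ^+ m + 1 by rewrite ltr_wpDl // exprn_ge0 // mulr_ge0.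
  have e1 : 0 < e / ((2 * B) ^+ m + 1) by rewrite divr_gt0.
  have := tube_continuous t0 (@box_compact m B) (slice2_cont (proj1 hf)) e1.
  apply: filterS => t ht.
  apply: le_trans (IHL _ _ (e / ((2 * B) ^+ m + 1)) _ _ (ltW e1) _) _.
  - exact: slice_cc.
  - exact: slice_cc.
  - move=> v; have [/asboolP hv|/asboolP hv] := boolP `[< forall j, `|v 0 j| <= B >].
      by rewrite distrC; exact: ht.
    have [j hj] : exists j, B < `|v 0 j|.
      by move/existsNP: hv => [j /negP]; rewrite -ltNge => h; exists j.
    by rewrite !(proj2 (slice_cc _ hf)) ?subrr ?normr0 ?ltW //; exists j.
  - by rewrite mulrCA ger_pMr // ler_pdivrMr // mul1r lerDl.
have I0 (f : 'rV[R]_m.+1 -> R) t : cc B f -> B < `|t| -> integral_rV (slice f t) = 0.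
  by move=> hf Bt; rewrite (slice_out hf Bt) integral_rV0.
have muB : mu `[- B, B]%classic = (2 * B)%:E.
  rewrite lebesgue_measure_itv /= lte_fin; case: ltP => h.
    by rewrite -EFinB; congr EFin; lra.
  have Bneg : B <= 0 by apply: le_trans h _; rewrite oppr_le0.
  have -> : B = 0 by apply/eqP; rewrite eq_le Bneg.
  by rewrite mulr0.
have IE (f : 'rV[R]_m.+1 -> R) : cc B f -> integral_rV f = \int[mu]_(t in `[- B, B]) integral_rV (slice f t).
  by move=> hf; rewrite -(cc1_E (fun t => I0 f t hf)).
have II (f : 'rV[R]_m.+1 -> R) : cc B f -> mu.-integrable `[- B, B] (EFin \o (fun t => integral_rV (slice f t))).
  by move=> hf; apply: cc1_integrable; exact: IC.
split; [|split; [|split]].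
- move=> f c hf; rewrite (IE f hf).
  have hcf : cc B (fun v => c * f v).
    split; first by move=> v; apply: continuousM; [exact: cst_continuous|exact: (proj1 hf)].
    by move=> v /(proj2 hf) ->; rewrite mulr0.
  rewrite (IE _ hcf) -RintegralZl //; last exact: II.
  by apply: eq_Rintegral => t _; rewrite -IHZ //; exact: slice_cc.
- move=> f g e hf hg e0 fg; rewrite (IE f hf) (IE g hg) -RintegralB //; [|exact: II|exact: II].
  have iB : mu.-integrable `[- B, B] (EFin \o (fun t => integral_rV (slice f t) - integral_rV (slice g t))).
    have K : mu.-integrable `[- B, B] (fun t => ((integral_rV (slice f t))%:E - (integral_rV (slice g t))%:E)%E).
      by apply: integrableB => //; exact: II.
    by apply: eq_integrable K => // t _ /=; rewrite EFinB.
  apply: le_trans (le_normr_Rintegral _ iB) _ => //.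
  apply: (@le_trans _ _ (\int[mu]_(t in `[- B, B]) ((2 * B) ^+ m * e))).
    apply: le_Rintegral => //.
    + exact: integrable_norm.
    + apply/integrableP; split; first exact: measurable_cst.
      by rewrite /= integral_cst // -[X in (_ * X)%E]/(mu `[- B, B]%classic) muB -EFinM ltry.
    + by move=> t _; apply: IHL => //; [exact: slice_cc|exact: slice_cc|move=> v; exact: fg].
  rewrite Rintegral_cst // -[X in fine X]/(mu `[- B, B]%classic) muB /= exprS.
  by rewrite mulrC mulrA.
- move=> f g hf hg fg; rewrite (IE f hf) (IE g hg); apply: le_Rintegral => //; [exact: II|exact: II|].
  by move=> t _; apply: IHM; [exact: slice_cc|exact: slice_cc|move=> v; exact: fg].
- move=> f v hf f0 fv; apply: (cc1_gt0 (IC f hf) (fun t => I0 f t hf) (t0 := v 0 0)).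
    move=> t; rewrite -(@integral_rV0 m); apply: IHM; [|exact: slice_cc|by move=> w; exact: f0].
    by split=> //; exact: cst_continuous.
  apply: (IHP _ (rsubmx (v : 'rV[R]_(1 + m)))); [exact: slice_cc|by move=> w; exact: f0|].
  have vE : row_mx ((v 0 0)%:M : 'rV[R]_1) (rsubmx (v : 'rV[R]_(1 + m))) = (v : 'rV[R]_(1 + m)).
    rewrite -[RHS](@hsubmxK _ 1 1 m); congr row_mx; apply/rowP => j.
    by rewrite !ord1 !mxE eqxx mulr1n; congr (v _ _); apply/val_inj.
  by rewrite /slice vE.
Qed.

End Induct.
End IntegralCc.

(** The point [x0] makes [T] a pointed space, on which compactness is equivalent to the existence of
    finite subcovers. *)
Lemma compact_cover_inhabited (T : topologicalType) (x0 : T) (K : set T) :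
  compact K -> cover_compact K.
Proof.
pose T' : ptopologicalType := HB.pack T (isPointed.Build T x0).
by have -> : @compact T = @cover_compact T by exact: (@compact_cover T').
Qed.

(** * Partitions of unity, mean values and the contact norm *)

Section Partition.
Variables (R : realType) (d : nat) (M : uniformType) (A : atlas R d M).
Hypothesis cptM : compact [set: M].

(** Uniform spaces are completely regular: some [f] is 0 at [x] and 1 off the chart. Truncating
    [1 / 2 - f] at 0 leaves a closed support inside [f <= 1 / 2], so inside the chart. *)
Lemma chart_bump (x : M) : exists (i : chart_index A) (b : M -> R),
  [/\ continuous b, forall y, 0 <= b y, 0 < b x & closure [set y | b y != 0] `<=` chart_dom i].
Proof.
have [i Di] := dom_cover A x.
have clB : closed (~` (chart_dom i : set M)) by apply: open_closedC; exact: dom_open.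
have sep := point_uniform_separator clB (fun h => h Di).
have [f [cf f01 f0 f1]] := (@uniform_separatorP M R _ _).1 (sep R).
exists i, (fun y => Num.max 0 (1 / 2 - f y)); split.
- move=> y; apply: (@continuous_max R M (fun=> 0) (fun y => 1 / 2 - f y)); first exact: cst_continuous.
  by apply: contB; [exact: cst_continuous|exact: cf].
- by move=> y; rewrite le_max lexx.
- have -> : f x = 0 by apply: f0; exists x.
  by rewrite lt_max subr0 divr_gt0 ?orbT.
- have cl2 : closed [set y | f y <= 1 / 2].
    by apply: (@preimage_closed _ _ f [set z | z <= 1 / 2]); [move=> ? _; exact: cf|exact: closed_le].
  move=> y /(closureS (B := [set y | f y <= 1 / 2])) => /(_ _) hy.
  have : closure [set y | f y <= 1 / 2] y.
    apply: hy => z /=; apply: contraNT; rewrite -ltNge => fz.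
    by rewrite max_l // subr_le0 ltW.
  move=> /cl2 /= fy; apply: contrapT => nD.
  have : f y = 1 by apply: f1; exists y.
  by move=> fy1; move: fy; rewrite fy1; lra.
Qed.

End Partition.

Section Mean.
Variables (R : realType) (n : nat) (M : uniformType).
Variable A : atlas R n.*2.+1 M.
Variable a : chart_index A -> 'rV[R]_n.*2.+1 -> 'cV[R]_n.*2.+1.
Notation E := 'rV[R]_n.*2.+1.
Hypothesis cptM : compact [set: M].
Hypothesis hausM : hausdorff_space M.
Hypothesis contact_a : contact_form a.
Hypothesis M0 : [set: M] !=set0.

(** Ensures that the choice by [xget] in [volume_integral] is a genuine partition of unity and not
    the default empty list, for which all integrals would vanish. *)
Lemma partition_of_unity_exists : exists rho, @partition_of_unity R n M A rho.
Proof.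
have [ib Hib] := choice (@chart_bump R _ M A).
have [b Hb] := choice Hib.
have cov : [set: M] `<=` cover setT (fun x => [set y | 0 < b x y]).
  by move=> x _; exists x => //=; have [] := Hb x.
have [x0 _] := M0; have cc := compact_cover_inhabited x0 cptM.
have [|//|D' _ covD] := cc M setT (fun x => [set y | 0 < b x y]).
  move=> x _; have [cb _ _ _] := Hb x.
  by apply: (@open_comp _ _ (b x) [set z | 0 < z]); [move=> y _; exact: cb|exact: open_gt].
pose D : seq M := finmap.enum_fset D'.
pose G y := \sum_(x <- D) b x y.
have G0 y : 0 < G y.
  have [x Dx bxy] := covD y I.
  rewrite /G (big_rem x) //= ltr_wpDr //.
  by apply: sumr_ge0 => z _; have [_ b0 _ _] := Hb z; exact: b0.
have cS (r : seq M) : continuous (fun y => \sum_(x <- r) b x y).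
  elim: r => [|x r IH].
    by rewrite (_ : (fun y => _) = fun=> 0); [exact: cst_continuous|apply/funext => y; rewrite big_nil].
  rewrite (_ : (fun y => _) = fun y => b x y + \sum_(x <- r) b x y); last first.
    by apply/funext => y; rewrite big_cons.
  by move=> y; apply: contD; [have [cb _ _ _] := Hb x; exact: cb|exact: IH].
have cG : continuous G := cS D.
exists [seq (ib x, fun y => b x y / G y) : {classic chart_index A * (M -> R)} | x <- D]; split.
  move=> p /mapP [x xD ->] /=; have [cb b0 _ supp] := Hb x; split.
  - move=> y; apply: (@contM R M (b x) (fun y => (G y)^-1)); first exact: cb.
    by apply: (@continuousV R M G); [rewrite gt_eqF|exact: cG].
  - by move=> y; rewrite divr_ge0 // ltW.
  - rewrite (_ : [set y | _] = [set y | b x y != 0]) //.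
    by apply/funext => y /=; rewrite mulf_eq0 invr_eq0 (gt_eqF (G0 y)) orbF.
move=> y; rewrite big_map /=.
by rewrite -mulr_suml -/(G y) divff // gt_eqF.
Qed.

Definition integrand (p : {classic chart_index A * (M -> R)}) (f : M -> R) (y : E) : R :=
  if y \in chart_img p.1 then
      p.2 (param p.1 y) * f (param p.1 y) * `|volume_coef a p.1 y| else 0.

Let rho := xget [::] (@partition_of_unity R n M A).

Lemma rhoP : partition_of_unity rho.
Proof. by have [r hr] := partition_of_unity_exists; exact: (@xgetPex _ [::] (@partition_of_unity R n M A) (ex_intro _ r hr)). Qed.

Lemma smooth_coef i y k l : chart_img i y -> smooth_at (fun z => a i z k l) y.
Proof.
move=> Iy; have [[sa _] _] := contact_a; apply: smooth_at_coord.
by have /(smooth_onP _ (@img_open _ _ _ A i)) := sa i; apply.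
Qed.

Lemma volume_coef_cont i y : chart_img i y -> {for y, continuous (volume_coef a i)}.
Proof.
move=> Iy; apply: smooth_at_cont; rewrite /volume_coef.
apply: smooth_at_M; first exact: smooth_at_cst.
apply: smooth_at_sum => s; apply: smooth_at_M.
  by apply: smooth_at_M; [exact: smooth_at_cst|exact: smooth_coef].
apply: smooth_at_prod => k; rewrite /dform.
by apply: smooth_at_B; apply: smooth_at_derive; exact: smooth_coef.
Qed.

(** The support of the partition function has a compact image in the chart, off which the integrand
    is zero; this gives both continuity across the edge of the chart image and a box. The box does
    not depend on [f], so integrands of different functions can be compared. *)
Lemma integrand_cc p : p \in rho -> exists2 B, 0 <= B &
  forall f, continuous f -> cc B (integrand p f).
Proof.
move=> pr; have [/(_ p pr) [cp p0 supp] _] := rhoP.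
set S := closure [set x | p.2 x != 0] in supp.
have cS : compact S by apply: (subclosed_compact _ cptM) => //; exact: closed_closure.
pose K := chart p.1 @` S.
have cK : compact K.
  apply: (@continuous_compact M E (chart p.1)) => //.
  by apply: continuous_in_subspaceT => x /[!inE] /supp Dx; exact: chart_continuous.
have clK : closed K by apply: compact_closed => //; exact: norm_hausdorff.
have outK z : chart_img p.1 z -> ~ K z -> p.2 (param p.1 z) = 0.
  move=> Iz nK; apply: contrapT => /eqP pz; apply: nK; exists (param p.1 z); last exact: paramK.
  exact: subset_closure.
have [B [_ HB]] := compact_bounded cK.
have B1 : `|B| < `|B| + 1 by rewrite ltrDl.
have HB1 : forall x, K x -> `|x| <= `|B| + 1 := HB _ (le_lt_trans (ler_norm _) B1).
exists (`|B| + 1); first by rewrite addr_ge0.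
move=> f cf; split.
  move=> y; have [Iy|nIy] := pselect (chart_img p.1 y).
    have nI : \forall z \near y, chart_img p.1 z by apply: (@near_img _ _ _ _ _ id); [exact: cvg_id|].
    have ceq : \forall z \near y, p.2 (param p.1 z) * f (param p.1 z) * `|volume_coef a p.1 z| = integrand p f z.
      by apply: filterS nI => z Iz; rewrite /integrand mem_set.
    have c1 : {for y, continuous (fun z => p.2 (param p.1 z) * f (param p.1 z) * `|volume_coef a p.1 z|)}.
      apply: contM.
        apply: contM; apply: continuous_comp; [exact: param_continuous|exact: cp|exact: param_continuous|exact: cf].
      by apply: continuous_comp; [exact: volume_coef_cont|exact: norm_continuous].
    rewrite /continuous_at -(nbhs_singleton ceq).
    exact: (cvg_trans (near_eq_cvg ceq) c1).
  have nK : ~ K y by move=> [x Sx xy]; apply: nIy; rewrite -xy; apply: chart_to; exact: supp.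
  have nnK : \forall z \near y, ~ K z.
    by apply: (open_nbhs_nbhs (A := ~` K)); split=> //; exact: closed_openC.
  have ceq : \forall z \near y, (0 : R) = integrand p f z.
    apply: filterS nnK => z nKz; rewrite /integrand; case: ifPn => // /set_mem Iz.
    by rewrite outK // !mul0r.
  rewrite /continuous_at -(nbhs_singleton ceq).
  exact: (cvg_trans (near_eq_cvg ceq) (cvg_cst _)).
move=> v [j hj]; rewrite /integrand; case: ifPn => // /set_mem Iv.
rewrite outK ?mul0r // => Kv.
have := HB1 _ Kv; apply/negP; rewrite -ltNge; apply: lt_le_trans hj _.
by rewrite [`|v|]mx_normrE; apply: (le_trans _ (le_bigmax _ _ (0, j))).
Qed.

Lemma volume_integralE f : volume_integral a f = \sum_(p <- rho) integral_rV (integrand p f).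
Proof. by []. Qed.

Lemma volume_integral_le f g : continuous f -> continuous g -> (forall x, f x <= g x) ->
  volume_integral a f <= volume_integral a g.
Proof.
move=> cf cg fg; rewrite !volume_integralE big_seq [X in _ <= X]big_seq; apply: ler_sum => p pr.
have [B B0 HB] := integrand_cc pr; have [_ [_ [IM _]]] := @cc_integral R B B0 n.*2.+1.
apply: IM; [exact: HB|exact: HB|move=> v].
have [/(_ p pr) [_ p0 _] _] := rhoP.
by rewrite /integrand; case: ifP => // _; rewrite ler_wpM2r // ler_wpM2l.
Qed.

Lemma volume_integralZ c : volume_integral a (fun=> c) = c * volume_integral a (fun=> 1).
Proof.
rewrite !volume_integralE mulr_sumr big_seq [RHS]big_seq; apply: eq_bigr => p pr.
have [B B0 HB] := integrand_cc pr; have [IZ _] := @cc_integral R B B0 n.*2.+1.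
rewrite -IZ; last by apply: HB; exact: cst_continuous.
congr integral_rV; apply/funext => v; rewrite /integrand; case: ifP => _; last by rewrite mulr0.
by rewrite mulr1 mulrA [c * _]mulrC.
Qed.

(** Some partition function is positive at a given point, and there the volume coefficient is
    nonzero by the contact condition; all other contributions are nonnegative. *)
Lemma volume_gt0 : 0 < volume_integral a (fun=> 1).
Proof.
have [x _] := M0; have [Hr /(_ x) sr] := rhoP.
have [p pr px] : exists2 p, p \in rho & p.2 x != 0.
  apply: contrapT => h; have := sr; rewrite big_seq big1; first by move/esym/eqP; rewrite oner_eq0.
  move=> p pr; by apply: contrapT => /eqP px; apply: h; exists p.
rewrite volume_integralE (big_rem p) //=.
have ge0 q : q \in rho -> forall v, 0 <= integrand q (fun=> 1) v.
  move=> qr v; have [_ q0 _] := Hr _ qr; rewrite /integrand; case: ifP => // _.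
  by rewrite mulr1 mulr_ge0.
rewrite ltr_wpDr //.
  rewrite big_seq; apply: sumr_ge0 => q /mem_rem qr.
  have [B B0 HB] := integrand_cc qr; have [_ [_ [IM _]]] := @cc_integral R B B0 n.*2.+1.
  rewrite -(@integral_rV0 R n.*2.+1); apply: IM; [|by apply: HB; exact: cst_continuous|exact: ge0].
  by split=> //; exact: cst_continuous.
have [cp p0 supp] := Hr _ pr.
have Dx : chart_dom p.1 x by apply: supp; exact: subset_closure.
have [B B0 HB] := integrand_cc pr; have [_ [_ [_ IP]]] := @cc_integral R B B0 n.*2.+1.
apply: (IP _ (chart p.1 x)); [by apply: HB; exact: cst_continuous|exact: ge0|].
have Ix := chart_to Dx.
rewrite /integrand mem_set // chartK // mulr1 mulr_gt0 //; first by rewrite lt_neqAle eq_sym px p0.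
by rewrite normr_gt0; have [_ H] := contact_a; exact: H.
Qed.

Lemma mean_bounds f m S : continuous f -> (forall x, m <= f x <= S) -> m <= mean a f <= S.
Proof.
move=> cf hf; have V0 := volume_gt0.
rewrite /mean [_^-1 * _]mulrC ler_pdivlMr // ler_pdivrMr // -!volume_integralZ.
have cc (c : R) : continuous (fun _ : M => c) by exact: cst_continuous.
apply/andP; split; apply: volume_integral_le; try exact: cc; try exact: cf.
  by move=> x; have /andP [] := hf x.
by move=> x; have /andP [] := hf x.
Qed.

Lemma cont_bounded (f : M -> R) : continuous f -> exists C, forall x, `|f x| <= C.
Proof.
move=> cf; have cpt : compact (f @` setT).
  by apply: continuous_compact => //; exact: continuous_subspaceT.
have [B [_ HB]] := compact_bounded cpt.
have B1 : `|B| < `|B| + 1 by rewrite ltrDl.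
have HB1 : forall x, (f @` setT) x -> `|x| <= `|B| + 1 := HB _ (le_lt_trans (ler_norm _) B1).
by exists (`|B| + 1) => x; apply: HB1; exists x.
Qed.

(** The mean lies between infimum and supremum, which makes the contact norm equivalent to the
    supremum norm. The 3 is 2 for the oscillation plus 1 for the mean. *)
Lemma contact_norm_bounds f : continuous f ->
  (forall x, `|f x| <= contact_norm a f) /\ forall C, (forall x, `|f x| <= C) -> contact_norm a f <= 3 * C.
Proof.
move=> cf; have [x0 _] := M0; have [B HB] := cont_bounded cf.
have hs : has_sup (range f).
  split; first by exists (f x0); exists x0.
  by exists B => _ [x _ <-]; apply: le_trans (HB x); exact: ler_norm.
have hi : has_inf (range f).
  split; first by exists (f x0); exists x0.
  by exists (- B) => _ [x _ <-]; have := HB x; rewrite ler_norml => /andP[].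
have fs x : f x <= sup (range f) by apply: ub_le_sup; [exact: hs.2|exists x].
have fi x : inf (range f) <= f x by apply: ge_inf; [exact: hi.2|exists x].
have /andP [m1 m2] : inf (range f) <= mean a f <= sup (range f).
  by apply: mean_bounds => // x; rewrite fi fs.
rewrite /contact_norm; split=> [x|C HC].
  have := ler_norm (mean a f); have := ler_norm (- mean a f); rewrite normrN => h1 h2.
  by rewrite ler_norml; have := fs x; have := fi x; lra.
have sC : sup (range f) <= C.
  by apply: ge_sup; [exact: hs.1|move=> _ [x _ <-]; apply: le_trans (HC x); exact: ler_norm].
have iC : - C <= inf (range f).
  by apply: lb_le_inf; [exact: hi.1|move=> _ [x _ <-]; have := HC x; rewrite ler_norml => /andP[]].
have : `|mean a f| <= C by rewrite ler_norml; lra.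
lra.
Qed.

End Mean.

(** * Time changes adapted to a speed *)

Section Reparametrization.
Variable R : realType.
Notation mu := (@lebesgue_measure R).

Lemma uniform_cont_compact (u : R -> R) (K : set R) e : compact K -> continuous u -> 0 < e ->
  exists2 r, 0 < r & forall x y, K x -> `|x - y| < r -> `|u x - u y| <= e.
Proof.
move=> /compact_near_coveringP cK cu e0; have e2 : 0 < e / 2 by rewrite divr_gt0.
have [] := cK R (0^'+) (fun r x => forall y, `|x - y| < r -> `|u x - u y| <= e).
  move=> x Kx; have /cvgrPdist_le/(_ _ e2) [s /= s0 Hs] := cu x.
  have s2 : 0 < s / 2 by rewrite divr_gt0.
  exists ([set x' | `|x - x'| < s / 2], [set r | r < s / 2]) => /=.
    by split; [exists (s / 2)|exact: nbhs_right_lt].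
  move=> [x' r] /= [h1 h2] y h3.
  have H1 : `|u x - u x'| <= e / 2 by apply: Hs => /=; lra.
  have H2 : `|u x - u y| <= e / 2.
    apply: Hs => /=; rewrite -(subrKA x'); apply: le_lt_trans (ler_normD _ _) _; lra.
  rewrite -(subrKA (u x)); apply: le_trans (ler_normD _ _) _.
  by rewrite distrC; lra.
move=> s /= s0 Hs; have s2 : 0 < s / 2 by rewrite divr_gt0.
exists (s / 2) => // x y Kx xy.
apply: (Hs (s / 2)) => //=; rewrite sub0r normrN gtr0_norm //; lra.
Qed.

Lemma riemann_sum_le (u : R -> R) (N : nat) e : continuous u -> (0 < N)%N ->
  (forall i s, (i < N)%N -> i%:R / N%:R <= s <= i.+1%:R / N%:R -> u (i%:R / N%:R) - e <= u s) ->
  N%:R^-1 * \sum_(i < N) (u (i%:R / N%:R) - e) <= \int[mu]_(t in `[0, 1]) u t.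
Proof.
move=> cu N0 hu; have NR : 0 < N%:R :> R by rewrite ltr0n.
have iu (a b : R) : mu.-integrable `[a, b] (EFin \o u).
  by apply: continuous_compact_integrable; [exact: segment_compact|exact: continuous_subspaceT].
suff H k : (k <= N)%N -> N%:R^-1 * \sum_(i < k) (u (i%:R / N%:R) - e) <= \int[mu]_(t in `[0, k%:R / N%:R]) u t.
  by have := H N (leqnn _); rewrite divff // gt_eqF.
elim: k => [|k IH] kN.
  by rewrite big_ord0 mulr0 mul0r set_itv1 Rintegral_set1.
have kk : k%:R / N%:R <= k.+1%:R / N%:R :> R by rewrite ler_pM2r ?invr_gt0 // ler_nat.
have k0 : 0 <= k%:R / N%:R :> R by rewrite divr_ge0.
have E := Rintegral_itvB (iu 0 (k.+1%:R / N%:R)) (x := k%:R / N%:R).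
rewrite !bnd_simp in E; have {}E := E k0 kk.
rewrite big_ord_recr /= mulrDr -[X in _ <= X](subrK (\int[mu]_(t in `[0, (k%:R / N%:R)]) u t)) E addrC.
apply: lerD; last exact: IH (ltnW kN).
pose J := `](k%:R / N%:R), (k.+1%:R / N%:R)]%classic : set R.
have muJ : mu J = (N%:R^-1)%:E.
  rewrite /J lebesgue_measure_itv /= lte_fin ifT; last by rewrite ltr_pM2r ?invr_gt0 // ltr_nat.
  by rewrite -EFinB -mulrBl -natrB // subSnn mul1r.
have iJ : mu.-integrable J (EFin \o u).
  apply: integrableS (iu (k%:R / N%:R) (k.+1%:R / N%:R)) => //.
    exact: measurable_itv.
  by move=> x; rewrite /J /= !in_itv /= => /andP[h1 h2]; rewrite h2 ltW.
rewrite mulrC.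
have <- : \int[mu]_(t in J) (u (k%:R / N%:R) - e) = (u (k%:R / N%:R) - e) * N%:R^-1.
  by rewrite Rintegral_cst; [rewrite -[X in fine X]/(mu J) muJ|exact: measurable_itv].
apply: le_Rintegral => //; first exact: measurable_itv.
  apply/integrableP; split; first exact: measurable_cst.
  by rewrite /= integral_cst; [rewrite -[X in (_ * X)%E]/(mu J) muJ -EFinM ltry|exact: measurable_itv].
by move=> x; rewrite /J /= in_itv /= => /andP[h1 h2]; apply: (hu k) => //; rewrite (ltW h1).
Qed.

(** The ideal time change keeps [z' * u (z)] constant. It is approximated by cutting [[0, 1]] into
    [N] equal pieces on which [u] is nearly constant, and [[s0, s1]] into intervals of length [l i]
    proportional to the approximate values [w i] of [u]; a smooth step crosses the [i]-th piece
    during the [i]-th interval. There [z' <= C / (N * l i)], so [z' * u (z)] is at most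
    [C / (s1 - s0)] times the mean of the [w i], which is a Riemann sum for the integral of [u]. *)
Lemma reparametrization : exists2 C : R, 0 < C & forall (u : R -> R) (s0 s1 e : R),
  continuous u -> (forall t, 0 <= u t) -> s0 < s1 -> 0 < e ->
  exists z : R -> R, [/\ unit_time z, forall t, t <= s0 -> z t = 0, forall t, s1 <= t -> z t = 1,
    forall t, t <= s0 \/ s1 <= t -> 'D_1 (z : R -> R) t = 0
    & forall t, `|'D_1 (z : R -> R) t| * u (z t) <= C * (\int[mu]_(t in `[0, 1]) u t + e) / (s1 - s0)].
Proof.
have [C C0 HC] := @derive_step_bounded R; exists C => // u s0 s1 e cu u0 s01 e0.
(* The mean of the [w i] exceeds a lower Riemann sum by [2 * dl], which is below [e]. Adding [dl]
   also keeps the weights positive where [u] vanishes. *)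
pose dl := e / 3; have dl0 : 0 < dl by rewrite divr_gt0.
have [r r0 Hr] := uniform_cont_compact (@segment_compact R 0 1) cu dl0.
have [N N0 Nr] : exists2 N, (0 < N)%N & N%:R^-1 < r.
  by exists (Num.truncn r^-1).+1 => //; rewrite invf_plt ?posrE // truncnS_gt.
have NR : 0 < N%:R :> R by rewrite ltr0n.
have hu i s : (i < N)%N -> i%:R / N%:R <= s <= i.+1%:R / N%:R -> `|u (i%:R / N%:R) - u s| <= dl.
  move=> iN /andP[h1 h2]; apply: Hr.
    by rewrite /= in_itv /= divr_ge0 //= ler_pdivrMr // mul1r ler_nat ltnW.
  rewrite distrC ger0_norm ?subr_ge0 //; apply: le_lt_trans Nr.
  by rewrite lerBlDr; apply: le_trans h2 _; rewrite -[i.+1]addn1 natrD mulrDl mul1r addrC.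
pose w (i : nat) := u (i%:R / N%:R) + dl.
have w0 i : 0 < w i by rewrite ltr_wpDl.
pose W := \sum_(i < N) w i.
have W0 : 0 < W.
  by rewrite /W (bigD1 (Ordinal N0)) //= ltr_wpDr // sumr_ge0 // => i _; rewrite ltW.
pose L := s1 - s0; have L0 : 0 < L by rewrite subr_gt0.
pose l (i : nat) := L * w i / W.
have l0 i : 0 < l i by rewrite divr_gt0 // mulr_gt0.
pose a (i : nat) := s0 + \sum_(j < i) l j.
have aS i : a i.+1 = a i + l i by rewrite /a big_ord_recr /= addrA.
have amono i j : (i <= j)%N -> a i <= a j.
  elim: j => [|j IH]; first by rewrite leqn0 => /eqP ->.
  rewrite leq_eqVlt => /orP[/eqP -> //|/IH h]; apply: le_trans h _.
  by rewrite aS lerDl ltW.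
have a0 : a 0 = s0 by rewrite /a big_ord0 addr0.
have aN : a N = s1.
  rewrite /a -mulr_suml -mulr_sumr -/W mulfK ?gt_eqF // /L; lra.
pose arg (i : nat) (t : R) := (l i)^-1 * t + - ((l i)^-1 * a i).
have argE i t : arg i t = (t - a i) / l i by rewrite /arg; ring.
have arg_le0 i t : t <= a i -> arg i t <= 0.
  by move=> h; rewrite argE pmulr_lle0 ?invr_gt0 // subr_le0.
have arg_ge1 i t : a i.+1 <= t -> 1 <= arg i t.
  by rewrite aS => h; rewrite argE ler_pdivlMr // mul1r; lra.
pose z (t : R) := \sum_(i < N) N%:R^-1 * step (arg i t).
have sarg i t : smooth_at (fun t : R => step (arg i t) : R) t.
  apply: (@smooth_at_comp R R R R (fun t : R => arg i t : R) (@step R)); [exact: fdim_R|exact: smooth_at_affine|exact: smooth_at_step].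
have sz t : smooth_at (z : R -> R) t.
  by apply: smooth_at_sum => i; apply: smooth_at_M; [exact: smooth_at_cst|exact: sarg].
have step_out i t : t <= a i \/ a i.+1 <= t -> 'D_1 (@step R : R -> R) (arg i t) = 0.
  by move=> [h|h]; apply: derive_step_out; [left; exact: arg_le0|right; exact: arg_ge1].
have dz t : 'D_1 (z : R -> R) t = \sum_(i < N) N%:R^-1 * ((l i)^-1 * 'D_1 (@step R : R -> R) (arg i t)).
  have -> : (z : R -> R) = \sum_(i < N) (fun t : R => N%:R^-1 * step (arg i t) : R).
    by apply/funext => t'; rewrite fct_sumE.
  have ds i : is_derive t 1 (fun t : R => step (arg i t) : R) ((l i)^-1 * 'D_1 (@step R : R -> R) (arg i t)).
    have d1 : is_derive (arg i t) 1 (@step R : R -> R) ('D_1 (@step R : R -> R) (arg i t)).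
      by apply/derivableP/diff_derivable/smooth_at_diff/smooth_at_step.
    have d2 : is_derive t 1 (fun t : R => arg i t : R) (l i)^-1.
      have d3 : is_derive t 1 ((l i)^-1 *: (@id R)) ((l i)^-1 *: (1 : R)) by apply: is_deriveZ.
      have d4 := is_deriveD d3 (is_derive_cst (- ((l i)^-1 * a i)) t (1 : R)).
      by apply: is_derive_eq d4 _; rewrite addr0 [_ *: _]mulr1.
    by have := is_derive1_comp d1 d2; rewrite mulrC.
  have [_ ->] := is_derive_sum (fun i : 'I_N => is_deriveZ N%:R^-1 (ds i)).
  by [].
(* During the [k]-th interval the earlier steps have reached 1 and the later ones are still 0. *)
have zk k t : (k < N)%N -> a k <= t <= a k.+1 -> z t = N%:R^-1 * (k%:R + step (arg k t)).
  move=> kN /andP[h1 h2]; rewrite /z -mulr_sumr; congr (_ * _).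
  rewrite -(big_mkord xpredT (fun i => step (arg i t))) (big_cat_nat (n := k)) //=; last exact: ltnW.
  congr (_ + _).
    rewrite big_nat (eq_bigr (fun=> 1)); last first.
      move=> i /andP[_ ik]; apply: step1; apply: arg_ge1.
      by apply: le_trans h1; apply: amono.
    by rewrite -big_nat sumr_const_nat subn0.
  rewrite big_ltn // big_nat big1 ?addr0 // => i /andP[ki _].
  by apply: step0; apply: arg_le0; apply: le_trans h2 _; exact: amono.
have z01 t : `[0, 1]%classic (z t).
  rewrite /= in_itv /=; apply/andP; split.
    by apply: sumr_ge0 => i _; rewrite mulr_ge0 ?step_ge0 // invr_ge0 ltW.
  rewrite /z -mulr_sumr ler_pdivrMl // mulr1.
  apply: (@le_trans _ _ (\sum_(i < N) 1)); first by apply: ler_sum => i _; exact: step_le1.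
  by rewrite sumr_const card_ord.
have dout t : t <= s0 \/ s1 <= t -> 'D_1 (z : R -> R) t = 0.
  move=> h; rewrite dz big1 // => i _; rewrite step_out ?mulr0 //.
  case: h => h; [left; apply: le_trans h _; rewrite -a0; exact: amono|right].
  by apply: le_trans h; rewrite -aN; exact: amono.
exists z; split=> //.
- move=> t h; rewrite /z big1 // => i _; rewrite step0 ?mulr0 //.
  by apply: arg_le0; apply: le_trans h _; rewrite -a0; exact: amono.
- move=> t h; rewrite /z (eq_bigr (fun=> N%:R^-1)); last first.
    move=> i _; rewrite step1 ?mulr1 //; apply: arg_ge1.
    by apply: le_trans h; rewrite -aN; exact: amono.
  by rewrite sumr_const card_ord -[_ *+ _]mulr_natr mulVf // gt_eqF.
move=> t.
have RS : N%:R^-1 * W <= \int[mu]_(t in `[0, 1]) u t + e.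
  have := @riemann_sum_le u N dl cu N0.
  have h1 : forall i s, (i < N)%N -> i%:R / N%:R <= s <= i.+1%:R / N%:R -> u (i%:R / N%:R) - dl <= u s.
    by move=> i s iN /(hu _ _ iN); rewrite ler_norml; lra.
  move=> /(_ h1) h2.
  have -> : N%:R^-1 * W = N%:R^-1 * \sum_(i < N) (u (i%:R / N%:R) - dl) + 2 * dl.
    have sumE c : N%:R^-1 * \sum_(i < N) (u (i%:R / N%:R) + c) = N%:R^-1 * \sum_(i < N) u (i%:R / N%:R) + c.
      by rewrite big_split /= sumr_const card_ord -[X in _ * (_ + X)]mulr_natl mulrDr mulKf // gt_eqF.
    by rewrite /W /w (sumE dl) (sumE (- dl)); lra.
  by rewrite /dl in h2 *; lra.
have I0 : 0 <= \int[mu]_(t in `[0, 1]) u t by apply: Rintegral_ge0.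
have rhs0 : 0 <= C * (\int[mu]_(t in `[0, 1]) u t + e) / L.
  by rewrite divr_ge0 ?(ltW L0) // mulr_ge0 ?(ltW C0) // addr_ge0 // ltW.
have [[k ak]|none] := pselect (exists k : 'I_N, a k < t < a k.+1); last first.
  suff -> : 'D_1 (z : R -> R) t = 0 by rewrite normr0 mul0r.
  rewrite dz big1 // => i _; rewrite step_out ?mulr0 //.
  have [h|h] := leP t (a i); first by left.
  right; rewrite leNgt; apply/negP => h2; apply: none; exists i; exact/andP.
case: k ak => k kN /= /andP[h1 h2].
have zE : z t = N%:R^-1 * (k%:R + step (arg k t)) by apply: zk => //; rewrite (ltW h1) ltW.
have uz : u (z t) <= w k.
  have : `|u (k%:R / N%:R) - u (z t)| <= dl.
    apply: hu => //; rewrite zE [_^-1 * _]mulrC !ler_pM2r ?invr_gt0 //.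
    by rewrite lerDl step_ge0 /= -addn1 natrD lerD2l step_le1.
  by rewrite /w ler_norml; lra.
have -> : 'D_1 (z : R -> R) t = N%:R^-1 * ((l k)^-1 * 'D_1 (@step R : R -> R) (arg k t)).
  rewrite dz (bigD1 (Ordinal kN)) //= big1 ?addr0 // => i ik.
  rewrite step_out ?mulr0 //.
  have : (i < k)%N || (k < i)%N by rewrite -neq_ltn.
  case/orP => h; [right; apply: le_trans (ltW h1)|left; apply: le_trans (ltW h2) _]; exact: amono.
rewrite !normrM (@gtr0_norm _ N%:R^-1) ?invr_gt0 // (@gtr0_norm _ (l k)^-1) ?invr_gt0 //.
apply: (@le_trans _ _ (N%:R^-1 * ((l k)^-1 * C) * w k)).
  apply: ler_pM => //; first by rewrite !mulr_ge0 ?invr_ge0 ?(ltW (l0 k)) ?(ltW NR).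
  by rewrite !ler_pM2l ?invr_gt0.
have -> : N%:R^-1 * ((l k)^-1 * C) * w k = C * (N%:R^-1 * W) / L.
  have fE (x1 x2 x3 x4 : R) : 0 < x1 -> 0 < x2 -> 0 < x3 -> 0 < x4 ->
      x4^-1 * ((x3 * x1 / x2)^-1 * C) * x1 = C * (x4^-1 * x2) / x3.
    by move=> *; field; rewrite !gt_eqF.
  exact: fE.
by rewrite ler_pM2r ?invr_gt0 // ler_pM2l.
Qed.
End Reparametrization.

(** * The norm of L^1([0, 1], C^0(M)) *)

Lemma uniform_cvgP (U : choiceType) (V : uniformType) (B : set U) (F : nat -> U -> V) (f : U -> V) :
  {uniform B, F @ \oo --> f} <->
  forall E, entourage E -> \forall k \near \oo, forall y, B y -> E (f y, F k y).
Proof.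
split=> [cF E entE|H P].
  by apply: (cF [set h | forall y, B y -> E (f y, h y)]); apply/uniform_nbhs; exists E; split.
move=> /uniform_nbhs [E [entE EP]].
have : \forall k \near \oo, forall y, B y -> E (f y, F k y) by exact: H.
by move=> HE; change (nbhs \oo (F @^-1` P)); apply: filterS HE => k; exact: EP.
Qed.

Lemma uniform_cvg_normP (R : realType) (U : choiceType) (B : set U) (F : nat -> U -> R) (f : U -> R) :
  {uniform B, F @ \oo --> f} <->
  forall e, 0 < e -> \forall k \near \oo, forall y, B y -> `|f y - F k y| < e.
Proof.
split=> [/uniform_cvgP cF e e0|H].
  apply: (cF [set p : R * R | `|p.1 - p.2| < e]).
  by rewrite -entourage_ballE; exists e.
apply/uniform_cvgP => E; rewrite -entourage_ballE => -[e /= e0 eE].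
by apply: filterS (H e e0) => k hk y By; apply: eE => /=; exact: hk.
Qed.

Section NonMeasurable.
Import HBNNSimple.
Context d (T : measurableType d) (R : realType) (mu : {measure set T -> \bar R}).
Local Open Scope ereal_scope.

(* No measurability of [f] is assumed: the integral of a nonnegative function is
   the supremum over the simple functions below it. *)
Lemma integral_lower_bound (D N : set T) (v f : T -> \bar R) :
  measurable D -> measurable N -> mu N = 0 ->
  (forall x, 0 <= v x) -> (forall x, N x -> v x = 0) ->
  (forall x, D x -> ~ N x -> v x <= f x) ->
  \int[mu]_(x in D) v x <= \int[mu]_(x in D) f x.
Proof.
move=> mD mN N0 v0 vN vf.
pose nn (g : T -> \bar R) := ereal_sup [set sintegral mu h |
  h in [set h : {nnsfun T >-> R} | forall x, (h x)%:E <= g x]].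
have nn_le g1 g2 : (forall x, g1 x <= g2 x) -> nn g1 <= nn g2.
  by move=> g12; apply: ereal_sup_le => _ [h hg <-]; exists h => // x; apply: le_trans (hg x) _.
rewrite ge0_integralE // -/(nn _) [X in _ <= X]/integral -/(nn _) -/(nn _).
have -> : nn ((f \_ D)^\-) = 0.
  apply/eqP; rewrite eq_le; apply/andP; split; last first.
    apply: ereal_sup_ubound; exists nnsfun0; last first.
      by rewrite -(sintegral0 mu); apply: eq_sintegral.
    by move=> x; exact: funeneg_ge0.
  (* On [D] the negative part of [f] can be nonzero only on the null set [N], so it is dominated by
     the function equal to infinity on [N]. *)
  have <- : \int[mu]_x ((cst +oo) \_ N) x = 0.
    by rewrite -integral_mkcond integral_cst // N0 mule0.
  rewrite ge0_integralTE => [|x]; last by rewrite patchE; case: ifP => // _; exact: leey.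
  apply: nn_le => x; rewrite funenegE !patchE.
  case: ifPn => [/set_mem Dx|_]; last first.
    by rewrite oppe0 maxxx; case: ifP => // _; exact: leey.
  case: ifPn => [_|/negP nN]; first exact: leey.
  rewrite ge_max lexx andbT oppe_le0; apply: le_trans (v0 x) _; apply: vf => //.
  by move=> Nx; apply: nN; rewrite inE.
rewrite sube0; apply: nn_le => x; rewrite funeposE !patchE.
case: ifPn => [/set_mem Dx|_]; last by rewrite le_max lexx.
have [Nx|nN] := pselect (N x); first by rewrite vN // le_max lexx orbT.
by rewrite le_max vf.
Qed.

End NonMeasurable.

(** * Supremum norms of paths of functions *)

Section SupNorm.
Variables (R : realType) (M : uniformType).
Hypothesis cptM : compact [set: M].
Hypothesis M0 : [set: M] !=set0.
Notation mu := (@lebesgue_measure R).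

Definition snorm (f : M -> R) : R := sup (range (fun x => `|f x|)).

Definition bounded (f : M -> R) := exists C, forall x, `|f x| <= C.

Lemma snorm_ub f x : bounded f -> `|f x| <= snorm f.
Proof.
move=> [C HC]; apply: ub_le_sup; last by exists x.
by exists C => _ [y _ <-].
Qed.

Lemma snorm_le f C : (forall x, `|f x| <= C) -> snorm f <= C.
Proof.
move=> HC; have [x0 _] := M0; apply: ge_sup; first by exists `|f x0|, x0.
by move=> _ [y _ <-].
Qed.

Lemma snorm_ge0 f : bounded f -> 0 <= snorm f.
Proof. by move=> bf; have [x0 _] := M0; apply: le_trans (normr_ge0 _) (snorm_ub x0 bf). Qed.

Lemma snorm_dist f g e : bounded f -> bounded g -> (forall x, `|f x - g x| <= e) ->
  `|snorm f - snorm g| <= e.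
Proof.
move=> bf bg fg; have H f' g' : bounded g' -> (forall x, `|f' x - g' x| <= e) -> snorm f' <= snorm g' + e.
  move=> bg' h; apply: snorm_le => x; rewrite -(subrK (g' x) (f' x)) addrC.
  by apply: le_trans (ler_normD _ _) _; apply: lerD; [exact: snorm_ub|exact: h].
have h1 := H f g bg fg.
have h2 : snorm g <= snorm f + e by apply: H => // x; rewrite distrC.
by rewrite ler_norml; lra.
Qed.

Lemma cont_fiber (F : R -> M -> R) t : continuous (fun p : R * M => F p.1 p.2) -> continuous (F t).
Proof.
move=> cF x; apply: (@continuous_comp _ _ _ (fun x : M => (t, x)) (fun p : R * M => F p.1 p.2)); last exact: cF.
by apply: continuous_pair_at; [exact: cst_continuous|exact: cvg_id].
Qed.

Lemma bounded_fiber (F : R -> M -> R) t : continuous (fun p : R * M => F p.1 p.2) -> bounded (F t).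
Proof. by move=> cF; apply: cont_bounded => //; exact: cont_fiber. Qed.

Lemma snorm_cont (F : R -> M -> R) : continuous (fun p : R * M => F p.1 p.2) ->
  continuous (fun t => snorm (F t)).
Proof.
move=> cF t; apply/cvgrPdist_le => e e0.
apply: filterS (@tube_continuous R R M setT (fun p => F p.1 p.2) t e cptM cF e0) => s hs.
by apply: snorm_dist; [exact: bounded_fiber|exact: bounded_fiber|move=> x; rewrite distrC; exact: hs].
Qed.

(** Induction on the number of pieces: on the last set its function is constant in time and is moved
    into the continuous path [G]; off that set it disappears. The two resulting functions are glued
    by indicators. *)
Lemma simple_measurable m (E : 'I_m -> set R) (f : 'I_m -> M -> R) (G : R -> M -> R) :
  (forall k, measurable (E k)) -> (forall k, continuous (f k)) ->
  continuous (fun p : R * M => G p.1 p.2) ->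
  measurable_fun setT (fun t => snorm (fun x => \sum_(k < m) \1_(E k) t * f k x - G t x)).
Proof.
elim: m E f G => [|m IH] E f G mE cf cG.
  apply: continuous_measurable_fun.
  apply: (@snorm_cont (fun t x => \sum_(k < 0) \1_(E k) t * f k x - G t x)) => p.
  apply: contB; last exact: cG.
  by rewrite (_ : (fun y : R * M => _) = cst 0); [exact: cst_continuous|apply/funext => q; rewrite big_ord0].
pose E' k := E (widen_ord (leqnSn m) k); pose f' k := f (widen_ord (leqnSn m) k).
pose A t := snorm (fun x => \sum_(k < m) \1_(E' k) t * f' k x - (G t x - f ord_max x)).
pose B t := snorm (fun x => \sum_(k < m) \1_(E' k) t * f' k x - G t x).
have mA : measurable_fun setT A.
  apply: (IH E' f' (fun t x => G t x - f ord_max x)); [by move=> k; exact: mE|by move=> k; exact: cf|].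
  move=> p; apply: contB; first exact: cG.
  by apply: continuous_comp; [exact: continuous_snd|exact: cf].
have mB : measurable_fun setT B.
  by apply: IH => //; [move=> k; exact: mE|move=> k; exact: cf].
rewrite (_ : (fun t => _) = (fun t => \1_(E ord_max) t * A t + (1 - \1_(E ord_max) t) * B t)).
  apply: measurable_funD; apply: measurable_funM => //.
  by apply: measurable_funB; [exact: measurable_cst|exact: measurable_indic].
apply/funext => t; rewrite indicE; case: (t \in E ord_max) / boolP => tE.
  rewrite mul1r subrr mul0r addr0; congr snorm; apply/funext => x.
  by rewrite big_ord_recr /= indicE tE mul1r opprB addrA.
rewrite mul0r add0r subr0 mul1r; congr snorm; apply/funext => x.
by rewrite big_ord_recr /= indicE (negbTE tE) mul0r addr0.
Qed.

End SupNorm.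

(** * The Cauchy property of approximating Hamiltonians *)

Section CauchyL1.
Variables (R : realType) (n : nat) (M : uniformType).
Variable A : atlas R n.*2.+1 M.
Variable a : chart_index A -> 'rV[R]_n.*2.+1 -> 'cV[R]_n.*2.+1.
Hypothesis cptM : compact [set: M].
Hypothesis hausM : hausdorff_space M.
Hypothesis contact_a : contact_form a.
Hypothesis M0 : [set: M] !=set0.
Notation mu := (@lebesgue_measure R).

Lemma contB_fun (f g : M -> R) : continuous f -> continuous g -> continuous (fun x => f x - g x).
Proof. by move=> cf cg x; apply: contB; [exact: cf|exact: cg]. Qed.

Lemma simple_path_cont (S : R -> M -> R) t : simple_path S -> continuous (S t).
Proof.
move=> [m [E [f [_ cf SE]]]].
have -> : S t = fun x => \sum_(k < m) \1_(E k) t * f k x by apply/funext => x; exact: SE.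
elim: m E f cf {SE} => [|m IH] E f cf.
  by rewrite (_ : (fun x => _) = cst 0); [exact: cst_continuous|apply/funext => x; rewrite big_ord0].
rewrite (_ : (fun x => _) = fun x => \sum_(k < m) \1_(E (widen_ord (leqnSn m) k)) t * f (widen_ord (leqnSn m) k) x + \1_(E ord_max) t * f ord_max x); last first.
  by apply/funext => x; rewrite big_ord_recr.
move=> x.
apply: (@contD R M (fun x => \sum_(k < m) \1_(E (widen_ord (leqnSn m) k)) t * f (widen_ord (leqnSn m) k) x) (fun x => \1_(E ord_max) t * f ord_max x)).
  by apply: (IH (fun k => E (widen_ord (leqnSn m) k)) (fun k => f (widen_ord (leqnSn m) k))) => k; exact: cf.
by apply: (@contM R M (fun=> _) (f ord_max)); [exact: cst_continuous|exact: cf].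
Qed.

(** [N] contains the times at which the simple paths fail to converge. Elsewhere [H t] is a uniform
    limit of continuous functions, and its distance to [G t] is a limit of measurable functions of
    [t]. *)
Lemma L1_approx (H : R -> M -> R) : L1C0 H -> exists N : set R,
  [/\ measurable N, mu N = 0,
   forall t, `[0, 1]%classic t -> ~ N t -> continuous (H t) &
   forall G : R -> M -> R, continuous (fun p : R * M => G p.1 p.2) ->
     measurable_fun (`[0, 1]%classic `\` N) (fun t => snorm (fun x => H t x - G t x))].
Proof.
move=> [S [sS [N [mN N0 HN]] _]].
have good t : `[0, 1]%classic t -> ~ N t -> {uniform, (fun k => S k t) @ \oo --> H t}.
  by move=> t01 nN; apply: contrapT => h; apply: nN; apply: HN => /(_ t01).
have cH t : `[0, 1]%classic t -> ~ N t -> continuous (H t).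
  move=> t01 nN; apply: (@uniform_limit_continuous M R ((fun k => S k t) @ \oo)); last exact: good.
  have : \forall k \near \oo, continuous (S k t) by apply: nearW => k; exact: simple_path_cont.
  by [].
exists N; split=> // G cG.
apply: (@measurable_fun_cvg _ _ _ _ (fun k t => snorm (fun x => S k t x - G t x))).
  move=> k; have [m [E [f [mE cf SE]]]] := sS k.
  rewrite (_ : (fun t => _) = (fun t => snorm (fun x => \sum_(k < m) \1_(E k) t * f k x - G t x))).
    by apply: measurable_funTS; exact: simple_measurable.
  by apply/funext => t; congr snorm; apply/funext => x; rewrite SE.
move=> t [t01 nN]; apply/cvgrPdist_le => e e0.
have /uniform_cvg_normP/(_ e e0) := good t t01 nN.
apply: filterS => k hk; apply: snorm_dist => //.
- by apply: cont_bounded => //; apply: contB_fun; [exact: cH|exact: cont_fiber].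
- by apply: cont_bounded => //; apply: contB_fun; [exact: simple_path_cont|exact: cont_fiber].
- by move=> x; rewrite opprB addrA subrK; exact: ltW (hk x I).
Qed.

(** The integrand of [norm_1oo] is bounded below by [v i], the supremum norm of [H - G i] cut to 0
    on the null set [N], which is measurable. The triangle inequality then holds almost everywhere,
    and [H] drops out of the conclusion. *)
Lemma L1_cauchy (H : R -> M -> R) (G : nat -> R -> M -> R) : L1C0 H ->
  (forall i, continuous (fun p : R * M => G i p.1 p.2)) ->
  norm_1oo a (fun t x => H t x - G i t x) @[i --> \oo] --> 0%E ->
  forall e, 0 < e -> exists N, forall i j, (N <= i)%N -> (N <= j)%N ->
    \int[mu]_(t in `[0, 1]) snorm (fun x => G i t x - G j t x) <= e.
Proof.
move=> LH cG cv e e0; have [N [mN N0 cH mH]] := L1_approx LH.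
pose v i t : R := if t \in `[0, 1]%classic `\` N then snorm (fun x => H t x - G i t x) else 0.
have bHG i t : `[0, 1]%classic t -> ~ N t -> bounded (fun x => H t x - G i t x).
  by move=> t01 nN; apply: cont_bounded => //; apply: contB_fun; [exact: cH|exact: cont_fiber].
have v0 i t : 0 <= v i t.
  by rewrite /v; case: ifPn => // /set_mem [t01 nN]; apply: snorm_ge0 => //; exact: bHG.
have mI : measurable (`[0, 1]%classic : set R) by exact: measurable_itv.
have mDN : measurable (`[0, 1]%classic `\` N : set R) by exact: measurableD.
have mv i : measurable_fun setT (v i).
  have -> : v i = (fun t => snorm (fun x => H t x - G i t x)) \_ (`[0, 1]%classic `\` N).
    by apply/funext => t; rewrite patchE.
  by apply/(measurable_restrictT _ mDN); exact: mH.
have le_v i : (\int[mu]_(t in `[0%R, 1%R]) (v i t)%:E <= norm_1oo a (fun t x => (H t x - G i t x)%R))%E.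
  rewrite /norm_1oo; apply: (@integral_lower_bound _ _ R mu `[0,1]%classic N (fun t => (v i t)%:E) (fun t => (contact_norm a (fun x : M => H t x - G i t x))%:E)) => //.
  - by move=> t; rewrite lee_fin.
  - by move=> t Nt; rewrite /v ifF //; apply/negbTE/negP => /set_mem [].
  - move=> t t01 nN; rewrite lee_fin /v mem_set //.
    apply: (snorm_le M0) => x; have cHG : continuous (fun x => H t x - G i t x).
      by apply: contB_fun; [exact: cH|exact: cont_fiber].
    exact: (proj1 (contact_norm_bounds cptM contact_a M0 cHG)).
have e2 : 0 < e / 2 by rewrite divr_gt0.
have [K _ HK] : \forall i \near \oo, (norm_1oo a (fun t x => (H t x - G i t x)%R) < (e / 2)%:E)%E.
  apply: (cv [set y | (y < (e / 2)%:E)%E]); apply: open_nbhs_nbhs; split=> //=.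
  exact: open_ereal_lt_ereal.
exists K => i j Ki Kj.
have cu : continuous (fun t => snorm (fun x => G i t x - G j t x)).
  by apply: (@snorm_cont _ _ cptM M0 (fun t x => G i t x - G j t x)) => p; apply: contB; exact: cG.
have u0 t : 0 <= snorm (fun x => G i t x - G j t x).
  by apply: snorm_ge0 => //; apply: cont_bounded => //; apply: contB_fun; exact: cont_fiber.
have mE (w : R -> R) : measurable_fun setT w -> measurable_fun (`[0, 1]%classic : set R) (fun t => (w t)%:E).
  by move=> mw; apply/measurable_EFinP; exact: measurable_funTS.
suff H1 : (\int[mu]_(t in `[0%R, 1%R]) (snorm (fun x => (G i t x - G j t x)%R))%:E <= e%:E)%E.
  have I0 : (0 <= \int[mu]_(t in `[0%R, 1%R]) (snorm (fun x => (G i t x - G j t x)%R))%:E)%E.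
    by apply: integral_ge0 => t _; rewrite lee_fin.
  rewrite /Rintegral -lee_fin fineK // ge0_fin_numE //.
  exact: le_lt_trans H1 (ltry _).
apply: (@le_trans _ _ (\int[mu]_(t in `[0%R, 1%R]) ((v i t)%:E + (v j t)%:E))%E).
  apply: ae_ge0_le_integral => //.
  - by move=> t _; rewrite lee_fin.
  - by apply: mE; exact: continuous_measurable_fun.
  - by move=> t _; rewrite -EFinD lee_fin addr_ge0.
  - by apply: emeasurable_funD; exact: mE.
  exists N; split=> // t /= /not_implyP [t01 h].
  apply: contrapT => nN; apply: h; rewrite -EFinD lee_fin /v mem_set //.
  apply: (snorm_le M0) => x.
  have -> : G i t x - G j t x = (H t x - G j t x) - (H t x - G i t x) by lra.
  rewrite [X in _ <= X]addrC; apply: le_trans (ler_normB _ _) _.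
  by apply: lerD; apply: (snorm_ub (f := fun x => H t x - G _ t x)); exact: bHG.
rewrite ge0_integralD //; last 4 first.
- by move=> t _; rewrite lee_fin.
- exact: mE.
- by move=> t _; rewrite lee_fin.
- exact: mE.
rewrite [e](splitr e) EFinD; apply: leeD.
  by apply: le_trans (le_v i) _; apply: ltW; exact: HK.
by apply: le_trans (le_v j) _; apply: ltW; exact: HK.
Qed.

End CauchyL1.

(** * Concatenation of increments *)

Lemma uniform_continuity_param (X : topologicalType) (M V : uniformType) (K : set X) (f : X -> M -> V)
    (E : set (V * V)) : compact K -> compact [set: M] ->
  continuous (fun p : X * M => f p.1 p.2) -> entourage E ->
  exists2 D, entourage D & forall s y y', K s -> D (y, y') -> E (f s y, f s y').
Proof.
move=> cK cM cf entE.
have /compact_near_coveringP cKM := compact_setX cK cM.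
(* The filter of arbitrarily small relations serves as parameter: compactness of [K * M] in its
   near-covering form then yields one entourage valid at all points. *)
pose F := filter_from (@entourage M) (fun E' => [set D : set (M * M) | D `<=` E']).
have FF : Filter F.
  apply: filter_from_filter; first by exists setT; exact: entourageT.
  move=> E1 E2 e1 e2; exists (E1 `&` E2); first exact: filterI.
  by move=> D /= h; split=> p /h [].
have [] := cKM (set (M * M)) F (fun D p => forall y', D (p.2, y') -> E (f p.1 p.2, f p.1 y')) FF.
  move=> [s0 y0] [_ _].
  pose E1 := split_ent E.
  have entE1 : entourage E1 by exact: entourage_split_ent.
  have entE2 : entourage (E1 `&` E1^-1)%relation by exact: entourage_invI.
  have := cf (s0, y0) _ (nbhs_entourage _ entE2) => -[[U W] /= [nU nW] UW].
  have [D0 entD0 D0W] : exists2 D0, entourage D0 & xsection D0 y0 `<=` W.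
    by move: nW; rewrite -nbhs_entourageE => -[D0 ? ?]; exists D0.
  have entD1 := entourage_split_ent entD0.
  exists (U `*` xsection (split_ent D0) y0, [set D | D `<=` split_ent D0]) => /=.
    split; first by exists (U, xsection (split_ent D0) y0) => //; split=> //; exact: nbhs_entourage.
    by exists (split_ent D0).
  move=> [[s y] D] /= [[Us /xsectionP Dy] DD] y' Dyy'.
  have h1 : W y by apply: D0W; apply/xsectionP; exact: (split_ent_subset entD0 Dy).
  have h2 : W y' by apply: D0W; apply/xsectionP; apply: (entourage_split y) => //; exact: DD.
  have /xsectionP [_ g1] := UW (s, y) (conj Us h1).
  have /xsectionP [g2 _] := UW (s, y') (conj Us h2).
  exact: (entourage_split (f s0 y0)).
move=> D entD DP; exists D => // s y y' Ks Dyy'.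
by apply: (DP D _ (s, y)).
Qed.

(** * Increments close to the identity *)

Section Conjugates.
Variables (R : realType) (M : uniformType).
Hypothesis cptM : compact [set: M].
Hypothesis hausM : hausdorff_space M.

(** Equal images under [Phi_ m s] and [Phi_ m' s] give close images under the limit [Phi s], whose
    inverse is uniformly continuous, uniformly in [s]. With [m' = m.+1] this says that the
    increments are uniformly close to the identity. *)
Lemma same_image_close (Phi_ : nat -> R -> M -> M) (Phi : R -> M -> M) (E : set (M * M)) :
  isotopy_of_homeos Phi -> cvg_uniformly Phi_ Phi -> entourage E ->
  exists N, forall m m' s z x, (N <= m)%N -> (N <= m')%N -> `[0, 1]%classic s ->
    Phi_ m s z = Phi_ m' s x -> E (z, x).
Proof.
move=> [cP hP] /uniform_cvgP cv entE.
have H0 : forall t : R, exists psi, cancel (Phi (clamp t)) psi /\ cancel psi (Phi (clamp t)).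
  by move=> t; have [_ [psi [_ ? ?]]] := hP _ (clamp01 t); exists psi.
have [Th HT] := choice H0.
have cT : continuous (fun p : R * M => Th p.1 p.2).
  apply: (@jcont_inv _ cptM hausM R (fun t => Phi (clamp t)) Th (jcont_clamp cP)) => t; by have [] := HT t.
have [D entD HD] := uniform_continuity_param (@segment_compact R 0 1) cptM cT entE.
have entD1 := entourage_split_ent entD.
have entD2 : entourage (split_ent D `&` (split_ent D)^-1)%relation by exact: entourage_invI.
have [N _ HN] := cv _ entD2.
exists N => m m' s z x Nm Nm' s01 zx.
have [h1 _] := HN m Nm (s, z) (conj s01 I).
have [_ h2] := HN m' Nm' (s, x) (conj s01 I).
have DD : D (Phi s z, Phi s x) by apply: (entourage_split (Phi_ m s z)) => //; rewrite zx.
have [TK _] := HT s; rewrite (clamp_id s01) in TK.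
by have := HD s _ _ s01 DD; rewrite !TK.
Qed.

End Conjugates.

(** * The concatenated isotopies, their Hamiltonians and conformal factors *)

Section Construction.
Variables (R : realType) (d : nat) (M : topologicalType) (A : atlas R d M).
Variable a : chart_index A -> 'rV[R]_d -> 'cV[R]_d.
Hypothesis cptM : compact [set: M].
Hypothesis hausM : hausdorff_space M.
Hypothesis a_neq0 : forall i y, chart_img i y -> exists v, pairing v (a i y) != 0.

Definition node (k : nat) : R := 1 - (2 ^+ k.+1)^-1.

Lemma node_gap k : node k.+1 - node k = (2 ^+ k.+2)^-1.
Proof. by rewrite /node exprS; field; rewrite expf_eq0 /= pnatr_eq0. Qed.

Lemma node_ltS k : node k < node k.+1.
Proof. by rewrite -subr_gt0 node_gap invr_gt0 exprn_gt0. Qed.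

Lemma node_le k m : (k <= m)%N -> node k <= node m.
Proof.
elim: m => [|m IH]; first by rewrite leqn0 => /eqP ->.
rewrite leq_eqVlt => /orP[/eqP -> //|/IH h].
exact: le_trans h (ltW (node_ltS m)).
Qed.

Lemma node_lt1 k : node k < 1.
Proof. by rewrite /node ltrBlDr ltrDl invr_gt0 exprn_gt0. Qed.

Lemma node_gt0 k : 0 < node k.
Proof. by rewrite /node subr_gt0 invf_lt1 ?exprn_gt0 // exprn_egt1 // ltr1n. Qed.

Lemma node_cofinal t : t < 1 -> exists k, t <= node k.
Proof.
move=> t1; have t0 : 0 < 1 - t by rewrite subr_gt0.
exists (Num.truncn (1 - t)^-1); set k := Num.truncn _.
have k1 : (1 - t)^-1 < k.+1%:R by exact: truncnS_gt.
have k2 : k.+1%:R <= 2 ^+ k.+1 :> R by rewrite -natrX ler_nat ltnW // ltn_expl.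
have : (2 ^+ k.+1)^-1 <= 1 - t.
  rewrite -[1 - t]invrK lef_pV2 ?posrE ?invr_gt0 ?exprn_gt0 //.
  exact: ltW (lt_le_trans k1 k2).
rewrite /node; lra.
Qed.

Variables (Phi_ Th : nat -> R -> M -> M) (H_ h_ : nat -> R -> M -> R).
Variables (z : nat -> R -> R) (zi : R -> R).

Hypothesis sys : forall k, smooth_contact_system a (Phi_ k) (H_ k) (h_ k).
Hypothesis inv : forall k t, `[0, 1]%classic t ->
  [/\ smooth_map A (Th k t), cancel (Phi_ k t) (Th k t) & cancel (Th k t) (Phi_ k t)].
Hypothesis zi_unit : unit_time zi.
Hypothesis zi0 : zi 0 = 0.
Hypothesis zi1 : forall t, node 0 <= t -> zi t = 1.
Hypothesis Dzi1 : forall t, node 0 <= t -> 'D_1 (zi : R -> R) t = 0.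
Hypothesis z_unit : forall k, unit_time (z k).
Hypothesis z0 : forall k t, t <= node k -> z k t = 0.
Hypothesis z1 : forall k t, node k.+1 <= t -> z k t = 1.
Hypothesis Dz : forall k t, t <= node k \/ node k.+1 <= t -> 'D_1 (z k : R -> R) t = 0.

(* The increment [Phi_k^-1 o Phi_{k+1}] at time [z k t], its inverse, its
   Hamiltonian and its conformal factor. *)
Definition inc k t x := Th k (z k t) (Phi_ k.+1 (z k t) x).
Definition inc_inv k t x := Th k.+1 (z k t) (Phi_ k (z k t) x).
Definition inc_ham k t x : R :=
  - (expR (- h_ k (z k t) x) * ('D_1 (z k : R -> R) t * H_ k (z k t) (Phi_ k (z k t) x)))
  + expR (- h_ k (z k t) (Th k (z k t) (Phi_ k (z k t) x))) *
    ('D_1 (z k : R -> R) t * H_ k.+1 (z k t) (Phi_ k (z k t) x)).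
Definition inc_conf k t x : R :=
  - h_ k (z k t) (Th k (z k t) (Phi_ k.+1 (z k t) x)) + h_ k.+1 (z k t) x.

(** [Psi k] performs the initial run along [Phi_ 0] and the first [k] increments, so it is at rest
    from [node k] on. Together with [PsiI], [Psih] and [PsiH] it repeats the formulas of
    [gsystem_comp] literally, so that lemma applies without rewriting. *)
Fixpoint Psi k : R -> M -> M :=
  match k with 0 => fun t => Phi_ 0 (zi t) | k'.+1 => fun t x => Psi k' t (inc k' t x) end.
Fixpoint PsiI k : R -> M -> M :=
  match k with 0 => fun t => Th 0 (zi t) | k'.+1 => fun t x => inc_inv k' t (PsiI k' t x) end.
Fixpoint Psih k : R -> M -> R :=
  match k with 0 => fun t => h_ 0 (zi t)
  | k'.+1 => fun t x => Psih k' t (inc k' t x) + inc_conf k' t x end.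
Fixpoint PsiH k : R -> M -> R :=
  match k with 0 => fun t x => 'D_1 (zi : R -> R) t * H_ 0 (zi t) x
  | k'.+1 => fun t x => PsiH k' t x + expR (Psih k' t (PsiI k' t x)) * inc_ham k' t (PsiI k' t x) end.

Lemma inc_system k : gsystem a (inc k) (inc_inv k) (inc_ham k) (inc_conf k).
Proof.
have s1 := system_reparam cptM hausM a_neq0 (sys k) (inv k) (z_unit k).
have s2 := system_reparam cptM hausM a_neq0 (sys k.+1) (inv k.+1) (z_unit k).
exact: (gsystem_comp (gsystem_inv s1) s2).
Qed.

Lemma Psi_system k : gsystem a (Psi k) (PsiI k) (PsiH k) (Psih k).
Proof.
elim: k => [|k IH]; first exact: (system_reparam cptM hausM a_neq0 (sys 0) (inv 0) zi_unit).
exact: (gsystem_comp IH (inc_system k)).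
Qed.

Lemma Phi0 k x : Phi_ k 0 x = x.
Proof. by have [[_ _ h] _ _] := sys k; exact: h. Qed.

Let t0 : `[0, 1]%classic (0 : R). Proof. by rewrite /= in_itv /= lexx ler01. Qed.
Let t1 : `[0, 1]%classic (1 : R). Proof. by rewrite /= in_itv /= lexx ler01. Qed.

Lemma inc_early k t x : t <= node k -> inc k t x = x.
Proof.
move=> tk; rewrite /inc z0 // Phi0; have [_ PK _] := inv k t0.
by rewrite -[in LHS](Phi0 k x) PK.
Qed.

Lemma Psi_id k x : Psi k 0 x = x.
Proof.
elim: k x => [|k IH] x /=; first by rewrite zi0 Phi0.
by rewrite inc_early ?IH // ltW // node_gt0.
Qed.

Lemma Psi_contact k : smooth_contact_system a (Psi k) (PsiH k) (Psih k).
Proof. by apply: (gsystem_contact (Psi_system k)); exact: Psi_id. Qed.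

(** Telescoping: once all increments are completed, each [Phi_ k 1] cancels against the inverse in
    the next increment. *)
Lemma Psi_late k t x : node k <= t -> Psi k t x = Phi_ k 1 x.
Proof.
case: k => [|k] kt /=; first by rewrite zi1.
elim: k x kt => [|k IH] x kt; rewrite /inc z1 //=.
  rewrite zi1; last by apply: le_trans kt; exact: node_le.
  by have [_ _ TK] := inv 0 t1; rewrite TK.
rewrite IH; last by apply: le_trans kt; exact: node_le.
by have [_ _ TK] := inv k.+1 t1; rewrite TK.
Qed.

Lemma inc_ham_out k t x : t <= node k \/ node k.+1 <= t -> inc_ham k t x = 0.
Proof. by move=> h; rewrite /inc_ham Dz // !mul0r !mulr0 oppr0 addr0. Qed.

Lemma PsiH_late k t x : node k <= t -> PsiH k t x = 0.
Proof.
elim: k x => [|k IH] x kt /=; first by rewrite Dzi1 // mul0r.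
rewrite IH; last by apply: le_trans kt; exact: node_le.
by rewrite inc_ham_out ?mulr0 ?addr0 //; right.
Qed.

(** The maps are already known to coincide, so uniqueness of conformal factors replaces a
    telescoping sum. *)
Lemma Psih_late k t x : node k <= t -> Psih k t x = h_ k 1 x.
Proof.
move=> kt; have [_ _ _ _ /(_ t) [c _]] := Psi_system k.
have [_ _ c'] := sys k.
rewrite (_ : Psi k t = Phi_ k 1) in c; last by apply/funext => y; exact: Psi_late.
by rewrite (conformal_factor_uniq a_neq0 c (c' _ t1)).
Qed.

Lemma PsiS_early k t x : t <= node k ->
  [/\ Psi k.+1 t x = Psi k t x, PsiH k.+1 t x = PsiH k t x & Psih k.+1 t x = Psih k t x].
Proof.
move=> tk; have PE y : Psi k.+1 t y = Psi k t y by rewrite /= inc_early.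
split=> //; first by rewrite /= inc_ham_out ?mulr0 ?addr0 //; left.
have [_ _ _ _ /(_ t) [c _]] := Psi_system k.
have [_ _ _ _ /(_ t) [c' _]] := Psi_system k.+1.
rewrite (_ : Psi k.+1 t = Psi k t) in c'; last by apply/funext.
by rewrite (conformal_factor_uniq a_neq0 c' c).
Qed.

Lemma Psi_stable k m t x : (k <= m)%N -> t <= node k ->
  [/\ Psi m t x = Psi k t x, PsiH m t x = PsiH k t x & Psih m t x = Psih k t x].
Proof.
elim: m => [|m IH]; first by rewrite leqn0 => /eqP ->.
rewrite leq_eqVlt => /orP[/eqP -> //|km] tk.
have [e1 e2 e3] := IH km tk.
have tm : t <= node m by apply: le_trans tk _; exact: node_le.
by have [-> -> ->] := PsiS_early x tm.
Qed.

(* The two halves of [inc_ham] combine into [e^-h (H_{k+1} - H_k)] evaluated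
   along the flow. *)
Lemma inc_hamE k t x : inc_ham k t x = expR (- h_ k (z k t) x) *
  ('D_1 (z k : R -> R) t * (H_ k.+1 (z k t) (Phi_ k (z k t) x) - H_ k (z k t) (Phi_ k (z k t) x))).
Proof.
have [_ zk] := z_unit k; have [_ PK _] := inv k (zk t).
by rewrite /inc_ham PK; ring.
Qed.

(** After [node k] only the last increment contributes. One factor [expR B] bounds the conformal
    factor of the completed part, the other the factor [e^-h] of [inc_hamE]; the hypothesis holds at
    every [y], so it does not matter where on the orbit the difference is evaluated. *)
Lemma PsiH_bound k t x B C : node k <= t ->
  (forall k s y, `[0, 1]%classic s -> `|h_ k s y| <= B) ->
  (forall y, `|'D_1 (z k : R -> R) t| * `|H_ k.+1 (z k t) y - H_ k (z k t) y| <= C) ->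
  `|PsiH k.+1 t x| <= expR B * (expR B * C).
Proof.
move=> kt hB hC; rewrite /= PsiH_late // add0r Psih_late // inc_hamE !normrM.
have [_ zk] := z_unit k.
have eB m s y : `[0, 1]%classic s -> `|expR (h_ m s y)| <= expR B.
  move=> s01; rewrite ger0_norm ?expR_ge0 // ler_expR.
  exact: le_trans (ler_norm _) (hB m s y s01).
have eBN m s y : `[0, 1]%classic s -> `|expR (- h_ m s y)| <= expR B.
  move=> s01; rewrite ger0_norm ?expR_ge0 // ler_expR.
  by apply: le_trans (ler_norm _) _; rewrite normrN; exact: hB.
apply: ler_pM; [exact: normr_ge0|by rewrite !mulr_ge0|exact: eB|].
by apply: ler_pM; [exact: normr_ge0|by rewrite mulr_ge0|exact: eBN|exact: hC].
Qed.

Lemma Psih_step k t x : node k <= t ->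
  Psih k.+1 t x = h_ k 1 (inc k t x) - h_ k (z k t) (inc k t x) + h_ k.+1 (z k t) x.
Proof. by move=> kt; rewrite /= Psih_late // /inc_conf addrA. Qed.

Lemma Psi_step k t x : node k <= t -> Psi k.+1 t x = Phi_ k 1 (inc k t x).
Proof. by move=> kt /=; rewrite Psi_late. Qed.

Lemma inc_image k t x : Phi_ k (z k t) (inc k t x) = Phi_ k.+1 (z k t) x.
Proof. by have [_ zk] := z_unit k; have [_ _ TK] := inv k (zk t); rewrite TK. Qed.

End Construction.

(** * Uniform limits over [[0, 1]] *)

Section UniformLimits.
Variables (R : realType) (M : uniformType).

Lemma unclamp (T : topologicalType) (F : R -> M -> T) :
  continuous (fun p : R * M => F (clamp p.1) p.2) ->
  {within `[0, 1] `*` [set: M], continuous (fun p : R * M => F p.1 p.2)}.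
Proof.
move=> cF.
apply/subspace_continuousP => p [p01 _].
have c : (fun q => F (clamp q.1) q.2) @ within (`[0, 1] `*` [set: M]) (nbhs p) --> F (clamp p.1) p.2.
  by apply: cvg_within_filter; exact: cF.
have nE : \forall q \near within (`[0, 1] `*` [set: M]) (nbhs p), F (clamp q.1) q.2 = F q.1 q.2.
  by rewrite near_withinE; apply: nearW => q [q01 _]; rewrite clamp_id.
have c2 := cvg_trans (near_eq_cvg nE) c.
rewrite (clamp_id p01) in c2. exact: c2.
Qed.

Lemma uniform_limit_clamp (V : uniformType) (F : nat -> R -> M -> V) (f : R -> M -> V) :
  (forall k, continuous (fun p : R * M => F k (clamp p.1) p.2)) ->
  cvg_uniformly F f -> continuous (fun p : R * M => f (clamp p.1) p.2).
Proof.
move=> cF /uniform_cvgP cv.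
apply: (@uniform_limit_continuous (R * M)%type V ((fun k => (fun p : R * M => F k (clamp p.1) p.2)) @ \oo)).
  have : \forall k \near \oo, continuous (fun p : R * M => F k (clamp p.1) p.2) by exact: nearW.
  by [].
apply/uniform_cvgP => E entE; apply: filterS (cv E entE) => k hk p _.
exact: (hk (clamp p.1, p.2) (conj (clamp01 _) I)).
Qed.

Lemma cvg_uniformly_sub (V : uniformType) (F : nat -> R -> M -> V) (f : R -> M -> V) (nu : nat -> nat) :
  (forall k, (k <= nu k)%N) -> cvg_uniformly F f -> cvg_uniformly (fun k => F (nu k)) f.
Proof.
move=> nuk /uniform_cvgP cv; apply/uniform_cvgP => E entE.
have [N _ HN] := cv E entE; exists N => // k /= Nk y By.
by apply: (HN (nu k)) => //=; exact: leq_trans (nuk k).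
Qed.

End UniformLimits.

(** * Passage to the limit at the final time *)

Section Limit.
Variables (R : realType) (n : nat) (M : uniformType).
Variable A : atlas R n.*2.+1 M.
Variable a : chart_index A -> 'rV[R]_n.*2.+1 -> 'cV[R]_n.*2.+1.
Hypothesis cptM : compact [set: M].
Hypothesis hausM : hausdorff_space M.
Hypothesis contact_a : contact_form a.
Hypothesis M0 : [set: M] !=set0.
Hypothesis a_neq0 : forall i y, chart_img i y -> exists v, pairing v (a i y) != 0.

Lemma norm_oo_le (F : R -> M -> R) e : 0 <= e ->
  (forall t, `[0, 1]%classic t -> continuous (F t)) ->
  (forall t x, `[0, 1]%classic t -> `|F t x| <= e) -> 0 <= norm_oo a F <= 3 * e.
Proof.
move=> e0 cF hF.
have cn t : `[0, 1]%classic t -> 0 <= contact_norm a (F t) <= 3 * e.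
  move=> t01; have [h1 h2] := contact_norm_bounds cptM contact_a M0 (cF t t01).
  have [x _] := M0; rewrite (le_trans _ (h1 x)) //=.
  by apply: h2 => y; exact: hF.
have t0 : `[0, 1]%classic (0 : R) by rewrite /= in_itv /= lexx ler01.
have ub : ubound [set contact_norm a (F t) | t in `[0, 1]] (3 * e).
  by move=> _ [t t01 <-]; have /andP [] := cn t t01.
apply/andP; split.
  have /andP [c0 _] := cn 0 t0; apply: le_trans c0 _.
  by apply: ub_le_sup; [exists (3 * e)|exists 0].
by apply: ge_sup; [exists (contact_norm a (F 0)), 0|].
Qed.

Variables (Phi_ Th : nat -> R -> M -> M) (H_ h_ : nat -> R -> M -> R).
Variables (z : nat -> R -> R) (zi : R -> R).
Variables (Phi : R -> M -> M) (h : R -> M -> R) (B C : R).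

Hypothesis sys : forall k, smooth_contact_system a (Phi_ k) (H_ k) (h_ k).
Hypothesis inv : forall k t, `[0, 1]%classic t ->
  [/\ smooth_map A (Th k t), cancel (Phi_ k t) (Th k t) & cancel (Th k t) (Phi_ k t)].
Hypothesis zi_unit : unit_time zi.
Hypothesis zi0 : zi 0 = 0.
Hypothesis zi1 : forall t, node R 0 <= t -> zi t = 1.
Hypothesis Dzi1 : forall t, node R 0 <= t -> 'D_1 (zi : R -> R) t = 0.
Hypothesis z_unit : forall k, unit_time (z k).
Hypothesis z0 : forall k t, t <= node R k -> z k t = 0.
Hypothesis z1 : forall k t, node R k.+1 <= t -> z k t = 1.
Hypothesis Dz : forall k t, t <= node R k \/ node R k.+1 <= t -> 'D_1 (z k : R -> R) t = 0.
Hypothesis isoPhi : isotopy_of_homeos Phi.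
Hypothesis cvPhi : cvg_uniformly Phi_ Phi.
Hypothesis cvh : cvg_uniformly h_ h.
Hypothesis hB : forall k s y, `[0, 1]%classic s -> `|h_ k s y| <= B.
Hypothesis C0 : 0 <= C.
Hypothesis HC : forall k t y,
  `|'D_1 (z k : R -> R) t| * `|H_ k.+1 (z k t) y - H_ k (z k t) y| <= C / 2 ^+ k.

Let P := Psi Phi_ Th z zi.
Let PI := PsiI Phi_ Th z zi.
Let PH := PsiH Phi_ Th H_ h_ z zi.
Let Ph := Psih Phi_ Th h_ z zi.

Lemma node_choice : exists kappa : R -> nat, forall t, t < 1 -> t <= node R (kappa t).
Proof.
have H0 (t : R) : exists k, t < 1 -> t <= node R k.
  have [t1|t1] := ltP t 1; last by exists 0%N.
  by have [k hk] := node_cofinal t1; exists k.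
by have [kappa hkappa] := choice H0; exists kappa.
Qed.

Lemma late_bracket k t : node R k < t -> t < 1 ->
  exists m, [/\ (k <= m)%N, node R m <= t & t <= node R m.+1].
Proof.
move=> kt /node_cofinal ex; case: (ex_minnP ex) => j tj jmin.
case: j tj jmin => [|m] tj jmin.
  by move: (lt_le_trans kt tj); rewrite ltNge node_le.
exists m; split=> //; last first.
  by rewrite leNgt; apply/negP => /ltW /jmin; rewrite ltnn.
rewrite -ltnS ltnNge; apply/negP => mk.
by move: (lt_le_trans kt tj); rewrite ltNge node_le.
Qed.


Lemma PsiH_step_bound m t x : node R m <= t ->
  `|PH m.+1 t x| <= expR B * (expR B * (C / 2 ^+ m)).
Proof.
move=> mt.
by apply: (PsiH_bound cptM hausM a_neq0 sys inv zi_unit zi1 Dzi1 z_unit z1 Dz x mt hB) => y; exact: HC.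
Qed.

Lemma step_bound_small e : 0 < e ->
  exists N, forall m, (N <= m)%N -> expR B * (expR B * (C / 2 ^+ m)) <= e.
Proof.
move=> e0; pose D := expR B * (expR B * C).
have D0 : 0 <= D by rewrite !mulr_ge0 ?expR_ge0.
exists (Num.truncn (D / e)).+1 => m Nm.
have -> : expR B * (expR B * (C / 2 ^+ m)) = D / 2 ^+ m by rewrite /D !mulrA.
rewrite ler_pdivrMr ?exprn_gt0 // mulrC -ler_pdivrMr //.
apply: (@le_trans _ _ m%:R).
  by apply: ltW; apply: lt_le_trans (truncnS_gt _) _; rewrite ler_nat.
by rewrite -natrX ler_nat ltnW // ltn_expl.
Qed.

Lemma conformal_limit_cont : continuous (fun p : R * M => h (clamp p.1) p.2).
Proof.
apply: (uniform_limit_clamp _ cvh) => k.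
by apply: (conformal_cont a_neq0 _ (sys k)); have [] := contact_a.
Qed.

Section Kappa.
Variable kappa : R -> nat.
Hypothesis kappaP : forall t, t < 1 -> t <= node R (kappa t).

(* Before [node k] the isotopies [P m] agree for all [m >= k], so the choice of
   [kappa] does not matter. *)
Definition Psi_lim t x := if t < 1 then P (kappa t) t x else Phi 1 x.
Definition PsiH_lim t x : R := if t < 1 then PH (kappa t) t x else 0.
Definition Psih_lim t x : R := if t < 1 then Ph (kappa t) t x else h 1 x.

Lemma lim_early k t x : t <= node R k -> [/\ Psi_lim t x = P k t x, PsiH_lim t x = PH k t x & Psih_lim t x = Ph k t x].
Proof.
move=> tk; have t1 : t < 1 := le_lt_trans tk (node_lt1 R k).
have stab k1 m1 := Psi_stable cptM hausM a_neq0 sys inv zi_unit z_unit z0 Dz (k := k1) (m := m1) x.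
rewrite /Psi_lim /PsiH_lim /Psih_lim t1; have [km|mk] := leqP k (kappa t).
  by have [] := stab _ _ _ km tk.
by have [e1 e2 e3] := stab _ _ _ (ltnW mk) (kappaP t1); rewrite /P /PH /Ph e1 e2 e3.
Qed.

(** Up to [node k] the two sides agree. Later [P k] rests at [Phi_ k 1], while the limit is
    [Phi_ m 1] applied to an increment close to the identity, for some [m >= k], or [Phi 1] at the
    end; all of these are close to [Phi 1]. *)
Lemma Psi_lim_cvg : cvg_uniformly P Psi_lim.
Proof.
apply/uniform_cvgP => E entE.
pose E1 := split_ent E; pose E2 := split_ent E1.
have entE1 : entourage E1 by exact: entourage_split_ent.
have entE2 : entourage E2 by exact: entourage_split_ent.
have entS : entourage (E2 `&` E2^-1)%relation by exact: entourage_invI.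
have [cPhi hPhi] := isoPhi.
have t1I : `[0, 1]%classic (1 : R) by rewrite /= in_itv /= lexx ler01.
have [D entD HD] := uniform_continuity_param (f := fun t => Phi (clamp t)) (@segment_compact R 0 1) cptM (jcont_clamp cPhi) entE2.
have [N1 HN1] := same_image_close cptM hausM isoPhi cvPhi entD.
have /uniform_cvgP cv := cvPhi.
have [N2 _ HN2] := cv _ entS.
exists (maxn N1 N2) => // k /= Nk [t x] [/= t01 _].
have N1k : (N1 <= k)%N by apply: leq_trans Nk; exact: leq_maxl.
have N2k : (N2 <= k)%N by apply: leq_trans Nk; exact: leq_maxr.
have [tk|kt] := leP t (node R k).
  by have [-> _ _] := lim_early x tk; exact: entourage_refl.
have -> : P k t x = Phi_ k 1 x by exact: (Psi_late inv zi1 z1 x (ltW kt)).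
have [ek _] := HN2 k N2k (1, x) (conj t1I I).
have [t1|t1] := ltP t 1; last first.
  rewrite /Psi_lim ltNge t1 /=; apply: (split_ent_subset entE).
  by apply: (split_ent_subset entE1).
have [m [km mt tm]] := late_bracket kt t1.
have [-> _ _] := lim_early x tm.
have -> : P m.+1 t x = Phi_ m 1 (inc Phi_ Th z m t x) by exact: (Psi_step inv zi1 z1 x mt).
set y := inc Phi_ Th z m t x.
have N1m : (N1 <= m)%N by exact: leq_trans km.
have N2m : (N2 <= m)%N by exact: leq_trans km.
have [_ zm] := z_unit m.
have Dyx : D (y, x).
  apply: (HN1 m m.+1 (z m t)) => //; first exact: leqW.
  exact: (inc_image inv z_unit).
have e1 := HD 1 _ _ t1I Dyx; rewrite (clamp_id t1I) in e1.
have [_ e2] := HN2 m N2m (1, y) (conj t1I I).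
(* The chain is [Phi_ m 1 y], [Phi 1 y], [Phi 1 x], [Phi_ k 1 x]; its three links account for the
   two successive splittings of [E]. *)
apply: (entourage_split (Phi 1 x)) => //.
  by apply: (entourage_split (Phi 1 y)).
by apply: (split_ent_subset entE1).
Qed.

(** After [node k] the [k]-th Hamiltonian is 0, so the difference is the limit Hamiltonian itself,
    bounded by that of a single increment with index at least [k]. *)
Lemma PsiH_lim_close e : 0 < e -> exists N, forall k, (N <= k)%N -> forall t x,
  `[0, 1]%classic t -> `|PsiH_lim t x - PH k t x| <= e.
Proof.
move=> e0; have [N HN] := step_bound_small e0; exists N => k Nk t x t01.
have [tk|kt] := leP t (node R k).
  by have [_ -> _] := lim_early x tk; rewrite subrr normr0 ltW.
have -> : PH k t x = 0 by exact: (PsiH_late Phi_ Th H_ h_ Dzi1 Dz x (ltW kt)).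
rewrite subr0; have [t1|t1] := ltP t 1; last by rewrite /PsiH_lim ltNge t1 /= normr0 ltW.
have [m [km mt tm]] := late_bracket kt t1.
have [_ -> _] := lim_early x tm.
by apply: le_trans (PsiH_step_bound x mt) _; apply: HN; exact: leq_trans km.
Qed.

(** During an increment the factor is [h_ m 1 y - h_ m s y + h_ m.+1 s x] with [y] close to [x]: the
    two terms at time [s] nearly cancel and what remains is close to [h 1 x]. *)
Lemma Psih_lim_cvg : cvg_uniformly Ph Psih_lim.
Proof.
apply/uniform_cvg_normP => e e0.
(* Six errors occur below: four from the convergence of [h_] and two from replacing [y] by [x]. *)
have e8 : 0 < e / 8 by rewrite divr_gt0.
have entE : entourage [set p : R * R | `|p.1 - p.2| < e / 8].
  by rewrite -entourage_ballE; exists (e / 8).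
have t1I : `[0, 1]%classic (1 : R) by rewrite /= in_itv /= lexx ler01.
have [D entD HD] := uniform_continuity_param (f := fun t => h (clamp t)) (@segment_compact R 0 1) cptM conformal_limit_cont entE.
have [N1 HN1] := same_image_close cptM hausM isoPhi cvPhi entD.
have /uniform_cvg_normP cv := cvh.
have [N2 _ HN2] := cv _ e8.
exists (maxn N1 N2) => // k /= Nk [t x] [/= t01 _].
have N1k : (N1 <= k)%N by apply: leq_trans Nk; exact: leq_maxl.
have N2k : (N2 <= k)%N by apply: leq_trans Nk; exact: leq_maxr.
have [tk|kt] := leP t (node R k).
  by have [_ _ ->] := lim_early x tk; rewrite subrr normr0.
have -> : Ph k t x = h_ k 1 x by exact: (Psih_late cptM hausM a_neq0 sys inv zi_unit zi1 z_unit z1 x (ltW kt)).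
have ek : `|h 1 x - h_ k 1 x| < e / 8 := HN2 k N2k (1, x) (conj t1I I).
have [t1|t1] := ltP t 1; last first.
  by rewrite /Psih_lim (ltNge t) t1 /=; apply: lt_le_trans ek _; lra.
have [m [km mt tm]] := late_bracket kt t1.
have [_ _ ->] := lim_early x tm.
rewrite /Ph; have -> := Psih_step cptM hausM a_neq0 sys inv zi_unit zi1 z_unit z1 x mt.
set y := inc Phi_ Th z m t x.
have N1m : (N1 <= m)%N by exact: leq_trans km.
have N2m : (N2 <= m)%N by exact: leq_trans km.
have [_ zm] := z_unit m; have s01 := zm t; set s := z m t in s01 *.
have Dyx : D (y, x).
  apply: (HN1 m m.+1 s) => //; first exact: leqW.
  exact: (inc_image inv z_unit).
have e1 : `|h 1 y - h 1 x| < e / 8 by have := HD 1 _ _ t1I Dyx; rewrite /= clamp_id.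
have e2 : `|h s y - h s x| < e / 8 by have := HD s _ _ s01 Dyx; rewrite /= clamp_id.
have e3 : `|h 1 y - h_ m 1 y| < e / 8 := HN2 m N2m (1, y) (conj t1I I).
have e4 : `|h s y - h_ m s y| < e / 8 := HN2 m N2m (s, y) (conj s01 I).
have e5 : `|h s x - h_ m.+1 s x| < e / 8 := HN2 m.+1 (leqW N2m) (s, x) (conj s01 I).
move: ek e1 e2 e3 e4 e5; rewrite !ltr_norml; lra.
Qed.

Lemma PsiH_cont k : continuous (fun p : R * M => PH k (clamp p.1) p.2).
Proof.
have S := Psi_contact cptM hausM a_neq0 sys inv zi_unit zi0 z_unit z0 k.
by apply: (hamiltonian_cont cptM hausM _ S); have [] := contact_a.
Qed.

Lemma PsiH_lim_cvg : cvg_uniformly PH PsiH_lim.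
Proof.
apply/uniform_cvg_normP => e e0; have e2 : 0 < e / 2 by rewrite divr_gt0.
have [N HN] := PsiH_lim_close e2; exists N => // k /= Nk [t x] [t01 _].
by apply: le_lt_trans (HN k Nk t x t01) _; lra.
Qed.

Lemma limit_system : continuous_contact_system a Psi_lim PsiH_lim Psih_lim /\ Psi_lim 1 = Phi 1.
Proof.
have [cPhi hPhi] := isoPhi.
have S k := Psi_contact cptM hausM a_neq0 sys inv zi_unit zi0 z_unit z0 k.
have G k := Psi_system cptM hausM a_neq0 sys inv zi_unit z_unit k.
have cHL := uniform_limit_clamp PsiH_cont PsiH_lim_cvg.
split; last by apply/funext => x; rewrite /Psi_lim ltxx.
split.
- split.
    apply: unclamp; apply: (uniform_limit_clamp _ Psi_lim_cvg) => k.
    have [[cP _] _ _ _ _] := G k.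
    move=> p; apply: (@continuous_comp _ _ _ (fun p : R * M => (clamp p.1, p.2)) (fun p : R * M => P k p.1 p.2)); last exact: cP.
    apply: continuous_pair_at; last exact: continuous_snd.
    by apply: continuous_comp; [exact: continuous_fst|exact: clamp_continuous].
  move=> t t01; have [t1|t1] := ltP t 1; last first.
    have -> : Psi_lim t = Phi 1 by apply/funext => x; rewrite /Psi_lim ltNge t1.
    by apply: hPhi; rewrite /= in_itv /= lexx ler01.
  have -> : Psi_lim t = P (kappa t) t by apply/funext => x; rewrite /Psi_lim t1.
  have [gP gI /(_ t) [PK IK] _ _] := G (kappa t).
  split; first by have [] := gpath_smooth_map t gP.
  by exists (PI (kappa t) t); split=> //; have [] := gpath_smooth_map t gI.
- exact: unclamp.
- exists P, PH, Ph; split; [exact: S|exact: Psi_lim_cvg|exact: Psih_lim_cvg|].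
  (* Division by 3 compensates the factor in [norm_oo_le]. *)
  apply/cvgrPdist_le => e e0; have e3 : 0 < e / 3 by rewrite divr_gt0.
  have [N HN] := PsiH_lim_close e3; exists N => // k /= Nk.
  have /andP [n0 n1] : 0 <= norm_oo a (fun t x => PsiH_lim t x - PH k t x) <= 3 * (e / 3).
    apply: norm_oo_le; first exact: ltW.
      move=> t t01.
      have c1 := @cont_fiber _ _ (fun t => PsiH_lim (clamp t)) t cHL.
      have c2 := @cont_fiber _ _ (fun t => PH k (clamp t)) t (@PsiH_cont k).
      rewrite (clamp_id t01) in c1; rewrite (clamp_id t01) in c2.
      by move=> x; apply: contB; [exact: c1|exact: c2].
    by move=> t x; exact: HN.
  by rewrite sub0r normrN ger0_norm //; lra.
Qed.

End Kappa.
End Limit.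

(** * From topological to continuous systems *)

Section Inclusions.
Variables (R : realType) (n : nat) (M : uniformType).
Variable A : atlas R n.*2.+1 M.
Variable a : chart_index A -> 'rV[R]_n.*2.+1 -> 'cV[R]_n.*2.+1.
Hypothesis cptM : compact [set: M].
Hypothesis hausM : hausdorff_space M.
Hypothesis contact_a : contact_form a.
Hypothesis M0 : [set: M] !=set0.
Notation mu := (@lebesgue_measure R).

(** Every term of the volume coefficient contains a component of the contact form, so the
    coefficient would vanish wherever the form does. *)
Lemma contact_form_neq0 i y : chart_img i y -> exists v, pairing v (a i y) != 0.
Proof.
move=> yi; apply: contrapT => h; have [_ /(_ i y yi) /eqP] := contact_a; apply.
have a0 l : a i y l 0 = 0.
  apply: contrapT => /eqP al; apply: h; exists (delta_mx 0 l).
  by rewrite /pairing -rowE mxE.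
by rewrite /volume_coef big1 ?mulr0 // => s _; rewrite a0 mulr0 mul0r.
Qed.

Lemma cont_bounded_param (F : R -> M -> R) : continuous (fun p : R * M => F p.1 p.2) ->
  exists B, forall t x, `[0, 1]%classic t -> `|F t x| <= B.
Proof.
move=> cF; have cpt : compact ((fun p : R * M => F p.1 p.2) @` (`[0, 1] `*` setT)).
  apply: continuous_compact; first exact: continuous_subspaceT.
  by apply: compact_setX => //; exact: segment_compact.
have [B [_ HB]] := compact_bounded cpt.
exists (`|B| + 1) => t x t01.
have B1 : B < `|B| + 1 by apply: le_lt_trans (ler_norm _) _; rewrite ltrDl.
by apply: (HB _ B1); exists (t, x).
Qed.

Lemma uniform_bound (F : nat -> R -> M -> R) (f : R -> M -> R) :
  continuous (fun p : R * M => f (clamp p.1) p.2) -> cvg_uniformly F f ->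
  exists B N, forall k t x, (N <= k)%N -> `[0, 1]%classic t -> `|F k t x| <= B.
Proof.
move=> cf /uniform_cvg_normP/(_ 1 ltr01) [N _ HN].
have [B HB] := cont_bounded_param (F := fun t => f (clamp t)) cf.
exists (B + 1), N => k t x Nk t01.
have h1 := HB t x t01; rewrite (clamp_id t01) in h1.
have h2 : `|f t x - F k t x| < 1 := HN k Nk (t, x) (conj t01 I).
rewrite -(subrK (f t x) (F k t x)) addrC; apply: le_trans (ler_normD _ _) _.
by rewrite lerD // distrC ltW.
Qed.

Lemma clamped_norm_1oo (F G : R -> M -> R) :
  norm_1oo a (fun t x => F t x - G (clamp t) x) = norm_1oo a (fun t x => F t x - G t x).
Proof.
by apply: eq_integral => t; rewrite inE => t01; rewrite clamp_id.
Qed.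

Lemma Homeo_1oo_sub : Homeo_1oo a `<=` Homeo_oo a.
Proof.
move=> phi [Phi [H [h [[iso LH [P0 [H0 [h0 [sys0 cvP cvh cvH]]]]] <-]]]].
have a_neq0 := contact_form_neq0; have [smooth_a _] := contact_a.
pose G i t := H0 i (clamp t).
have cG i : continuous (fun p : R * M => G i p.1 p.2) := hamiltonian_cont cptM hausM smooth_a (sys0 i).
have cvG : norm_1oo a (fun t x => H t x - G i t x) @[i --> \oo] --> 0%E.
  by rewrite (_ : (fun i => _) = fun i => norm_1oo a (fun t x => H t x - H0 i t x)) //; apply/funext => i; exact: clamped_norm_1oo.
have e4 k : 0 < (4 ^+ k)^-1 :> R by rewrite invr_gt0 exprn_gt0.
have ex1 k : exists N, forall i j, (N <= i)%N -> (N <= j)%N ->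
    \int[mu]_(t in `[0, 1]) snorm (fun x => G i t x - G j t x) <= (4 ^+ k)^-1.
  exact: (L1_cauchy cptM contact_a M0 LH cG cvG (e4 k)).
have [N HN] := choice ex1.
have [B [NB HB]] := uniform_bound (conformal_limit_cont contact_a a_neq0 sys0 cvh) cvh.
(* [NB] secures the bound [B] on the conformal factors, the sum dominates [N k] for both [nu k] and
   [nu k.+1], and the last summand makes [nu k] tend to infinity. *)
pose nu k := (NB + \sum_(j < k.+1) N j + k)%N.
have nuNB k : (NB <= nu k)%N by rewrite /nu -addnA leq_addr.
have nuk k : (k <= nu k)%N by rewrite /nu leq_addl.
have nuN k : (N k <= nu k)%N.
  apply: leq_trans (leq_addr _ _); apply: leq_trans (leq_addl _ _).
  by rewrite big_ord_recr leq_addl.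
have nuS k : (N k <= nu k.+1)%N.
  apply: leq_trans (nuN k) _; apply: leq_add => //.
  by rewrite leq_add2l [leqRHS]big_ord_recr leq_addr.
pose Phi_ k := P0 (nu k); pose H_ k := H0 (nu k); pose h_ k := h0 (nu k).
have sys k : smooth_contact_system a (Phi_ k) (H_ k) (h_ k) by exact: sys0.
have ex2 k : exists Th : R -> M -> M, forall t, `[0, 1]%classic t ->
    [/\ smooth_map A (Th t), cancel (Phi_ k t) (Th t) & cancel (Th t) (Phi_ k t)].
  have ex3 (t : R) : exists psi, `[0, 1]%classic t ->
      [/\ smooth_map A psi, cancel (Phi_ k t) psi & cancel psi (Phi_ k t)].
    have [t01|nt] := pselect (`[0, 1]%classic t); last by exists id.
    by have [[_ /(_ t t01) [[_ [psi hpsi]] _] _] _ _] := sys k; exists psi.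
  by have [Th hTh] := choice ex3; exists Th.
have [Th inv] := choice ex2.
have [C C0 HC] := @reparametrization R.
(* For the initial run along [Phi_ 0] no estimate is required, so any time change will do; speed 0
   and tolerance 1 are arbitrary. *)
have [zi [zi_unit zi0 zi1 Dzi _]] := HC (fun=> 0) 0 (node R 0) 1 (@cst_continuous _ _ 0) (fun=> lexx 0) (node_gt0 R 0) ltr01.
pose u k t := snorm (fun x => G (nu k.+1) t x - G (nu k) t x).
have bG k t : bounded (fun x => G (nu k.+1) t x - G (nu k) t x).
  by apply: cont_bounded => //; apply: contB_fun; exact: cont_fiber.
have cu k : continuous (u k).
  by apply: (@snorm_cont _ _ cptM M0 (fun t x => G (nu k.+1) t x - G (nu k) t x)) => p; apply: (@contB _ _ (fun p : R * M => G (nu k.+1) p.1 p.2) (fun p : R * M => G (nu k) p.1 p.2)); exact: cG.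
have u0 k t : 0 <= u k t by exact: snorm_ge0.
have ex4 k := HC (u k) (node R k) (node R k.+1) (4 ^+ k)^-1 (@cu k) (u0 k) (node_ltS R k) (e4 k).
have [z hz] := choice ex4.
have z_unit k : unit_time (z k) by have [] := hz k.
have HHC k t y : `|'D_1 (z k : R -> R) t| * `|H_ k.+1 (z k t) y - H_ k (z k t) y| <= 8 * C / 2 ^+ k.
  have [_ zk] := z_unit k; have [_ _ _ _ /(_ t) b] := hz k.
  apply: (@le_trans _ _ (`|'D_1 (z k : R -> R) t| * u k (z k t))).
    apply: ler_wpM2l; first exact: normr_ge0.
    by apply: le_trans _ (snorm_ub y (bG k (z k t))); rewrite /G (clamp_id (zk t)).
  apply: le_trans b _; rewrite node_gap invrK.
  have i4 : \int[mu]_(s in `[0, 1]) u k s <= (4 ^+ k)^-1 by exact: HN.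
  (* One [4^-k] bounds the integral and the other is the tolerance given to [reparametrization]. The
     factor [2 ^+ k.+2] is the inverse length of the time interval, which yields
     [8 * C / 2 ^+ k]. *)
  apply: (@le_trans _ _ (C * ((4 ^+ k)^-1 + (4 ^+ k)^-1) * 2 ^+ k.+2)).
    by rewrite ler_wpM2r ?exprn_ge0 // ler_wpM2l ?(ltW C0) // lerD2r.
  have -> : (4 : R) ^+ k = 2 ^+ k * 2 ^+ k by rewrite -exprMn; congr (_ ^+ k); lra.
  rewrite !exprS; have w0 : 2 ^+ k != 0 :> R by rewrite expf_neq0.
  by set w := 2 ^+ k in w0 *; rewrite le_eqVlt; apply/orP; left; apply/eqP; field.
have [kappa kappaP] := node_choice R.
have [S1 S2] := limit_system cptM hausM contact_a M0 a_neq0 sys inv zi_unit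
  (zi0 0 (lexx 0)) zi1 (fun t ht => Dzi t (or_intror ht)) z_unit
  (fun k => let: And5 _ p _ _ _ := hz k in p) (fun k => let: And5 _ _ p _ _ := hz k in p)
  (fun k => let: And5 _ _ _ p _ := hz k in p) iso
  (cvg_uniformly_sub nuk cvP) (cvg_uniformly_sub nuk cvh)
  (fun k s y s01 => HB (nu k) s y (nuNB k) s01)
  (mulr_ge0 (ler0n R 8) (ltW C0)) HHC kappaP.
by do 3 eexists; split; [exact: S1|exact: S2].
Qed.

End Inclusions.

(** * From continuous to topological systems *)

Section ReverseInclusion.
Variables (R : realType) (n : nat) (M : uniformType).
Variable A : atlas R n.*2.+1 M.
Variable a : chart_index A -> 'rV[R]_n.*2.+1 -> 'cV[R]_n.*2.+1.
Hypothesis cptM : compact [set: M].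
Hypothesis hausM : hausdorff_space M.
Hypothesis contact_a : contact_form a.
Hypothesis M0 : [set: M] !=set0.
Notation mu := (@lebesgue_measure R).

(** Applied to contact norms, whose dependence on time is not known to be measurable; the upper
    bound therefore goes through [integral_lower_bound] with an empty null set. *)
Lemma unit_integral_le (c : R -> R) (e : R) :
  (forall t, 0 <= c t) -> (forall t, `[0, 1]%classic t -> c t <= e) ->
  (0 <= \int[mu]_(t in `[0%R, 1%R]) (c t)%:E <= e%:E)%E.
Proof.
move=> c0 ce; apply/andP; split; first by apply: integral_ge0 => t _; rewrite lee_fin.
apply: (@le_trans _ _ (\int[mu]_(t in `[0%R, 1%R]) (cst e%:E t))%E).
  apply: (@integral_lower_bound _ _ R mu `[0, 1]%classic set0 (fun t => (c t)%:E)) => //.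
  by move=> t t01 _; rewrite lee_fin; exact: ce.
have mu1 : mu (`[0, 1]%classic : set R) = 1%E.
  by rewrite lebesgue_measure_itv /= lte_fin ltr01 sube0.
by rewrite integral_cst ?measurable_itv // -[X in (_ * X)%E]/(mu `[0, 1]%classic) mu1 mule1.
Qed.

(** The simple paths sample [H] at the left end points of a subdivision; continuity in time, uniform
    over the compact space, gives convergence at every time. *)
Lemma L1C0_continuous (H : R -> M -> R) :
  {within `[0, 1] `*` [set: M], continuous (fun p : R * M => H p.1 p.2)} -> L1C0 H.
Proof.
move=> /jcont_clamp cH.
have cHt t : continuous (H (clamp t)) by exact: (@cont_fiber _ _ (fun t => H (clamp t)) t cH).
(* The intervals are half-open on the right, so one more interval, starting at 1, is needed to catch
   [t = 1]. *)
pose E k (i : 'I_k.+2) : set R := `[i%:R / k.+1%:R, i.+1%:R / k.+1%:R[%classic.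
pose S k t x := \sum_(i < k.+2) \1_(E k i) t * H (clamp (i%:R / k.+1%:R)) x.
have ES k t : `[0, 1]%classic t -> exists2 s, `|t - s| <= k.+1%:R^-1 & forall x, S k t x = H (clamp s) x.
  rewrite /= in_itv /= => /andP[t0 t1]; have k0 : 0 < k.+1%:R :> R by rewrite ltr0n.
  have tk0 : 0 <= t * k.+1%:R by rewrite mulr_ge0 // ltW.
  have /andP[h1 h2] := truncn_itv tk0; set m := Num.truncn _ in h1 h2.
  have mk : (m < k.+2)%N.
    rewrite ltnS -(ler_nat R); apply: le_trans h1 _.
    by rewrite -[leRHS]mul1r ler_wpM2r // ltW.
  exists (m%:R / k.+1%:R).
    rewrite ler_norml; apply/andP; split.
      apply: le_trans (_ : 0 <= _); first by rewrite oppr_le0 invr_ge0 ltW.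
      by rewrite subr_ge0 ler_pdivrMr.
    by rewrite lerBlDl -[X in _ + X]mul1r -mulrDl natr1 ler_pdivlMr // ltW.
  move=> x; rewrite /S (bigD1 (Ordinal mk)) //= big1 ?addr0.
    by rewrite indicE mem_set ?mul1r // /E /= in_itv /= ler_pdivrMr // h1 ltr_pdivlMr.
  move=> i im; rewrite indicE memNset ?mul0r // /E /= in_itv /= ler_pdivrMr // ltr_pdivlMr // => /truncn_def mi.
  by move: im; rewrite -val_eqE /= -/m in mi *; rewrite -mi eqxx.
exists S; split.
- move=> k; exists k.+2, (E k), (fun i : 'I_k.+2 => H (clamp (i%:R / k.+1%:R))); split=> // i.
  exact: measurable_itv.
- apply: aeW => t t01; apply/uniform_cvg_normP => e e0; have e2 : 0 < e / 2 by rewrite divr_gt0.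
  have [r /= r0 Hr] := @tube_continuous R R M setT (fun p => H (clamp p.1) p.2) t (e / 2) cptM cH e2.
  exists (Num.truncn r^-1) => // k /= rk x _.
  have [s ts ->] := ES k t t01.
  have sr : `|t - s| < r.
    apply: le_lt_trans ts _; rewrite -[r]invrK ltf_pV2 ?posrE ?invr_gt0 ?ltr0n //.
    by apply: lt_le_trans (truncnS_gt _) _; rewrite ler_nat.
  have := Hr s sr x I; rewrite /= (clamp_id t01) distrC => h; apply: le_lt_trans h _; lra.
- have [B HB] := cont_bounded_param (F := fun t => H (clamp t)) cptM cH.
  have bH t : bounded (H (clamp t)) by exact: cont_bounded.
  have /andP [_ h] : (0 <= \int[mu]_(t in `[0%R, 1%R]) (snorm (H (clamp t)))%:E <= B%:E)%E.
    apply: unit_integral_le => [t|t t01]; first exact: snorm_ge0.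
    by apply: snorm_le => // x; exact: HB.
  apply: le_lt_trans (ltry B); apply: le_trans h; rewrite le_eqVlt; apply/orP; left; apply/eqP.
  by apply: eq_integral => t; rewrite inE => t01; rewrite clamp_id.
Qed.

(** The approximating sequence is kept: over the unit interval the integral of the norms is at most
    their supremum. The joint continuity of the differences makes this supremum an actual bound. *)
Lemma Homeo_oo_sub : Homeo_oo a `<=` Homeo_1oo a.
Proof.
move=> phi [Phi [H [h [[iso cH [P0 [H0 [h0 [sys cvP cvh cvH]]]]] <-]]]].
have [smooth_a _] := contact_a.
exists Phi, H, h; split=> //; split=> //; first exact: L1C0_continuous.
exists P0, H0, h0; split=> //.
have cHc := jcont_clamp cH.
pose D i t x := H (clamp t) x - H0 i (clamp t) x.
have cD i : continuous (fun p : R * M => D i p.1 p.2).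
  move=> p; apply: (@contB _ _ (fun p : R * M => H (clamp p.1) p.2) (fun p : R * M => H0 i (clamp p.1) p.2)).
    exact: cHc.
  exact: (hamiltonian_cont cptM hausM smooth_a (sys i)).
have bounds i t := contact_norm_bounds cptM contact_a M0 (@cont_fiber _ _ (D i) t (cD i)).
have [x0 _] := M0.
have c0 i t : 0 <= contact_norm a (D i t).
  by apply: le_trans (normr_ge0 _) (proj1 (bounds i t) x0).
have cn i t : `[0, 1]%classic t -> contact_norm a (D i t) <= norm_oo a (fun t x => H t x - H0 i t x).
  move=> t01; apply: ub_le_sup; last by exists t => //; rewrite /D (clamp_id t01).
  have [B HB] := cont_bounded_param (F := D i) cptM (cD i).
  exists (3 * B) => _ [s s01 <-]; have [_ /(_ B)] := bounds i s.
  by rewrite /D (clamp_id s01); apply=> x; have := HB s x s01; rewrite /D (clamp_id s01).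
apply: (@squeeze_cvge _ _ _ _ (fun=> 0%E) _ (fun i => (norm_oo a (fun t x => H t x - H0 i t x))%:E)).
- apply: nearW => i; rewrite -clamped_norm_1oo.
  have -> : norm_1oo a (fun t x => H t x - H0 i (clamp t) x) = norm_1oo a (D i).
    by apply: eq_integral => t; rewrite inE => t01; rewrite /D clamp_id.
  by apply: unit_integral_le => // t; exact: cn.
- exact: cvg_cst.
- by apply: cvg_EFin; [exact: nearW|exact: cvH].
Qed.

End ReverseInclusion.

Theorem theorem5p4 (R : realType) (n : nat) (M : uniformType)
    (A : atlas R n.*2.+1 M)
    (a : chart_index A -> 'rV[R]_n.*2.+1 -> 'cV[R]_n.*2.+1) :
  [set: M] !=set0 -> compact [set: M] -> hausdorff_space M ->
  connected [set: M] -> contact_form a ->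
  Homeo_1oo a = Homeo_oo a.
Proof.
move=> M0 cptM hausM _ contact_a; apply/seteqP; split.
- exact: Homeo_1oo_sub.
- exact: Homeo_oo_sub.
Qed.
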